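(* Let $d\ge 1$. (i) Let $0\le q<p$ be integers and let the data $b,c,A_1,\dots,A_d,\Lambda$ satisfy the conditions in the definition of a causal CARMA$(p,q)$ random field on $\mathbb{R}^d$ (see context). Then the CARMA$(p,q)$ random field $(Y(t))_{t\in\mathbb{R}^d}$ exists, i.e. the stochastic integrals defining $X(t)$, $t\in\mathbb{R}^d$, exist, and $Y$ is a mild solution to the system $$Y(t)=b^\top X(t),\qquad (I_p\partial_d-A_d)\cdots(I_p\partial_1-A_1)X(t)=c\,\dot L(t),\qquad t\in\mathbb{R}^d .$$ (ii) The same conclusion holds for the causal GCARMA random field when the data $p,b,c,A_1,\dots,A_d,\Lambda$ satisfy the conditions in the definition of a causal GCARMA random field on $\mathbb{R}^d$.
   Context: Lévy bases. On a fixed complete probability space, a homogeneous Lévy basis $\Lambda$ on $\mathbb{R}^d$ with characteristics $(\beta,\sigma^2,\nu)$ ($\beta\in\mathbb{R}$, $\sigma\ge0$, $\nu$ a Lévy measure on $\mathbb{R}$) is the family indexed by bounded Borel sets $A\subset\mathbb{R}^d$, $$\Lambda(A)=\beta\,\mathrm{Leb}(A)+\sigma W(A)+\int_{\mathbb{R}^d}\int_{\mathbb{R}}1_A(s)z1_{\{|z|\le1\}}(\mathfrak p-\mathfrak q)(ds,dz)+\int_{\mathbb{R}^d}\int_{\mathbb{R}}1_A(s)z1_{\{|z|>1\}}\mathfrak p(ds,dz),$$ where $W$ is Gaussian white noise on $\mathbb{R}^d$ with $\mathrm{Var}(W(A))=\mathrm{Leb}(A)$ and $\mathfrak p$ is a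 Poisson random measure on $\mathbb{R}^d\times\mathbb{R}$ with intensity $\mathfrak q=\mathrm{Leb}\otimes\nu$, independent of $W$. For measurable deterministic $g:\mathbb{R}^d\to\mathbb{R}$, $\int g\,d\Lambda$ is the Rajput–Rosiński integral (limit in probability of integrals of approximating simple functions); it is well defined if and only if $\int_{\mathbb{R}^d}|\beta g(s)+\int_{\mathbb{R}}(zg(s)1_{\{|zg(s)|\le1\}}-g(s)z1_{\{|z|\le1\}})\nu(dz)|ds<\infty$, $\int_{\mathbb{R}^d}\sigma^2|g(s)|^2ds<\infty$ and $\int_{\mathbb{R}^d}\int_{\mathbb{R}}(1\wedge|zg(s)|^2)\nu(dz)ds<\infty$. Vector-valued integrands are integrated componentwise. The Lévy sheet of $\Lambda$ is $L(t)=\Lambda(\{(s_1t_1,\dots,s_dt_d)^\top: s_i\in[0,1]\})$, and $\dot L=\partial_1\cdots\partial_d L$ formally. Companion matrix. The companion matrix of a monic polynomial $a(z)=z^p+\alpha_1z^{p-1}+\dots+\alpha_p$ is the $p\times p$ matrix with ones on the superdiagonal, last row $(-\alpha_p,-\alpha_{p-1},\dots,-\alpha_1)$ and zeros elsewhere (for $p=1$: $(-\alpha_1)$). GCARMA. Let $p\ge1$, $b,c\in\mathbb{R}^p$, $A_1,\dots,A_d\in\mathbb{R}^{p\times p}$ with all eigenvalues having strictly negative real parts, and $\Lambda$ a homogeneous Lévy basis on $\mathbb{R}^d$ with $\int_{\mathbb{R}}\log(|z|)^d1_{\{|z|>1\}}\nu(dz)<\infty$. $(Y(t))_{t\in\mathbb{R}^d}$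 is a causal GCARMA random field if $$Y(t)=b^\top X(t),\quad X(t)=\int_{-\infty}^{t_1}\cdots\int_{-\infty}^{t_d}e^{A_1(t_1-s_1)}\cdots e^{A_d(t_d-s_d)}c\,\Lambda(ds),\quad t\in\mathbb{R}^d.$$ CARMA. For integers $0\le q<p$, $Y$ is a causal CARMA$(p,q)$ random field if it is given by the same equations where $b=(b_0,\dots,b_{p-1})^\top\in\mathbb{R}^p$ with $b_q\ne0$ and $b_i=0$ for $i>q$, $c=(0,\dots,0,1)^\top\in\mathbb{R}^p$, $A_i$ is the companion matrix of a real monic polynomial $a_i$ of degree $p$ whose roots have strictly negative real parts ($i=1,\dots,d$), and $\Lambda$ satisfies the same log-moment condition. Mild solution. Let $\mathfrak D_d=(I_p\partial_d-A_d)\cdots(I_p\partial_1-A_1)$, where $I_p$ is the $p\times p$ identity matrix. A matrix $G$ of real-valued distributions on $\mathbb{R}^d$, of size $p\times p$, is a fundamental solution of $\mathfrak D_d$ to the right if $\mathfrak D_dG=I_p\delta_0$ in the distributional sense. If $G$ is such a fundamental solution with entries in $L^1_{\mathrm{loc}}(\mathbb{R}^d)$ and $(G*(c\Lambda))(t):=\int_{\mathbb{R}^d}G(t-s)c\,\Lambda(ds)$ exists for all $t\in\mathbb{R}^d$, then $b^\top(G*(c\Lambda))$ is called a mild solution to the system. *)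

(* Defs.v *)
From HB Require Import structures.
From mathcomp Require Import all_boot all_order all_algebra.
From mathcomp Require Import complex.
From mathcomp Require Import all_classical all_reals all_analysis.
From mathcomp Require Import measurable_realfun.

Set Implicit Arguments.
Unset Strict Implicit.
Unset Printing Implicit Defensive.

Import Order.TTheory GRing.Theory Num.Theory.
Import numFieldNormedType.Exports.
Import HBSimple.

Local Open Scope classical_set_scope.
Local Open Scope ring_scope.

Definition rV_display : measure_display. Proof. exact: default_measure_display. Qed.

Section measurable_rV.
Context {R : realType} {n : nat}.

Let coord (i : 'I_n) (v : 'rV[R]_n) : R := v 0 i.

Let rV_set0 : g_sigma_preimage coord set0.
Proof. exact: sigma_algebra0. Qed.

Let rV_setC A : g_sigma_preimage coord A -> g_sigma_preimage coord (~` A).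
Proof. exact: sigma_algebraC. Qed.

Let rV_bigcup (F : _^nat) : (forall i, g_sigma_preimage coord (F i)) ->
  g_sigma_preimage coord (\bigcup_i (F i)).
Proof. exact: sigma_algebra_bigcup. Qed.

HB.instance Definition _ := @isMeasurable.Build rV_display 'rV[R]_n
  (g_sigma_preimage coord) rV_set0 rV_setC rV_bigcup.

Lemma measurable_coord (i : 'I_n) :
  measurable_fun [set: 'rV[R]_n] (fun v : 'rV[R]_n => v 0 i).
Proof.
move=> _ Y mY; rewrite setTI; apply: sub_sigma_algebra => /=.
rewrite -bigcup_seq/=; exists i => /=; first by rewrite mem_index_enum.
by exists Y => //; rewrite setTI.
Qed.

Lemma measurable_fun_rV d (T : measurableType d) (f : T -> 'rV[R]_n) :
  (forall i, measurable_fun [set: T] (fun x => f x 0 i)) ->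
  measurable_fun [set: T] f.
Proof.
move=> mf.
suff H : g_sigma_preimage coord `<=`
    [set B | measurable (f @^-1` B)].
  by move=> _ B mB; rewrite setTI; exact: H.
apply: smallest_sub.
  split => [|B mB|F mF] /=.
  - by rewrite preimage_set0.
  - by rewrite setTD preimage_setC; exact: measurableC.
  - by rewrite preimage_bigcup; apply: bigcupT_measurable.
move=> B; rewrite -bigcup_seq => -[i _ [C mC <-]] /=.
by rewrite setTI -[X in measurable X]setTI; exact: mf.
Qed.

End measurable_rV.

(* The product sigma-algebra on 'rV[R]_n is the Borel sigma-algebra of its
   topology. *)
Lemma measurable_rV_borel (R : realType) n :
  (measurable : set (set 'rV[R]_n)) = <<s [set U : set 'rV[R]_n | open U] >>.
Proof.
apply/seteqP; split.
  apply: smallest_sub; first exact: smallest_sigma_algebra.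
  move=> B; rewrite -bigcup_seq => -[i _ [C mC <-]] /=; rewrite setTI.
  have {mC} : (@ocitv R).-sigma.-measurable C by [].
  rewrite RGenOpens.measurableE; move: C.
  pose coord (v : 'rV[R]_n) : R := v 0 i.
  suff H : <<s @RGenOpens.G R >> `<=`
      [set C | <<s [set U : set 'rV[R]_n | open U] >> (coord @^-1` C)].
    exact: H.
  apply: smallest_sub.
    split => [|C mC|F mF] /=.
    - by rewrite preimage_set0; exact: sigma_algebra0.
    - by rewrite setTD preimage_setC; exact: sigma_algebraC.
    - by rewrite preimage_bigcup; exact: sigma_algebra_bigcup.
  move=> _ [x [y ->]] /=; apply: sub_sigma_algebra => /=.
  apply: open_comp; last exact: interval_open.
  by move=> v _; exact: coord_continuous.
apply: smallest_sub; first exact: sigma_algebra_measurable.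
move=> U oU.
pose q2r (q : 'rV[rat]_n) : 'rV[R]_n := map_mx ratr q.
pose D := [set z : 'rV[rat]_n * nat | ball (q2r z.1) z.2.+1%:R^-1 `<=` U].
have -> : U = \bigcup_(z in D) ball (q2r z.1) z.2.+1%:R^-1.
  apply/seteqP; split => [x Ux|x [z Dz zx]]; last exact: Dz.
  move: oU; rewrite openE => /(_ _ Ux)/nbhs_ballP[e e0 xeU].
  pose k := Num.truncn (2 / e).
  have k0 : (0 : R) < k.+1%:R^-1 by rewrite invr_gt0.
  have ke : k.+1%:R^-1 + k.+1%:R^-1 <= e.
    rewrite -[leLHS]mulr2n -[_ *+ 2]mulr_natl ler_pdivrMr//.
    by rewrite mulrC -ler_pdivrMr// ltW// truncnS_gt.
  have hq i : {q : rat | ball (x 0 i) k.+1%:R^-1 (ratr q : R)}.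
    apply: cid; have : x 0 i - k.+1%:R^-1 < x 0 i + k.+1%:R^-1.
      by rewrite ltrBlDr -addrA ltrDl addr_gt0.
    move=> /rat_in_itvoo[q]; rewrite in_itv/= => /andP[q1 q2]; exists q.
    by rewrite -ball_normE/= ltr_distlC q1 q2.
  have bq : ball x k.+1%:R^-1 (q2r (\row_i projT1 (hq i))).
    by split=> // i j; rewrite ord1 !mxE; exact: projT2 (hq j).
  exists (\row_i projT1 (hq i), k) => /=; last exact: ball_sym.
  move=> y /= hy; apply: xeU; apply: (le_ball ke).
  exact: ball_triangle bq hy.
rewrite bigcup_mkcond; apply: countable_bigcupT_measurable => // z.
case: ifPn => // _.
have -> : ball (q2r z.1) z.2.+1%:R^-1 =
    \bigcap_(i in [set: 'I_n])
      ((fun v : 'rV[R]_n => v 0 i) @^-1` ball (q2r z.1 0 i) z.2.+1%:R^-1).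
  apply/seteqP; split => [v [_ h] i _|v h]; first exact: h.
  by split=> [|i j]; [rewrite invr_gt0|rewrite ord1; exact: h].
apply: fin_bigcap_measurable => // i _; rewrite -[X in measurable X]setTI.
by apply: measurable_coord => //; apply: measurable_ball.
Qed.


Section lebesgue_rV.
Context {R : realType}.

Definition rV_cons n (x : 'rV[R]_n * measurableTypeR R) : 'rV[R]_n.+1 :=
  \row_(i < n.+1) if unlift ord0 i is Some j then x.1 0 j else x.2.

Lemma measurable_rV_cons n : measurable_fun [set: 'rV[R]_n * measurableTypeR R] (@rV_cons n).
Proof.
apply: measurable_fun_rV => i.
under eq_fun do rewrite mxE.
case: unliftP => [j _|_]; last exact: measurable_snd.
exact: measurableT_comp (measurable_coord j) measurable_fst.
Qed.

Definition lebesgue_succ n (mu : {measure set 'rV[R]_n -> \bar R}) :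
    set 'rV[R]_n.+1 -> \bar R :=
  pushforward (mu \x (@lebesgue_measure R))%E (@rV_cons n).

Section lebesgue_succ_measure.
Variables (n : nat) (mu : {measure set 'rV[R]_n -> \bar R}).

Let push : {measure set 'rV[R]_n.+1 -> \bar R} :=
  measure_function_pushforward__canonical__measure_function_Measure
    (mu \x (@lebesgue_measure R))%E (@measurable_rV_cons n).

HB.instance Definition _ := isMeasure.Build _ _ _ (lebesgue_succ mu)
  (measure0 push) (measure_ge0 push) (@measure_semi_sigma_additive _ _ _ push).

End lebesgue_succ_measure.

Fixpoint lebesgue_rV n : {measure set 'rV[R]_n -> \bar R} :=
  match n with
  | 0 => dirac (0 : 'rV[R]_0)
  | m.+1 => lebesgue_succ (lebesgue_rV m)
  end.

Lemma lebesgue_rV_box n (A : 'I_n -> set R) : (forall i, measurable (A i)) ->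
  lebesgue_rV n [set v | forall i, A i (v 0 i)] =
  (\prod_(i < n) lebesgue_measure (A i))%E.
Proof.
elim: n A => [|n IH] A mA /=.
  by rewrite big_ord0 diracE mem_set//= => -[].
rewrite /lebesgue_succ /pushforward.
have -> : rV_cons (n:=n) @^-1` [set v | forall i, A i (v 0 i)] =
    [set v : 'rV[R]_n | forall i, A (lift ord0 i) (v 0 i)] `*`
    (A ord0 : set (measurableTypeR R)).
  apply/seteqP; split=> [[v x] /= h|[v x] [/= h1 h2] i].
    split=> [i /=|/=]; first by have := h (lift ord0 i); rewrite mxE liftK.
    by have := h ord0; rewrite mxE unlift_none.
  by rewrite mxE; case: unliftP => [j ->|->].
have mE : measurable [set v : 'rV[R]_n | forall i, A (lift ord0 i) (v 0 i)].
  have -> : [set v : 'rV[R]_n | forall i, A (lift ord0 i) (v 0 i)] =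
      \bigcap_(i in [set: 'I_n])
        ((fun v : 'rV[R]_n => v 0 i) @^-1` A (lift ord0 i)).
    by apply/seteqP; split=> [v h i _|v h i]; exact: h.
  apply: fin_bigcap_measurable => // i _.
  by rewrite -[X in measurable X]setTI; exact: measurable_coord.
rewrite product_measure1E//; last exact: mA.
by rewrite big_ord_recl muleC; congr (_ * _)%E; exact: IH.
Qed.

End lebesgue_rV.

Section random_measures.
Context {dT : measure_display} {T : measurableType dT} {R : realType}.
Variables (P : probability T R) (d : nat).

Definition bounded_borel (A : set 'rV[R]_d) := measurable A /\ bounded_set A.

(* normal_prob m 0 is not the Dirac mass at m (it is the uniform law on
   [0, 1]), hence the case distinction. *)
Definition centered_gaussian (v : R) : set R -> \bar R :=
  if v == 0 then dirac (0 : R) else normal_prob 0 (Num.sqrt v).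

(* Centered Gaussian process with covariance Leb (A `&` B): joint Gaussianity
   is expressed through all finite linear combinations. *)
Definition gaussian_white_noise (W : set 'rV[R]_d -> {RV P >-> R}) :=
  forall (n : nat) (a : 'I_n -> R) (A : 'I_n -> set 'rV[R]_d),
    (forall i, bounded_borel (A i)) ->
    forall B : set R, measurable B ->
      P ((fun w => \sum_(i < n) a i * W (A i) w) @^-1` B) =
      centered_gaussian (\sum_(i < n) \sum_(j < n)
        a i * a j * fine (lebesgue_rV d (A i `&` A j))) B.

(* The library's poisson_pmf is 1 for every k at rate 0, hence the explicit
   formula. *)
Definition poisson_random_measure (q : set ('rV[R]_d * R) -> \bar R)
    (p : R.-ker T ~> ('rV[R]_d * R)%type) :=
  [/\ forall B, measurable B -> (q B < +oo)%E -> forall k : nat,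
        P [set w | p w B = (k%:R)%:E] =
        (expR (- fine (q B)) * fine (q B) ^+ k / k`!%:R)%:E,
      forall B, measurable B -> q B = +oo%E -> P [set w | p w B = +oo%E] = 1%E &
      forall (n : nat) (B : 'I_n -> set ('rV[R]_d * R)),
        (forall i, measurable (B i)) -> trivIset [set: 'I_n] B ->
        forall C : 'I_n -> set (\bar R), (forall i, measurable (C i)) ->
          P [set w | forall i, C i (p w (B i))] =
          (\prod_(i < n) P [set w | C i (p w (B i))])%E].

Definition independent_noises (W : set 'rV[R]_d -> {RV P >-> R})
    (p : R.-ker T ~> ('rV[R]_d * R)%type) :=
  forall (m n : nat) (A : 'I_m -> set 'rV[R]_d) (B : 'I_n -> set ('rV[R]_d * R)),
    (forall i, bounded_borel (A i)) -> (forall j, measurable (B j)) ->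
    forall (C : 'I_m -> set R) (D : 'I_n -> set (\bar R)),
      (forall i, measurable (C i)) -> (forall j, measurable (D j)) ->
      P ([set w | forall i, C i (W (A i) w)] `&`
         [set w | forall j, D j (p w (B j))]) =
      (P [set w | forall i, C i (W (A i) w)] *
       P [set w | forall j, D j (p w (B j))])%E.

Definition levy_measure (nu : {measure set R -> \bar R}) :=
  nu [set 0] = 0%E /\ (\int[nu]_z (Num.min 1 (z ^+ 2))%:E < +oo)%E.

(* The integral of 1_A(s) z against p - q over eps < |z| <= 1; the q-part is
   Leb(A) times an integral against nu since q = Leb (x) nu. *)
Definition compensated_jumps (nu : {measure set R -> \bar R})
    (p : R.-ker T ~> ('rV[R]_d * R)%type) (A : set 'rV[R]_d) (eps : R) (w : T) : R :=
  \int[p w]_(x in A `*` [set z | eps < `|z| <= 1]) x.2 -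
  fine (lebesgue_rV d A) * \int[nu]_(z in [set z | eps < `|z| <= 1]) z.

(* The compensated integral over 0 < |z| <= 1 is the L^2-limit of the
   truncated ones. *)
Definition is_compensated_small_jumps (nu : {measure set R -> \bar R})
    (p : R.-ker T ~> ('rV[R]_d * R)%type) (A : set 'rV[R]_d) (M : {RV P >-> R}) :=
  (\int[P]_w ((compensated_jumps nu p A eps w - M w) ^+ 2)%:E)%E
    @[eps --> (0 : R)^'+] --> 0%E.

Definition large_jumps (p : R.-ker T ~> ('rV[R]_d * R)%type) (A : set 'rV[R]_d)
    (w : T) : R :=
  \int[p w]_(x in A `*` [set z | 1 < `|z|]) x.2.

(* Only the values of L on bounded Borel sets are constrained. *)
Definition homogeneous_levy_basis (beta sigma : R)
    (nu : {measure set R -> \bar R}) (L : set 'rV[R]_d -> {RV P >-> R}) :=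
  [/\ 0 <= sigma, levy_measure nu &
    exists (W : set 'rV[R]_d -> {RV P >-> R}) (p : R.-ker T ~> ('rV[R]_d * R)%type),
      [/\ gaussian_white_noise W,
          poisson_random_measure (lebesgue_rV d \x nu)%E p,
          independent_noises W p &
          forall A, bounded_borel A ->
            exists2 M : {RV P >-> R}, is_compensated_small_jumps nu p A M &
            \forall w \ae P,
              L A w = beta * fine (lebesgue_rV d A) + sigma * W A w +
                      M w + large_jumps p A w]].

Definition cvg_in_probability (X : nat -> T -> R) (Y : T -> R) :=
  forall eps : R, 0 < eps ->
    P [set w | eps <= `|X n w - Y w|] @[n --> \oo] --> 0%E.

(* The value x = 0 contributes 0 whatever L is on the (unbounded) zero set
   of f. *)
Definition simple_integral (L : set 'rV[R]_d -> {RV P >-> R})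
    (f : {sfun 'rV[R]_d >-> R}) (B : set 'rV[R]_d) (w : T) : R :=
  \sum_(x \in range f) x * L (f @^-1` [set x] `&` B) w.

(* X is (a version of) the Rajput-Rosinski integral of f over R^d. *)
Definition is_levy_integral (L : set 'rV[R]_d -> {RV P >-> R})
    (f : 'rV[R]_d -> R) (X : {RV P >-> R}) :=
  measurable_fun [set: 'rV[R]_d] f /\
  exists fn : nat -> {sfun 'rV[R]_d >-> R},
    [/\ forall n, bounded_set [set s | fn n s != 0],
        \forall s \ae lebesgue_rV d, fn n s @[n --> \oo] --> f s,
        forall B, measurable B -> exists Y : {RV P >-> R},
          cvg_in_probability (fun n => simple_integral L (fn n) B) Y &
        cvg_in_probability (fun n => simple_integral L (fn n) setT) X].

Definition levy_integrable (L : set 'rV[R]_d -> {RV P >-> R})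
    (f : 'rV[R]_d -> R) :=
  exists X : {RV P >-> R}, is_levy_integral L f X.

End random_measures.

Section distributions.
Context {R : realType} {d : nat}.

Definition partial (i : 'I_d) (phi : 'rV[R]_d -> R) : 'rV[R]_d -> R :=
  fun x => 'D_(delta_mx 0 i) phi x.

Definition partials (l : seq 'I_d) (phi : 'rV[R]_d -> R) : 'rV[R]_d -> R :=
  foldr partial phi l.

Definition test_function (phi : 'rV[R]_d -> R) :=
  [/\ forall l, continuous (partials l phi),
      forall l i x, derivable (partials l phi) x (delta_mx 0 i) &
      exists2 K : set 'rV[R]_d, compact K & forall x, ~ K x -> phi x = 0].

(* Functionals are total; only their values on test functions matter. *)
Definition functional := ('rV[R]_d -> R) -> R.

Definition is_distribution (F : functional) :=
  (forall (a : R) phi psi, test_function phi -> test_function psi ->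
     F (fun x => a * phi x + psi x) = a * F phi + F psi) /\
  (forall K : set 'rV[R]_d, compact K ->
     exists (C : R) (N : nat), forall phi (M : R), test_function phi ->
       (forall x, ~ K x -> phi x = 0) ->
       (forall l, (size l <= N)%N -> forall x, `|partials l phi x| <= M) ->
       `|F phi| <= C * M).

Definition regular_distribution (g : 'rV[R]_d -> R) : functional :=
  fun phi => \int[lebesgue_rV d]_x (g x * phi x).

Definition partial_distribution (i : 'I_d) (F : functional) : functional :=
  fun phi => - F (partial i phi).

Definition locally_L1 (g : 'rV[R]_d -> R) :=
  measurable_fun [set: 'rV[R]_d] g /\
  forall K : set 'rV[R]_d, compact K ->
    (lebesgue_rV d).-integrable K (EFin \o g).

Variable p : nat.

(* (I_p d_i - A_i) H for a matrix H of distributions *)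
Definition first_order_factor (A : 'I_d -> 'M[R]_p)
    (H : 'I_p -> 'I_p -> functional) (i : 'I_d) : 'I_p -> 'I_p -> functional :=
  fun j k phi => partial_distribution i (H j k) phi -
                 \sum_(l < p) A i j l * H l k phi.

(* (I_p d_d - A_d) ... (I_p d_1 - A_1) G: the factor with the smallest index
   acts first. *)
Definition product_operator (A : 'I_d -> 'M[R]_p)
    (G : 'I_p -> 'I_p -> functional) : 'I_p -> 'I_p -> functional :=
  foldl (first_order_factor A) G (enum 'I_d).

Definition fundamental_solution (A : 'I_d -> 'M[R]_p)
    (G : 'I_p -> 'I_p -> functional) :=
  (forall j k, is_distribution (G j k)) /\
  (forall j k phi, test_function phi ->
     product_operator A G j k phi = (j == k)%:R * phi 0).

End distributions.

Section gcarma.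
Context {R : realType}.

Definition expmx p (A : 'M[R]_p) : 'M[R]_p :=
  \matrix_(i, j) limn (series (fun k : nat => (A ^+ k) i j / k`!%:R)).

Definition log_moment (d : nat) (nu : {measure set R -> \bar R}) :=
  (\int[nu]_(z in [set z : R | (1 < `|z|)%R]) ((ln `|z|) ^+ d)%:E < +oo)%E.

Definition stable_mx p (A : 'M[R]_p) :=
  forall z : R[i], eigenvalue (map_mx (real_complex R) A) z ->
    complex.Re z < 0.

Definition stable_poly (a : {poly R}) :=
  forall z : R[i], root (map_poly (real_complex R) a) z -> complex.Re z < 0.

(* The cast is along (size a).-1 = p, i.e. deg a = p when p > 0. *)
Definition is_companion p (a : {poly R}) (A : 'M[R]_p) :=
  exists e : (size a).-1 = p, A = castmx (e, e) (companionmx a).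

Context {dT : measure_display} {T : measurableType dT}.
Variables (P : probability T R) (d p : nat).
Implicit Types (b c : 'cV[R]_p) (A : 'I_d -> 'M[R]_p).
Implicit Types (L : set 'rV[R]_d -> {RV P >-> R}) (Y : 'rV[R]_d -> {RV P >-> R}).

Definition gcarma_data A (beta sigma : R) (nu : {measure set R -> \bar R}) L :=
  [/\ (0 < p)%N, forall i, stable_mx (A i),
      homogeneous_levy_basis beta sigma nu L & log_moment d nu].

Definition carma_coefficients (q : nat) b c A :=
  [/\ (q < p)%N,
      forall i : 'I_p, i = q :> nat -> b i 0 != 0,
      forall i : 'I_p, (q < i)%N -> b i 0 = 0,
      c = \col_(i < p) (i == p.-1 :> nat)%:R &
      forall i, exists a : {poly R},
        [/\ a \is monic, size a = p.+1, stable_poly a & is_companion a (A i)]].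

Definition carma_data (q : nat) b c A (beta sigma : R)
    (nu : {measure set R -> \bar R}) L :=
  [/\ carma_coefficients q b c A, homogeneous_levy_basis beta sigma nu L &
      log_moment d nu].

(* The j-th component of the integrand of X(t), extended by 0 outside
   prod_i ]-oo, t_i]. *)
Definition gcarma_kernel c A (t : 'rV[R]_d) (j : 'I_p) (s : 'rV[R]_d) : R :=
  if [forall i, s 0 i <= t 0 i] then
    (\big[mulmx/1%:M]_(i < d) expmx ((t 0 i - s 0 i) *: A i) *m c) j 0
  else 0.

Definition causal_field b c A L Y :=
  exists X : 'rV[R]_d -> 'I_p -> {RV P >-> R},
    (forall t j, is_levy_integral L (gcarma_kernel c A t j) (X t j)) /\
    (forall t, \forall w \ae P, Y t w = \sum_(j < p) b j 0 * X t j w).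

Definition mild_solution b c A L Y :=
  exists G : 'rV[R]_d -> 'M[R]_p,
    [/\ forall j k, locally_L1 (fun x => G x j k),
        fundamental_solution A
          (fun j k => regular_distribution (fun x => G x j k)) &
        exists X : 'rV[R]_d -> 'I_p -> {RV P >-> R},
          (forall t j,
             is_levy_integral L (fun s => (G (t - s) *m c) j 0) (X t j)) /\
          (forall t, \forall w \ae P, Y t w = \sum_(j < p) b j 0 * X t j w)].

End gcarma.

(* Main.v *)
(* The modular [psi u = |u| + u ^ 2 + \int_(|z| > 1) min (1, |u z|) nu(dz)] controls
   the Levy basis in probability: for a simple function [f] and [e > 0],
   [P (|\int f dL| >= e) <= K_e \int psi (f)], by the Chebyshev inequality for the
   Gaussian and compensated parts, and by the Markov inequality for the large jumps
   truncated at height 1. Dominated convergence then makes the integrals of simple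
   approximations of [f] Cauchy in probability as soon as [\int psi (f)] is finite.
   The kernel [G x = e ^ (A_1 x_1) ... e ^ (A_d x_d)] on the positive orthant is
   dominated by [C e ^ (- l (x_1 + ... + x_d))], for which
   [\int min (1, |z| |G|)] is of order [(log |z|) ^ d], so that the logarithmic
   moment of [nu] makes [\int psi (G)] finite. Finally [G] is a fundamental
   solution by integration by parts along one coordinate at a time. *)
Require Import Defs.
From HB Require Import structures.
From mathcomp Require Import all_boot all_order all_algebra.
From mathcomp Require Import complex.
From mathcomp Require Import all_classical all_reals all_analysis.
From mathcomp Require Import measurable_realfun.
From mathcomp Require Import ring lra.

Set Implicit Arguments.
Unset Strict Implicit.
Unset Printing Implicit Defensive.

Import Order.TTheory GRing.Theory Num.Theory.
Import numFieldNormedType.Exports.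
Import HBSimple HBNNSimple.

Local Open Scope classical_set_scope.
Local Open Scope ring_scope.

(** The definition of the integral asks for one sequence of boundedly supported simple functions
    whose integrals over every Borel set converge in probability; limits come from completeness, so
    the key is a tail bound that depends on a simple function only and not on how it is written.
    [levy_modulus] is chosen for convenience rather than sharpness: it is even, nondecreasing in
    |u|, and satisfies psi (u + v) <= 2 psi u + 2 psi v. Its terms |u| and u ^ 2 are affordable
    because exponential kernels are integrable and bounded. The obstacle is the large jumps: min (1,
    |z G|) is not a product over the coordinates, and a geometric mean restores one. Decay of e ^ (t
    A) comes from Cayley-Hamilton: the linear factors of the characteristic polynomial give a chain
    of scalar equations, each controlled by an energy. The matrices need not commute, but the
    operator acting first meets the leftmost exponential: it turns the first coordinate into a Dirac
    mass and leaves the kernel of the other matrices on a hyperplane, whence an induction on [d]. *)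

Section Rintegral_lemmas.
Context d (T : measurableType d) (R : realType) (mu : {measure set T -> \bar R}).
Variables (D : set T) (mD : measurable D).

Lemma integrable_EFinZ (a : R) (f : T -> R) :
  mu.-integrable D (EFin \o f) -> mu.-integrable D (EFin \o (fun x => a * f x)).
Proof. by move=> /(integrableZl mD a); congr (integrable _ _ _). Qed.

Lemma integrable_EFinD (f g : T -> R) :
  mu.-integrable D (EFin \o f) -> mu.-integrable D (EFin \o g) ->
  mu.-integrable D (EFin \o (fun x => f x + g x)).
Proof. by move=> hf hg; have := integrableD mD hf hg; congr (integrable _ _ _). Qed.

Lemma integrable_EFin_sum (I : Type) (s : seq I) (f : I -> T -> R) :
  (forall i, mu.-integrable D (EFin \o f i)) ->
  mu.-integrable D (EFin \o (fun x => \sum_(i <- s) f i x)).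
Proof.
move=> h; rewrite (_ : _ \o _ = (fun x => \sum_(i <- s) (f i x)%:E)%E).
  by apply: integrable_sum => //= i _; exact: h.
by apply/funext => x; rewrite /= sumEFin.
Qed.

Lemma Rintegral_sum (I : Type) (s : seq I) (f : I -> T -> R) :
  (forall i, mu.-integrable D (EFin \o f i)) ->
  \int[mu]_(x in D) (\sum_(i <- s) f i x) = \sum_(i <- s) \int[mu]_(x in D) f i x.
Proof.
move=> h; elim: s => [|i s IH].
  by under eq_Rintegral do rewrite big_nil; rewrite /Rintegral integral0_eq// big_nil.
under eq_Rintegral do rewrite big_cons.
by rewrite RintegralD//= ?IH ?big_cons//; exact: integrable_EFin_sum.
Qed.

End Rintegral_lemmas.

(** * Exponential decay of matrix exponentials *)

Section matrix_exponential.
Context {R : realType}.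

(** Entries of [A] are at most [m], and each further product sums [p.+1] terms; the powers of [A]
    are thus dominated by the numerators of a scalar exponential series. *)
Lemma expmx_coef_bound p (A : 'M[R]_p.+1) : exists2 M : R, 0 <= M &
  forall k i j, `|(A ^+ k) i j| <= M ^+ k.
Proof.
pose m := \sum_i \sum_j `|A i j|.
have m0 : 0 <= m by apply: sumr_ge0 => i _; apply: sumr_ge0.
have Am i j : `|A i j| <= m.
  rewrite /m (bigD1 i)//= (bigD1 j)//= -addrA lerDl addr_ge0//.
    by apply: sumr_ge0.
  by apply: sumr_ge0 => ? _; apply: sumr_ge0.
exists (p.+1%:R * m); first by rewrite mulr_ge0.
elim=> [|k IH] i j.
  by rewrite !expr0 mxE; case: eqP; rewrite ?normr1 ?normr0.
rewrite exprS mxE; apply: (le_trans (ler_norm_sum _ _ _)).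
have -> : (p.+1%:R * m) ^+ k.+1 = \sum_(l < p.+1) m * (p.+1%:R * m) ^+ k.
  by rewrite sumr_const card_ord exprS -[RHS]mulr_natl mulrA.
by apply: ler_sum => l _; rewrite normrM ler_pM.
Qed.

(** Taylor coefficients of an entry of A ^ m e ^ (t A); the shift [m] closes the family under
    termwise differentiation. *)
Definition expmx_coef p (A : 'M[R]_p.+1) (m : nat) i j (k : nat) : R :=
  (A ^+ (k + m)) i j / k`!%:R.

Lemma pseries_expmx_coef_cvg p (A : 'M[R]_p.+1) m i j x :
  cvgn (pseries (expmx_coef A m i j) x).
Proof.
have [M M0 AM] := expmx_coef_bound A.
apply: normed_cvg.
apply: (@series_le_cvg _ _ (M ^+ m *: exp_coeff (M * `|x|))) => //.
- by move=> n; exact: normr_ge0.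
- by move=> n; rewrite /exp_coeff /=; apply: mulr_ge0; [exact: exprn_ge0|apply: divr_ge0; rewrite ?exprn_ge0 ?mulr_ge0].
- move=> n; rewrite /expmx_coef/= normrM normrM normrX.
  rewrite [`|_^-1|]ger0_norm ?invr_ge0//.
  rewrite [leRHS]/GRing.scale/= /exp_coeff/= exprMn [leRHS]mulrA [M ^+ m * _]mulrA -exprD -mulrA [_^-1 * _]mulrC mulrA.
  rewrite ler_wpM2r ?invr_ge0// ler_wpM2r ?exprn_ge0// addnC; exact: AM.
- apply: is_cvg_seriesZ; exact: is_cvg_series_exp_coeff.
Qed.

Lemma pseries_diffs_expmx_coef p (A : 'M[R]_p.+1) m i j :
  pseries_diffs (expmx_coef A m i j) = expmx_coef A m.+1 i j.
Proof.
apply/funext => k; rewrite /pseries_diffs /expmx_coef factS natrM invfM.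
by rewrite mulrCA addnS addSn; congr (_ * _); rewrite mulVKf ?pnatr_eq0.
Qed.

Lemma expmx_pseries p (A : 'M[R]_p.+1) t i j :
  expmx (t *: A) i j = limn (pseries (expmx_coef A 0 i j) t).
Proof.
rewrite mxE; congr (limn (series _)); apply/funext => k.
by rewrite /expmx_coef/= exprZn mxE addn0 mulrC mulrA mulrAC [_^-1 * _]mulrC.
Qed.

Lemma expmx_pseries1 p (A : 'M[R]_p.+1) t i j :
  limn (pseries (expmx_coef A 1 i j) t) = \sum_l A i l * expmx (t *: A) l j.
Proof.
apply: cvg_lim => //.
under eq_bigr do rewrite expmx_pseries.
have -> : pseries (expmx_coef A 1 i j) t =
    fun n => \sum_l A i l * pseries (expmx_coef A 0 l j) t n.
  apply/funext => n; rewrite /pseries /series/=.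
  under [RHS]eq_bigr do rewrite mulr_sumr.
  rewrite exchange_big/=; apply: eq_bigr => k _.
  rewrite /expmx_coef addn1 exprS mxE !mulr_suml; apply: eq_bigr => l _.
  by rewrite addn0 !mulrA.
apply: cvg_big => [|l _]; first exact: add_continuous.
by apply: cvgMr; exact: pseries_expmx_coef_cvg.
Qed.

Lemma is_derive_expmx p (A : 'M[R]_p.+1) t i j :
  is_derive t (1 : R) (fun t : R => expmx (t *: A) i j) ((A *m expmx (t *: A)) i j).
Proof.
have -> : (fun t => expmx (t *: A) i j) =
    fun t => limn (pseries (expmx_coef A 0 i j) t).
  by apply/funext => x; exact: expmx_pseries.
rewrite mxE -expmx_pseries1 -pseries_diffs_expmx_coef.
(* Any radius beyond |t| would do, since the series and its derivatives converge everywhere. *)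
apply: (@pseries_snd_diffs _ _ (`|t| + 1)); rewrite ?pseries_diffs_expmx_coef.
- exact: pseries_expmx_coef_cvg.
- exact: pseries_expmx_coef_cvg.
- exact: pseries_expmx_coef_cvg.
- by rewrite [ltRHS]ger0_norm ?addr_ge0// ltrDl.
Qed.

Lemma expmx0 p : expmx (0 : 'M[R]_p.+1) = 1%:M.
Proof.
apply/matrixP => i j; rewrite mxE; apply: cvg_lim => //.
apply: (cvg_near_cst ((1%:M : 'M[R]_p.+1) i j)).
near=> n; have n0 : (0 < n)%N by near: n; exists 1%N.
rewrite /series/= -(prednK n0) big_nat_recl// expr0 fact0 divr1 big1_seq ?addr0//.
by move=> k _; rewrite expr0n/= mxE mul0r.
Unshelve. all: by end_near. Qed.

Lemma expmx0t p (A : 'M[R]_p.+1) : expmx (0 *: A) = 1%:M.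
Proof. by rewrite scale0r expmx0. Qed.

Lemma continuous_expmx p (A : 'M[R]_p.+1) i j :
  continuous (fun t : R => expmx (t *: A) i j).
Proof.
move=> t; apply: differentiable_continuous; apply/derivable1_diffP.
exact: (@ex_derive _ _ _ _ _ _ _ (is_derive_expmx A t i j)).
Qed.

Definition decays (f : R -> R) := exists (C l : R),
  [/\ 0 <= C, 0 < l & forall t, 0 <= t -> `|f t| <= C * expR (- (l * t))].

(** A rate may always be lowered; the cap [m] keeps it well below the rate of the homogeneous
    equation in [decays_ode], which avoids resonance. *)
Lemma decays_common (f g : R -> R) (m : R) : 0 < m -> decays f -> decays g ->
  exists (C l : R), [/\ 0 <= C, 0 < l <= m &
    forall t, 0 <= t -> `|f t| <= C * expR (- (l * t)) /\
                        `|g t| <= C * expR (- (l * t))].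
Proof.
move=> m0 [C1 [l1 [C10 l10 H1]]] [C2 [l2 [C20 l20 H2]]].
pose l := Num.min m (Num.min l1 l2).
exists (C1 + C2), l; split; first exact: addr_ge0.
  by rewrite /l !lt_min m0 l10 l20/= ge_min lexx.
move=> t t0; split.
  apply: le_trans (H1 _ t0) _; rewrite ler_pM ?expR_ge0// ?lerDl//.
  by rewrite ler_expR lerN2 ler_wpM2r// /l !ge_min lexx !orbT.
apply: le_trans (H2 _ t0) _; rewrite ler_pM ?expR_ge0// ?lerDr//.
by rewrite ler_expR lerN2 ler_wpM2r// /l !ge_min lexx !orbT.
Qed.

(* Duhamel's bound for [y' = z y + (f + i g)], Re z < 0, by the energy
   [E = u ^ 2 + v ^ 2] of [y = u + i v]: [E' <= a E + (f ^ 2 + g ^ 2) / (- a)]. *)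
Lemma decays_ode (a b : R) (u v f g : R -> R) : a < 0 ->
  (forall t, is_derive t (1 : R) u (a * u t - b * v t + f t)) ->
  (forall t, is_derive t (1 : R) v (b * u t + a * v t + g t)) ->
  decays f -> decays g -> decays u /\ decays v.
Proof.
move=> a0 du dv df dg.
(* A rate [l] at most - a / 4 leaves k = - a - 2 l positive: the squared forcing term, once
   multiplied by the integrating factor, is of order e ^ (k t). *)
have ma : 0 < - a / 4 by rewrite divr_gt0// oppr_gt0.
have [C [l [C0 /andP[l0 lm] H]]] := decays_common ma df dg.
pose D := C ^+ 2 + C ^+ 2.
pose k := - a - 2 * l.
have k0 : 0 < k by rewrite /k; lra.
pose K := D / (- a * k).
pose E := fun t => u t ^+ 2 + v t ^+ 2.
(* The energy times its integrating factor, minus a primitive of the bound D / (- a) e ^ (k t) on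
   the forcing; the energy inequality says that [h] does not increase. *)
pose h := fun t => E t * expR (- a * t) - K * expR (k * t).
have dh t : is_derive t (1 : R) h
   ((2 * u t * (a * u t - b * v t + f t) + 2 * v t * (b * u t + a * v t + g t))
      * expR (- a * t) + E t * (- a * expR (- a * t)) - K * (k * expR (k * t))).
  pose hu := du t; pose hv := dv t.
  apply: is_derive_eq.
  rewrite /E /GRing.scale/=; ring.
have h_le t : 0 <= t -> h t <= h 0.
  move=> t0; apply: (@ler0_derive1_nincry _ h 0) => //.
  - move=> x; rewrite in_itv/= andbT => x0.
    rewrite derive1E (@derive_val _ _ _ _ _ _ _ (dh x)).
    have [Hf Hg] := H _ (ltW x0).
    have e0 : expR (k * x) = expR (- a * x) * expR (- (l * x)) ^+ 2.
      by rewrite -expRM_natl -expRD; congr expR; rewrite /k; ring.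
    have K1 : K * k = D / - a.
      by rewrite /K invfM mulrA -mulrA mulVf ?mulr1// gt_eqF.
    rewrite [K * (k * _)]mulrA K1 e0.
    set X := expR (- a * x); set Y := expR (- (l * x)) in Hf Hg *.
    have X0 : 0 < X by exact: expR_gt0.
    have fg : f x ^+ 2 + g x ^+ 2 <= D * Y ^+ 2.
      rewrite /D mulrDl -exprMn -[f x ^+ 2]real_normK ?num_real//.
      by rewrite -[g x ^+ 2]real_normK ?num_real// lerD// lerXn2r// ?nnegrE// (le_trans _ Hf).
    (* The rotation terms in [b] cancel in the energy. *)
    have -> : (2 * u x * (a * u x - b * v x + f x) +
         2 * v x * (b * u x + a * v x + g x)) * X + E x * (- a * X) -
         D / - a * (X * Y ^+ 2) =
       X * (a * E x + 2 * (u x * f x + v x * g x) - D * Y ^+ 2 / - a).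
      by rewrite /E; field; rewrite ?oppr_eq0 lt_eqF.
    rewrite pmulr_rle0// subr_le0.
    apply: (@le_trans _ _ ((f x ^+ 2 + g x ^+ 2) / - a)); last first.
      by rewrite ler_pM2r// invr_gt0 oppr_gt0.
    rewrite ler_pdivlMr ?oppr_gt0//.
    (* Completing the squares proves Young's inequality 2 (u f + v g) <= - a E + (f ^ 2 + g ^ 2) /
       (- a). *)
    rewrite -subr_ge0 (_ : _ - _ =
      (f x + a * u x) ^+ 2 + (g x + a * v x) ^+ 2); last by rewrite /E; ring.
    by rewrite addr_ge0// sqr_ge0.
  - apply: continuous_subspaceT => x; apply: differentiable_continuous.
    apply/derivable1_diffP; by have [] := dh x.
have K0 : 0 <= K by rewrite divr_ge0 ?addr_ge0 ?sqr_ge0// mulr_ge0 ?oppr_ge0// ltW.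
have E_le t : 0 <= t -> E t <= (E 0 + K) * expR (- (l * t)) ^+ 2.
  move=> t0; have := h_le _ t0; rewrite /h !mulr0 expR0 !mulr1 => hle.
  have ekt : 1 <= expR (k * t) by rewrite -[leLHS]expR0 ler_expR mulr_ge0// ltW.
  have -> : expR (- (l * t)) ^+ 2 = expR (k * t) * expR (a * t).
    by rewrite -expRM_natl -expRD; congr expR; rewrite /k; ring.
  have -> : E t = E t * expR (- a * t) * expR (a * t).
    by rewrite -mulrA -expRD mulNr addNr expR0 mulr1.
  rewrite mulrA ler_pM2r ?expR_gt0//.
  have E00 : 0 <= E 0 by rewrite addr_ge0// sqr_ge0.
  nra.
have E00 : 0 <= E 0 by rewrite addr_ge0// sqr_ge0.
have bnd w t : 0 <= t -> w ^+ 2 <= E t ->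
    `|w| <= Num.sqrt (E 0 + K) * expR (- (l * t)).
  move=> t0 wE; rewrite -[leLHS]sqrtr_sqr.
  apply: (le_trans (ler_wsqrtr (le_trans wE (E_le _ t0)))).
  by rewrite (sqrtrM _ (addr_ge0 E00 K0)) sqrtr_sqr ger0_norm ?expR_ge0.
split; exists (Num.sqrt (E 0 + K)), l; split => // t t0; apply: bnd => //.
- by rewrite lerDl sqr_ge0.
- by rewrite lerDr sqr_ge0.
Qed.

Let C := R[i].

(** Since [A] is real, the complex matrix Q e ^ (t A) is kept as a pair of real combinations of the
    entries of [expmx], and no complex exponential has to be defined. *)
Let reM p (A : 'M[R]_p.+1) (Q : 'M[C]_p.+1) i j (t : R) : R :=
  \sum_l complex.Re (Q i l) * expmx (t *: A) l j.
Let imM p (A : 'M[R]_p.+1) (Q : 'M[C]_p.+1) i j (t : R) : R :=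
  \sum_l complex.Im (Q i l) * expmx (t *: A) l j.

Let is_derive_lin p (A : 'M[R]_p.+1) (c : 'I_p.+1 -> R) j t :
  is_derive t (1 : R) (fun t : R => \sum_l c l * expmx (t *: A) l j)
    (\sum_m (\sum_l c l * A l m) * expmx (t *: A) m j).
Proof.
have H (l : 'I_p.+1) : is_derive t (1 : R) (fun t : R => c l * expmx (t *: A) l j)
    (c l * (A *m expmx (t *: A)) l j).
  have := is_derive_expmx A t l j => ?.
  by apply: is_derive_eq; rewrite /GRing.scale/=.
have := is_derive_sum H; rewrite fct_sumE => h.
apply: is_derive_eq h _.
under eq_bigr do rewrite mxE mulr_sumr.
rewrite exchange_big; apply: eq_bigr => m _ /=.
by rewrite mulr_suml; apply: eq_bigr => l _; rewrite mulrA.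
Qed.

Let re_sum (I : finType) (F : I -> C) :
  complex.Re (\sum_i F i) = \sum_i complex.Re (F i).
Proof. exact: (raddf_sum (@complex.Re R)). Qed.

Let im_sum (I : finType) (F : I -> C) :
  complex.Im (\sum_i F i) = \sum_i complex.Im (F i).
Proof. exact: (raddf_sum (@complex.Im R)). Qed.

(* [(D - z) (Q e ^ (t A)) = Q (A - z) e ^ (t A)], so the factors of a product
   annihilating [Q] can be peeled off one at a time. *)
Let decays_annihilated p (A : 'M[R]_p.+1) (s : seq C) (Q : 'M[C]_p.+1) :
  (forall z, z \in s -> complex.Re z < 0) ->
  Q *m \big[mulmx/1%:M]_(z <- s) (map_mx (real_complex R) A - z%:M) = 0 ->
  forall i j, decays (reM A Q i j) /\ decays (imM A Q i j).
Proof.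
elim: s Q => [|z s IH] Q sneg.
  rewrite big_nil mulmx1 => -> i j.
  by split; exists 0, 1; split => // t _; rewrite mul0r /reM /imM big1 ?normr0// => l _;
    rewrite mxE mul0r.
rewrite big_cons mulmxA => Q0 i j.
have [] := IH _ _ Q0 i j => [w ws|dr di]; first by apply: sneg; rewrite inE ws orbT.
have z0 : complex.Re z < 0 by apply: sneg; rewrite mem_head.
set Q1 := Q *m _ in dr di.
have eQ1 l : Q1 i l = (\sum_m Q i m * (A m l)%:C%C) - Q i l * z.
  rewrite /Q1 mulmxBr mxE [X in _ + X]mxE mul_mx_scalar !mxE.
  rewrite [z * _]mulrC; congr (_ - _).
  by apply: eq_bigr => m _; rewrite mxE.
have re1 m : \sum_l complex.Re (Q i l) * A l m = complex.Re z * complex.Re (Q i m)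
     - complex.Im z * complex.Im (Q i m) + complex.Re (Q1 i m).
  rewrite eQ1 raddfB/= re_sum.
  have -> : \sum_i0 complex.Re (Q i i0 * (A i0 m)%:C%C) =
            \sum_l complex.Re (Q i l) * A l m.
    by apply: eq_bigr => l _; case: (Q i l) => ? ?/=; rewrite mulr0 subr0.
  by case: z {sneg Q0 Q1 dr di eQ1 z0} => x y; case: (Q i m) => u v/=; ring.
have im1 m : \sum_l complex.Im (Q i l) * A l m = complex.Im z * complex.Re (Q i m)
     + complex.Re z * complex.Im (Q i m) + complex.Im (Q1 i m).
  rewrite eQ1 raddfB/= im_sum.
  have -> : \sum_i0 complex.Im (Q i i0 * (A i0 m)%:C%C) =
            \sum_l complex.Im (Q i l) * A l m.
    by apply: eq_bigr => l _; case: (Q i l) => ? ?/=; rewrite mulr0 add0r mulrC.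
  by case: z {sneg Q0 Q1 dr di eQ1 z0 re1} => x y; case: (Q i m) => u v/=; ring.
apply: (decays_ode (a := complex.Re z) (b := complex.Im z) _ _ _ dr di) => // t.
- apply: is_derive_eq; first exact: is_derive_lin.
  under eq_bigr do rewrite re1 !mulrDl mulNr -!mulrA.
  by rewrite !big_split/= sumrN -!mulr_sumr.
- apply: is_derive_eq; first exact: is_derive_lin.
  under eq_bigr do rewrite im1 !mulrDl -!mulrA.
  by rewrite !big_split/= -!mulr_sumr.
Qed.

(** Over the complex numbers the characteristic polynomial splits, and by Cayley-Hamilton the
    product of its linear factors at the matrix is 0. Hence [decays_annihilated] applies to the
    identity matrix, whose real part [reM] is the exponential itself. *)
Lemma expmx_decays p (A : 'M[R]_p.+1) i j :
  stable_mx A -> decays (fun t => expmx (t *: A) i j).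
Proof.
move=> stA; pose Ac := map_mx (real_complex R) A.
have [s es] := closed_field_poly_normal (char_poly Ac).
rewrite (monicP (char_poly_monic Ac)) scale1r in es.
have [] := @decays_annihilated _ A s 1%:M _ _ i j.
- move=> z zs; apply: stA; rewrite eigenvalue_root_char es.
  by rewrite root_prod_XsubC.
- rewrite mul1mx -[RHS](Cayley_Hamilton Ac) es rmorph_prod/=.
  rewrite [LHS](_ : _ = \prod_(z <- s) (Ac - z%:M))//.
  by apply: eq_bigr => z _; rewrite rmorphB/= horner_mx_X horner_mx_C.
- move=> H _; congr decays: H; apply/funext => t; rewrite /reM (bigD1 i)//=.
  rewrite mxE eqxx mul1r big1 ?addr0// => l li.
  by rewrite mxE eq_sym (negbTE li) mul0r.
Qed.

Lemma expmx_decays_unif (I : finType) p (A : I -> 'M[R]_p.+1) :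
  (forall i, stable_mx (A i)) ->
  exists (C0 l : R), [/\ 0 < C0, 0 < l & forall i j k t, 0 <= t ->
    `|expmx (t *: A i) j k| <= C0 * expR (- (l * t))].
Proof.
move=> stA.
pose J := (I * ('I_p.+1 * 'I_p.+1))%type.
have /choice[c H] : forall x : J, exists cl : R * R, [/\ 0 <= cl.1, 0 < cl.2 &
    forall t, 0 <= t -> `|expmx (t *: A x.1) x.2.1 x.2.2| <= cl.1 * expR (- (cl.2 * t))].
  move=> [i [j k]]; have [c [l [c0 l0 cl]]] := expmx_decays j k (stA i).
  by exists (c, l).
exists (1 + \sum_x (c x).1), (\big[Num.min/1]_x (c x).2); split.
- by rewrite ltr_pwDl// sumr_ge0// => x _; have [] := H x.
- apply: (big_ind (fun x => 0 < x)) => // [x y x0 y0|x _]; last by have [] := H x.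
  by rewrite lt_min x0.
- move=> i j k t t0; have [c0 l0 cl] := H (i, (j, k)).
  apply: le_trans (cl t t0) _; rewrite ler_pM ?expR_ge0//.
    rewrite (bigD1 (i, (j, k)))//= addrCA lerDl addr_ge0// sumr_ge0// => x _.
    by have [] := H x.
  rewrite ler_expR lerN2 ler_wpM2r//.
  by apply/bigmin_leP; right; exists (i, (j, k)).
Qed.

End matrix_exponential.

(** * Lebesgue measure on row vectors *)

Section sigma_finite_pack.
Context d (T : measurableType d) (R : realType).
Variables (mu : {measure set T -> \bar R}) (sf : sigma_finite setT mu).

(** A copy of [mu] that mentions the proof [sf], so that a sigma-finite structure can be attached to
    it; Fubini and product measures take the structure, not the property. *)
Definition sigma_finite_of_fun : set T -> \bar R := let _ := sf in mu.

HB.instance Definition _ := isMeasure.Build _ _ _ sigma_finite_of_fun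
  (measure0 mu) (measure_ge0 mu) (@measure_semi_sigma_additive _ _ _ mu).
HB.instance Definition _ :=
  Measure_isSigmaFinite.Build _ _ _ sigma_finite_of_fun sf.

Definition sigma_finite_of : {sigma_finite_measure set T -> \bar R} :=
  sigma_finite_of_fun.

Lemma sigma_finite_ofE (D : set T) f :
  (\int[sigma_finite_of]_(x in D) f x = \int[mu]_(x in D) f x)%E.
Proof. by apply: eq_measure_integral => A mA _. Qed.

End sigma_finite_pack.

Section lebesgue_rV_integral.
Context {R : realType}.

Definition rV_box n (k : R) : set 'rV[R]_n :=
  [set v | forall i, `[- k, k]%classic (v 0 i)].

Arguments rV_box : clear implicits.

Lemma lebesgue_rV_box_lty n k : (lebesgue_rV n (rV_box n k) < +oo)%E.
Proof.
rewrite (@lebesgue_rV_box _ _ (fun=> `[- k, k]%classic)) => [|i]; last exact: measurable_itv.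
rewrite ltey_eq; apply/orP; left.
apply: (big_ind (fun x : \bar R => x \is a fin_num)%E) => //.
  by move=> x y ? ?; rewrite fin_numM.
by move=> i _; rewrite lebesgue_measure_itv/=; case: ifP.
Qed.

Lemma measurable_rV_box n k : measurable (rV_box n k).
Proof.
have -> : rV_box n k = \bigcap_(i in [set: 'I_n])
    ((fun v : 'rV[R]_n => v 0 i) @^-1` `[- k, k]%classic).
  by apply/seteqP; split=> [v h i _|v h i]; exact: h.
apply: fin_bigcap_measurable => // i _.
by rewrite -[X in measurable X]setTI; exact: measurable_coord.
Qed.

Lemma bounded_rV_box n (A : set 'rV[R]_n) : bounded_set A ->
  exists k, A `<=` rV_box n k.
Proof.
move=> /pinfty_ex_gt0[M _ AM]; exists M => v Av i; rewrite /= in_itv/= -ler_norml.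
apply: le_trans (AM _ Av).
by rewrite [leRHS]/Num.norm/= mx_normrE; apply: (le_bigmax _ (fun ij => `|v ij.1 ij.2|) (0, i)).
Qed.

Lemma rV_box_bounded n k : bounded_set (rV_box n k).
Proof.
exists (Num.max 0 k); split; [exact: num_real|move=> M /ltW kM v bv].
apply: le_trans kM.
rewrite [leLHS]/Num.norm/= mx_normrE; apply: bigmax_le => [|[i j] _/=].
  by rewrite le_max lexx.
by have := bv j; rewrite /= in_itv/= -ler_norml ord1 => h; rewrite le_max h orbT.
Qed.

Lemma lebesgue_rV_bounded_lty n (A : set 'rV[R]_n) : measurable A ->
  bounded_set A -> (lebesgue_rV n A < +oo)%E.
Proof.
move=> mA /bounded_rV_box[k Ak]; apply: le_lt_trans (lebesgue_rV_box_lty n k).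
by apply: le_measure => //; rewrite inE//; exact: measurable_rV_box.
Qed.

Lemma rV_box_cover n : [set: 'rV[R]_n] = \bigcup_k rV_box n k%:R.
Proof.
apply/seteqP; split => // v _; exists (Num.truncn `|v|).+1 => //= i.
rewrite /= in_itv/= -ler_norml ltW//; apply: le_lt_trans (truncnS_gt _).
by rewrite [leRHS]/Num.norm/= mx_normrE; apply: (le_bigmax _ (fun ij => `|v ij.1 ij.2|) (0, i)).
Qed.

Lemma lebesgue_rV_sigma_finite n : sigma_finite setT (lebesgue_rV n : set 'rV[R]_n -> \bar R).
Proof.
exists (fun k => rV_box n k%:R); first exact: rV_box_cover.
by move=> k; split; [exact: measurable_rV_box|exact: lebesgue_rV_box_lty].
Qed.

Definition leb_rV n := sigma_finite_of (lebesgue_rV_sigma_finite n).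

Lemma compact_measurable_rV n (K : set 'rV[R]_n) : compact K -> measurable K.
Proof.
move=> cK; rewrite -[K]setCK; apply: measurableC.
suff : <<s [set U : set 'rV[R]_n | open U] >> (~` K) by rewrite -measurable_rV_borel.
by apply: sub_sigma_algebra; apply/closed_openC; exact: compact_closed cK.
Qed.

Lemma continuous_measurable_rV n (f : 'rV[R]_n -> R) :
  continuous f -> measurable_fun setT f.
Proof.
move=> /continuousP cf; apply: (measurability _ (RGenOpens.measurableE R)).
move=> _ [_ [a [b ->]] <-]; rewrite setTI.
suff : <<s [set U : set 'rV[R]_n | open U] >> (f @^-1` `]a, b[%classic).
  by rewrite -measurable_rV_borel.
by apply: sub_sigma_algebra; apply: cf; exact: interval_open.
Qed.

(** Same values as [lebesgue_rV n.+1], but built over the sigma-finite copy of the lower-dimensional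
    measure, as Fubini requires. *)
Let push n : {measure set 'rV[R]_n.+1 -> \bar R} :=
  measure_function_pushforward__canonical__measure_function_Measure
    (leb_rV n \x (@lebesgue_measure R))%E (@measurable_rV_cons R n).

Lemma ge0_integral_lebesgue_rVS n (f : 'rV[R]_n.+1 -> \bar R) :
  measurable_fun setT f -> (forall v, 0 <= f v)%E ->
  (\int[lebesgue_rV n.+1]_v f v =
   \int[lebesgue_rV n]_x \int[lebesgue_measure]_y f (rV_cons (x, y)))%E.
Proof.
move=> mf f0; rewrite [LHS](@eq_measure_integral _ _ _ _ (push n))//.
rewrite (ge0_integral_pushforward (@measurable_rV_cons R n))//=.
rewrite preimage_setT fubini_tonelli1//=; last first.
  exact: measurableT_comp mf (@measurable_rV_cons R n).
Qed.

Lemma integrable_lebesgue_rVS n (f : 'rV[R]_n.+1 -> R) :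
  (lebesgue_rV n.+1).-integrable setT (EFin \o f) ->
  (\int[lebesgue_rV n.+1]_v (f v)%:E =
   \int[lebesgue_rV n]_x \int[lebesgue_measure]_y (f (rV_cons (x, y)))%:E)%E.
Proof.
move=> /integrableP[mf lf].
have mfc : measurable_fun setT ((EFin \o f) \o @rV_cons R n).
  exact: measurableT_comp mf (@measurable_rV_cons R n).
have intf : (leb_rV n \x (@lebesgue_measure R))%E.-integrable setT
    ((EFin \o f) \o @rV_cons R n).
  apply/(integrable12ltyP _ _ mfc).
  apply: le_lt_trans lf; rewrite ge0_integral_lebesgue_rVS//; last first.
    exact: measurableT_comp.
rewrite [LHS](@eq_measure_integral _ _ _ _ (push n))//.
rewrite (integral_pushforward (@measurable_rV_cons R n))//=.
by rewrite preimage_setT -integral12_prod_meas1.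
Qed.

Lemma integral_prod_rV n (phi : 'I_n -> R -> R) :
  (forall i, measurable_fun setT (phi i)) -> (forall i x, 0 <= phi i x) ->
  (\int[lebesgue_rV n]_v (\prod_i phi i (v 0 i))%:E =
   \prod_i \int[lebesgue_measure]_x (phi i x)%:E)%E.
Proof.
elim: n phi => [|n IH] phi mphi phi0.
  rewrite big_ord0 integral_dirac//; last first.
    by apply: (eq_measurable_fun (cst 1%E)) => // x _; rewrite big_ord0.
  by rewrite diracE mem_set// mul1e big_ord0.
have mprod m (psi : 'I_m -> R -> R) : (forall i, measurable_fun setT (psi i)) ->
    measurable_fun setT (fun v : 'rV[R]_m => (\prod_i psi i (v 0 i))%:E).
  move=> mpsi; apply/measurable_EFinP; apply: measurable_prod => i _.
  exact: measurableT_comp (measurable_coord i).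
rewrite ge0_integral_lebesgue_rVS//; last 2 first.
- exact: mprod.
- by move=> v; rewrite lee_fin prodr_ge0.
have I0 : (0 <= \int[lebesgue_measure]_x (phi ord0 x)%:E)%E.
  by apply: integral_ge0 => x _; rewrite lee_fin.
transitivity (\int[lebesgue_rV n]_x ((\int[lebesgue_measure]_y (phi ord0 y)%:E) *
   (\prod_i phi (lift ord0 i) (x 0 i))%:E))%E.
  apply: eq_integral => x _.
  under eq_integral => y _.
    rewrite big_ord_recl mxE unlift_none/= EFinM.
    under eq_bigr do rewrite mxE liftK/=.
    over.
  rewrite ge0_integralZr//.
  - by apply/measurable_EFinP; exact: mphi.
  - by move=> y _; rewrite lee_fin.
  - by rewrite lee_fin prodr_ge0.
rewrite ge0_integralZl//.
- by rewrite (IH (fun i => phi (lift ord0 i)))// big_ord_recl.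
- exact: (mprod _ (fun i => phi (lift ord0 i))).
- by move=> v _; rewrite lee_fin prodr_ge0.
Qed.

End lebesgue_rV_integral.
Arguments rV_box {R}.

(** * The fundamental solution *)

Section big_mulmx.
Context {R : realType} {p : nat}.

(** One factor [p.+1] is paid per multiplication, including the one by the identity that ends the
    product, which keeps the bound a plain product over the indices. *)
Lemma big_mulmx_bound n (M : 'I_n -> 'M[R]_p.+1) (c : 'I_n -> R) :
  (forall i j k, `|M i j k| <= c i) ->
  forall j k, `|(\big[mulmx/1%:M]_(i < n) M i) j k| <= \prod_(i < n) (p.+1%:R * c i).
Proof.
elim: n M c => [|n IH] M c Mc j k.
  by rewrite !big_ord0 mxE; case: eqP; rewrite ?normr1 ?normr0.
rewrite !big_ord_recl mxE; apply: (le_trans (ler_norm_sum _ _ _)).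
set P := \prod_(i < n) _.
have -> : p.+1%:R * c ord0 * P = \sum_(l < p.+1) c ord0 * P.
  by rewrite sumr_const card_ord -[RHS]mulr_natl mulrA.
apply: ler_sum => l _; rewrite normrM ler_pM//.
by apply: IH => i; exact: Mc.
Qed.

Lemma measurable_big_mulmx d (T : measurableType d) n (M : 'I_n -> T -> 'M[R]_p.+1) :
  (forall i j k, measurable_fun setT (fun x => M i x j k)) ->
  forall j k, measurable_fun setT (fun x => (\big[mulmx/1%:M]_(i < n) M i x) j k).
Proof.
elim: n M => [|n IH] M mM j k.
  by under eq_fun do rewrite big_ord0; exact: measurable_cst.
under eq_fun do rewrite big_ord_recl mxE.
apply: measurable_sum => l; apply: measurable_funM; first exact: mM.
by apply: IH => i; exact: mM.
Qed.

End big_mulmx.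

Section green.
Context {R : realType} {p : nat}.

(** The closed orthant matches the test [s 0 i <= t 0 i] of [gcarma_kernel]: the two kernels then
    agree everywhere, not just almost everywhere. *)
Definition green d (A : 'I_d -> 'M[R]_p.+1) (x : 'rV[R]_d) : 'M[R]_p.+1 :=
  if [forall i, 0 <= x 0 i] then \big[mulmx/1%:M]_(i < d) expmx (x 0 i *: A i)
  else 0.

Lemma measurable_forall_le d (x : 'rV[R]_d) :
  measurable_fun setT (fun s : 'rV[R]_d => [forall i, x 0 i <= s 0 i]).
Proof.
apply: (measurable_fun_bool true).
rewrite setTI [X in measurable X](_ : _ = \bigcap_(i in [set: 'I_d])
    ((fun v : 'rV[R]_d => v 0 i) @^-1` `[x 0 i, +oo[%classic)).
  apply: fin_bigcap_measurable => // i _.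
  by rewrite -[X in measurable X]setTI; exact: measurable_coord.
apply/seteqP; split=> v /=.
  by move=> /forallP h i _ /=; rewrite in_itv/= h.
by move=> h; apply/forallP => i; have := h i I; rewrite /= in_itv/= andbT.
Qed.

Lemma measurable_green d (A : 'I_d -> 'M[R]_p.+1) j k :
  measurable_fun setT (fun x => green A x j k).
Proof.
rewrite /green.
have -> : (fun x : 'rV[R]_d => (if [forall i, 0 <= x 0 i] then
    \big[mulmx/1%:M]_(i < d) expmx (x 0 i *: A i) else 0) j k) =
  (fun x : 'rV[R]_d => if [forall i, (0 : 'rV[R]_d) 0 i <= x 0 i] then
    (\big[mulmx/1%:M]_(i < d) expmx (x 0 i *: A i)) j k else 0).
  apply/funext => x.
  have -> : [forall i, (0 : 'rV[R]_d) 0 i <= x 0 i] = [forall i, 0 <= x 0 i].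
    by apply: eq_forallb => i; rewrite mxE.
  by case: ifP => // _; rewrite mxE.
apply: measurable_fun_ifT; [exact: measurable_forall_le| |exact: measurable_cst].
apply: measurable_big_mulmx => i j' k'.
apply: (@measurableT_comp _ _ _ _ _ _ (fun t : R => expmx (t *: A i) j' k')).
  by apply: continuous_measurable_fun; exact: continuous_expmx.
exact: measurable_coord.
Qed.

Definition green_bound (C0 l u : R) : R :=
  if 0 <= u then p.+1%:R * (C0 * expR (- (l * u))) else 0.

Lemma green_bound_ge0 C0 l u : 0 <= C0 -> 0 <= green_bound C0 l u.
Proof.
by rewrite /green_bound => ?; case: ifP => // _; rewrite mulr_ge0// mulr_ge0// expR_ge0.
Qed.

Lemma norm_green d (A : 'I_d -> 'M[R]_p.+1) (C0 l : R) : 0 <= C0 ->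
  (forall i j k t, 0 <= t -> `|expmx (t *: A i) j k| <= C0 * expR (- (l * t))) ->
  forall x j k, `|green A x j k| <= \prod_(i < d) green_bound C0 l (x 0 i).
Proof.
move=> C00 HA x j k; rewrite /green; case: ifPn => [/forallP x0|_].
  apply: le_trans (big_mulmx_bound (c := fun i => C0 * expR (- (l * x 0 i))) _ j k) _.
    by move=> i j' k'; exact: HA.
  by apply: ler_prod => i _; rewrite mulr_ge0 ?mulr_ge0 ?expR_ge0//= /green_bound x0.
by rewrite mxE normr0 prodr_ge0// => i _; exact: green_bound_ge0.
Qed.

Lemma green_bounded d (A : 'I_d -> 'M[R]_p.+1) :
  (forall i, stable_mx (A i)) -> exists C0, forall x j k, `|green A x j k| <= C0.
Proof.
move=> /expmx_decays_unif[C0 [l [C00 l0 H]]].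
exists (\prod_(i < d) (p.+1%:R * C0)) => x j k.
apply: le_trans (norm_green (ltW C00) H x j k) _.
apply: ler_prod => i _; rewrite (green_bound_ge0 _ _ (ltW C00))/= /green_bound.
case: ifP => x0; last by rewrite mulr_ge0// ltW.
apply: ler_wpM2l => //; apply: ler_piMr; first exact: ltW.
by rewrite -[leRHS]expR0 ler_expR oppr_le0 mulr_ge0// ltW.
Qed.

(** The coordinate split off by [rV_cons] sits in the leftmost factor, the one on which the operator
    of index 0 acts; this drives the induction on the dimension. *)
Lemma green_cons d (A : 'I_d.+1 -> 'M[R]_p.+1) (x : 'rV[R]_d) (y : R) :
  green A (rV_cons (x, y)) = (if 0 <= y then expmx (y *: A ord0) else 0) *m
    green (fun i => A (lift ord0 i)) x.
Proof.
rewrite /green.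
have -> : [forall i, 0 <= rV_cons (x, y) 0 i] = (0 <= y) && [forall i, 0 <= x 0 i].
  apply/forallP/andP => [h|[y0 /forallP x0] i].
    split; first by have := h ord0; rewrite mxE unlift_none.
    by apply/forallP => i; have := h (lift ord0 i); rewrite mxE liftK.
  by rewrite mxE; case: unliftP => [j _|_]/=.
case: (0 <= y) => /=; last by rewrite mul0mx.
case: [forall i, _]; last by rewrite mulmx0.
rewrite big_ord_recl mxE unlift_none/=; congr (_ *m _).
by apply: eq_bigr => i _; rewrite mxE liftK.
Qed.

End green.

(** * Partial derivatives and test functions under restriction to a hyperplane *)

Section affine_derivative.
Context {R : realType} {U V : normedModType R}.
Variables (L : U -> V) (x v : U) (w : V).
Hypothesis Lvw : forall h : R, L (h *: v + x) = h *: w + L x.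

Let quotientE (f : V -> R) :
  (fun h : R => h^-1 *: (((f \o L) \o shift x) (h *: v) - (f \o L) x)) =
  (fun h : R => h^-1 *: ((f \o shift (L x)) (h *: w) - f (L x))).
Proof. by apply/funext => h /=; rewrite Lvw. Qed.

(** Along an affine map both difference quotients are the same function of [h], so a single
    directional derivative is transported as such. *)
Lemma derivable_affine (f : V -> R) : derivable f (L x) w -> derivable (f \o L) x v.
Proof. by rewrite /derivable quotientE. Qed.

Lemma derive_affine (f : V -> R) : 'D_v (f \o L) x = 'D_w f (L x).
Proof. by rewrite /derive quotientE. Qed.

End affine_derivative.

Section test_functions.
Context {R : realType}.

Definition cons0 n (x : 'rV[R]_n) : 'rV[R]_n.+1 := rV_cons (x, 0).

Lemma rV_consE n (x : 'rV[R]_n) y : rV_cons (x, y) = cons0 x + y *: delta_mx 0 ord0.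
Proof.
apply/rowP => i; rewrite !mxE; case: unliftP => [j ->|->]/=.
  by rewrite mulr0 addr0.
by rewrite mulr1 add0r.
Qed.

Lemma cons0_affine n (x : 'rV[R]_n) i (h : R) :
  cons0 (h *: delta_mx 0 i + x) = h *: delta_mx 0 (lift ord0 i) + cons0 x.
Proof.
apply/rowP => j; rewrite !mxE; case: unliftP => [k ->|->]/=.
  by rewrite !mxE (inj_eq lift_inj).
by rewrite mulr0 addr0.
Qed.

Lemma continuous_cons0 n : continuous (@cons0 n).
Proof.
move=> x A /nbhs_ballP[e /= e0 eA].
apply: (@filterS _ (nbhs x) _ (ball x e)); last exact: nbhsx_ballx.
move=> y [_ h]; apply: eA; split => // i j; rewrite !mxE.
by case: unliftP => [k _|_] //=; exact: ballxx.
Qed.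

Lemma continuous_rV_tail n :
  continuous (fun v : 'rV[R]_n.+1 => \row_i v 0 (lift ord0 i)).
Proof.
move=> x A /nbhs_ballP[e /= e0 eA].
apply: (@filterS _ (nbhs x) _ (ball x e)); last exact: nbhsx_ballx.
by move=> y [_ h]; apply: eA; split => // i j; rewrite !mxE.
Qed.

(** Differentiating along [i] and then along [l] is differentiating along [rcons l i]. The same
    compact set serves: its complement is open, so the difference quotients at an outer point are
    eventually 0. *)
Lemma test_partial d (phi : 'rV[R]_d -> R) i :
  test_function phi -> test_function (partial i phi).
Proof.
move=> [cphi dphi [K cK phiK]]; split.
- by move=> l; have := cphi (rcons l i); rewrite /partials -cats1 foldr_cat.
- by move=> l; have := dphi (rcons l i); rewrite /partials -cats1 foldr_cat.
exists K => // x Kx; rewrite /partial /derive.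
have cloK : closed K by exact: compact_closed cK.
apply: cvg_lim => //.
apply: cvg_near_cst; near=> h; rewrite /= (phiK x)// subr0.
rewrite phiK ?scaler0//; near: h.
have : nbhs x (~` K) by apply: open_nbhs_nbhs; split => //; exact/closed_openC.
have : (h *: delta_mx 0 i + x : 'rV[R]_d) @[h --> (0 : R)^'] --> x.
  rewrite -[X in _ --> X]add0r; apply: cvgD; last exact: cvg_cst.
  rewrite -[X in _ --> X](scale0r (delta_mx 0 i : 'rV[R]_d)).
  by apply: cvgZr_tmp; apply: cvg_within_filter; exact: cvg_id.
by move=> /[apply].
Unshelve. all: by end_near. Qed.

Lemma partials_cons0 n (phi : 'rV[R]_n.+1 -> R) l :
  partials l (phi \o @cons0 n) = partials (map (lift ord0) l) phi \o @cons0 n.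
Proof.
elim: l => //= i l ->; apply/funext => x; rewrite /partial.
by rewrite (derive_affine (w := delta_mx 0 (lift ord0 i)))// => h; exact: cons0_affine.
Qed.

Lemma test_cons0 n (phi : 'rV[R]_n.+1 -> R) :
  test_function phi -> test_function (phi \o @cons0 n).
Proof.
move=> [cphi dphi [K cK phiK]]; split.
- move=> l; rewrite partials_cons0 => x; apply: continuous_comp.
    exact: continuous_cons0.
  exact: cphi.
- move=> l i x; rewrite partials_cons0.
  apply: (derivable_affine (w := delta_mx 0 (lift ord0 i))); last exact: dphi.
  by move=> h; exact: cons0_affine.
(* The slice is supported in the projection of [K] that forgets the first coordinate. *)
exists ((fun v : 'rV[R]_n.+1 => \row_i v 0 (lift ord0 i)) @` K).
  apply: continuous_compact => //; apply: continuous_subspaceT.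
  exact: continuous_rV_tail.
move=> x Kx; apply: phiK => Kcx; apply: Kx; exists (cons0 x) => //.
by apply/rowP => i; rewrite !mxE liftK.
Qed.

Lemma test_continuous d (phi : 'rV[R]_d -> R) : test_function phi -> continuous phi.
Proof. by case=> /(_ [::]). Qed.

Lemma test_bounded d (phi : 'rV[R]_d -> R) : test_function phi ->
  exists (M k : R), [/\ 0 < k, forall x, `|phi x| <= M &
    forall x, ~ rV_box d k x -> phi x = 0].
Proof.
move=> tphi; have cphi := test_continuous tphi.
have [_ _ [K cK phiK]] := tphi.
have /pinfty_ex_gt0[M M0 HM] : bounded_set (phi @` K).
  apply: compact_bounded; apply: continuous_compact => //.
  exact: continuous_subspaceT.
have [k Kk] := bounded_rV_box (compact_bounded cK).
exists M, (Num.max k 1); split; first by rewrite lt_max ltr01 orbT.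
- move=> x; have [Kx|Kx] := pselect (K x); first by apply: HM; exists x.
  by rewrite phiK// normr0 ltW.
- move=> x bx; apply: phiK => /Kk kx; apply: bx => i; have := kx i.
  by rewrite /= !in_itv/= -!ler_norml => h; rewrite le_max h.
Qed.

Lemma integrable_test d (g phi : 'rV[R]_d -> R) (C0 : R) :
  measurable_fun setT g -> (forall x, `|g x| <= C0) -> test_function phi ->
  (lebesgue_rV d).-integrable setT (EFin \o (fun x => g x * phi x)).
Proof.
move=> mg gC tphi; have [M [k [_ phiM phik]]] := test_bounded tphi.
have -> : EFin \o (fun x => g x * phi x) =
    (EFin \o (fun x => g x * phi x)) \_ (rV_box d k).
  apply/funext => x; rewrite /patch; case: ifPn => //; rewrite notin_setE => /phik /=.
  by move=> ->; rewrite mulr0.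
have [+ _] := @integrable_mkcond _ _ _ (lebesgue_rV d) _ (EFin \o (fun x => g x * phi x)) (measurable_rV_box (n := d) k).
apply.
apply: measurable_bounded_integrable; first exact: measurable_rV_box.
- exact: lebesgue_rV_box_lty.
- apply: measurable_funTS; apply: measurable_funM => //.
  exact: continuous_measurable_rV (test_continuous tphi).
exists (C0 * M); split; [exact: num_real|move=> N /ltW CN x _].
by apply: le_trans CN; rewrite normrM ler_pM.
Qed.

End test_functions.

(** * Integration by parts and induction on the dimension *)

Section fundamental_solution.
Context {R : realType} {p : nat}.

Let is_derive_linr (A : 'M[R]_p.+1) (M : 'M[R]_p.+1) j k (t : R) :
  is_derive t (1 : R) (fun t : R => (expmx (t *: A) *m M) j k)
    ((A *m expmx (t *: A) *m M) j k).
Proof.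
have H (l : 'I_p.+1) : is_derive t (1 : R) (fun t : R => M l k * expmx (t *: A) j l)
    (M l k * (A *m expmx (t *: A)) j l).
  have := is_derive_expmx A t j l => ?.
  by apply: is_derive_eq; rewrite /GRing.scale/=.
have := is_derive_sum H; rewrite fct_sumE => h.
rewrite [X in is_derive _ _ X _](_ : _ = fun t : R => \sum_l M l k * expmx (t *: A) j l); last first.
  by apply/funext => s; rewrite mxE; apply: eq_bigr => l _; rewrite mulrC.
by apply: is_derive_eq h _; rewrite [RHS]mxE; apply: eq_bigr => l _; rewrite mulrC.
Qed.

Let is_derive_slice n (phi : 'rV[R]_n.+1 -> R) (x : 'rV[R]_n) (y : R) :
  test_function phi ->
  is_derive y (1 : R) (fun y : R => phi (rV_cons (x, y)))
    (partial ord0 phi (rV_cons (x, y))).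
Proof.
move=> [_ dphi _].
have L (h : R) : rV_cons (x, h *: (1 : R) + y : measurableTypeR R) =
    h *: delta_mx 0 ord0 + rV_cons (x, y : measurableTypeR R).
  apply/rowP => i; rewrite !mxE; case: unliftP => [j ->|->]/=.
    by rewrite mulr0 add0r.
  by rewrite /GRing.scale/= mulr1.
apply: DeriveDef.
  apply: (derivable_affine (L := fun y : R => rV_cons (x, y)) L).
  exact: (dphi [::]).
exact: (derive_affine (L := fun y : R => rV_cons (x, y)) L).
Qed.

Let continuous_slice n (x : 'rV[R]_n) :
  continuous (fun y : R => rV_cons (x, y) : 'rV[R]_n.+1).
Proof.
move=> y; under eq_fun do rewrite rV_consE.
apply: cvgD; first exact: cvg_cst.
by apply: cvgZr_tmp; exact: cvg_id.
Qed.

(* [d/dy (e ^ (y A) M phi) = (A e ^ (y A) M) phi + (e ^ (y A) M) d_0 phi]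
   integrated over [0, +oo[ along the first coordinate. *)
Let integral_half_line n (A M : 'M[R]_p.+1) j k (phi : 'rV[R]_n.+1 -> R)
    (x : 'rV[R]_n) : test_function phi ->
  (\int[lebesgue_measure]_y (if 0 <= y then
      - ((expmx (y *: A) *m M) j k * partial ord0 phi (rV_cons (x, y))
         + (A *m expmx (y *: A) *m M) j k * phi (rV_cons (x, y))) else 0)%:E)%E =
  (M j k * phi (cons0 x))%:E.
Proof.
move=> tphi.
have [_ [k1 [k10 _ phik]]] := test_bounded tphi.
have [_ [k2 [k20 _ dphik]]] := test_bounded (test_partial ord0 tphi).
(* Strictly beyond both supports, so that the boundary term at [N] itself vanishes. *)
pose N := Num.max k1 k2 + 1.
have N0 : 0 < N by rewrite addr_gt0// lt_max k10.
have kN : Num.max k1 k2 < N by rewrite ltrDl.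
have out y : N <= y -> phi (rV_cons (x, y)) = 0 /\ partial ord0 phi (rV_cons (x, y)) = 0.
  move=> Ny; split.
    apply: phik => /(_ ord0); rewrite /= mxE unlift_none in_itv/= => /andP[_].
    by rewrite leNgt (lt_le_trans _ Ny)// (le_lt_trans _ kN)// le_max lexx.
  apply: dphik => /(_ ord0); rewrite /= mxE unlift_none in_itv/= => /andP[_].
  by rewrite leNgt (lt_le_trans _ Ny)// (le_lt_trans _ kN)// le_max lexx orbT.
(* The primitive carries the sign of the distributional derivative: Q N - Q 0 leaves exactly the
   value at y = 0. *)
pose Q := fun y : R => - ((expmx (y *: A) *m M) j k * phi (rV_cons (x, y))).
pose q := fun y : R => - ((expmx (y *: A) *m M) j k * partial ord0 phi (rV_cons (x, y))
         + (A *m expmx (y *: A) *m M) j k * phi (rV_cons (x, y))).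
have dQ y : is_derive y (1 : R) Q (q y).
  have h := is_deriveN (is_deriveM (is_derive_linr A M j k y) (is_derive_slice x y tphi)).
  by apply: is_derive_eq h _; rewrite /q /GRing.scale/= [X in _ + X]mulrC.
have cphi : continuous (fun y : R => phi (rV_cons (x, y))).
  move=> y; apply: continuous_comp; first exact: continuous_slice.
  exact: test_continuous tphi _.
have cdphi : continuous (fun y : R => partial ord0 phi (rV_cons (x, y))).
  move=> y; apply: continuous_comp; first exact: continuous_slice.
  exact: test_continuous (test_partial _ tphi) _.
have cexp B : continuous (fun y : R => (B *m expmx (y *: A) *m M) j k).
  have -> : (fun y : R => (B *m expmx (y *: A) *m M) j k) =
      fun y => \sum_l (\sum_m B j m * expmx (y *: A) m l) * M l k.
    by apply/funext => y; rewrite mxE; apply: eq_bigr => l _; rewrite mxE.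
  move=> y; apply: cvg_big => [|l _]; first exact: add_continuous.
  apply: cvgMl; apply: cvg_big => [|m _]; first exact: add_continuous.
  by apply: cvgMr; exact: continuous_expmx.
have cq : continuous q.
  move=> y; apply: cvgN; apply: cvgD; apply: cvgM; [|exact: cdphi|exact: cexp|exact: cphi].
  by have := cexp 1%:M y; under eq_fun do rewrite mul1mx.
have cQ : continuous Q.
  move=> y; apply: differentiable_continuous; apply/derivable1_diffP.
  by have [] := dQ y.
transitivity (\int[lebesgue_measure]_(y in `[0%R, N]) (q y)%:E)%E.
  rewrite [RHS]integral_mkcond; apply: eq_integral => y _ /=.
  rewrite /patch mem_setE in_itv/=; have [y0|y0]//= := leP 0 y.
  have [//|/ltW /out[-> ->]] := leP y N.
  by rewrite !mulr0 addr0 oppr0.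
rewrite (@continuous_FTC2 _ q Q)//.
- rewrite /Q (out N _).1// mulr0 oppr0 sub0e expmx0t mul1mx.
  by rewrite -EFinN opprK.
- exact: continuous_subspaceT.
- split.
  + by move=> y _; have [] := dQ y.
  + by apply: cvg_at_right_filter; exact: cQ.
  + by apply: cvg_at_left_filter; exact: cQ.
- by move=> y _; rewrite derive1E; apply: derive_val.
Qed.

(** By Fubini the integral along the first coordinate is [integral_half_line], with [M] the kernel
    of the remaining matrices at [x]. The operator of index 0 has thus produced a Dirac mass in that
    coordinate, which restricts [phi] to the hyperplane. *)
Let fof_ord0 n (A : 'I_n.+1 -> 'M[R]_p.+1) (C0 : R) j k (phi : 'rV[R]_n.+1 -> R) :
  (forall x j k, `|green A x j k| <= C0) -> test_function phi ->
  first_order_factor A (fun j k => regular_distribution (fun x => green A x j k))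
    ord0 j k phi =
  regular_distribution (fun x => green (fun i => A (lift ord0 i)) x j k)
    (phi \o @cons0 R n).
Proof.
move=> gC tphi; have tdphi := test_partial ord0 tphi.
rewrite /first_order_factor /partial_distribution /regular_distribution.
have int1 j' : (lebesgue_rV n.+1).-integrable setT
    (EFin \o (fun x => green A x j' k * phi x)).
  by apply: (integrable_test _ (C0 := C0)) => //; exact: measurable_green.
have int2 : (lebesgue_rV n.+1).-integrable setT
    (EFin \o (fun x => green A x j k * partial ord0 phi x)).
  by apply: (integrable_test _ (C0 := C0)) => //; exact: measurable_green.
have int3 : (lebesgue_rV n.+1).-integrable setT
    (EFin \o (fun x => \sum_l A ord0 j l * (green A x l k * phi x))).
  by apply: integrable_EFin_sum => // l; exact: integrable_EFinZ.
have -> : \sum_l A ord0 j l * \int[lebesgue_rV n.+1]_x (green A x l k * phi x) =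
    \int[lebesgue_rV n.+1]_x (\sum_l A ord0 j l * (green A x l k * phi x)).
  rewrite Rintegral_sum// => [|l]; last exact: integrable_EFinZ.
  by apply: eq_bigr => l _; rewrite RintegralZl.
rewrite -opprD -RintegralD// -mulN1r -RintegralZl//; last exact: integrable_EFinD.
rewrite /Rintegral integrable_lebesgue_rVS; last first.
  by apply: integrable_EFinZ => //; exact: integrable_EFinD.
congr fine; apply: eq_integral => x _.
rewrite -[RHS](integral_half_line (A ord0)); last exact: tphi.
apply: eq_integral => y _; rewrite green_cons; case: ifPn => y0.
  rewrite mulN1r; congr (- (_ + _))%:E.
  rewrite -mulmxA [(_ *m (_ *m _)) j k]mxE mulr_suml; apply: eq_bigr => l _.
  by rewrite mulrA.
rewrite mul0mx mxE mul0r add0r big1 ?mulr0// => l _.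
by rewrite mxE mul0r mulr0.
Qed.

(** The operators of positive index differentiate along the hyperplane only, hence commute with the
    restriction to it. *)
Let foldl_fof_lift n (A : 'I_n.+1 -> 'M[R]_p.+1) (s : seq 'I_n)
    (H : 'I_p.+1 -> 'I_p.+1 -> functional) (H' : 'I_p.+1 -> 'I_p.+1 -> functional) :
  (forall j k phi, test_function phi -> H j k phi = H' j k (phi \o @cons0 R n)) ->
  forall j k phi, test_function phi ->
    foldl (first_order_factor A) H (map (lift ord0) s) j k phi =
    foldl (first_order_factor (fun i => A (lift ord0 i))) H' s j k (phi \o @cons0 R n).
Proof.
elim: s H H' => [//|i s IH] H H' HH'; apply: IH => j k phi tphi /=.
rewrite /first_order_factor /partial_distribution HH'; last exact: test_partial.
have -> : partial (lift ord0 i) phi \o @cons0 R n = partial i (phi \o @cons0 R n).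
  exact: esym (partials_cons0 phi [:: i]).
by congr (_ - _); apply: eq_bigr => l _; rewrite HH'.
Qed.

(** Induction on [d]: index 0 heads the enumeration, so [fof_ord0] removes the operator that acts
    first, and all later indices are lifted ones. *)
Lemma product_operator_green d (A : 'I_d -> 'M[R]_p.+1) j k phi :
  (forall i, stable_mx (A i)) -> test_function phi ->
  product_operator A
    (fun j k => regular_distribution (fun x => green A x j k)) j k phi =
  (j == k)%:R * phi 0.
Proof.
elim: d A phi => [|n IH] A phi stA tphi.
  (* In dimension 0 the space is one point carrying a Dirac mass, and the empty product of
     exponentials is the identity. *)
  rewrite /product_operator enum_ord0/= /regular_distribution /Rintegral/=.
  have e0 (x : 'rV[R]_0) : x = 0 by apply/rowP => -[].
  rewrite [X in fine X](_ : _ = (\int[\d_(0%R : 'rV[R]_0)]_x ((j == k)%:R * phi 0)%:E)%E).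
    by rewrite integral_cst//= indicE mem_set// mulr1.
  apply: eq_integral => x _; rewrite (e0 x) /green big_ord0.
  by rewrite (introT forallP) ?mxE// => -[].
rewrite /product_operator enum_ordSl/=.
have [C0 gC] := green_bounded stA.
rewrite (@foldl_fof_lift n A _ _ (fun j k =>
  regular_distribution (fun x => green (fun i => A (lift ord0 i)) x j k)))//; last first.
  by move=> j' k' psi tpsi; exact: fof_ord0 gC tpsi.
rewrite [LHS](IH (fun i => A (lift ord0 i)))//; last exact: test_cons0.
congr (_ * phi _); apply/rowP => i; rewrite !mxE.
by case: unliftP => // *; rewrite mxE.
Qed.

Lemma locally_L1_green d (A : 'I_d -> 'M[R]_p.+1) j k :
  (forall i, stable_mx (A i)) -> locally_L1 (fun x => green A x j k).
Proof.
move=> stA; split; first exact: measurable_green.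
move=> K cK; have mK := compact_measurable_rV cK.
apply: measurable_bounded_integrable => //.
- exact: lebesgue_rV_bounded_lty (compact_bounded cK).
- exact: measurable_funTS (measurable_green A j k).
have [C0 gC] := green_bounded stA.
exists C0; split; [exact: num_real|move=> N /ltW CN x _].
exact: le_trans (gC _ _ _) CN.
Qed.

Lemma fundamental_solution_green d (A : 'I_d -> 'M[R]_p.+1) :
  (forall i, stable_mx (A i)) ->
  fundamental_solution A
    (fun j k => regular_distribution (fun x => green A x j k)).
Proof.
move=> stA; have [C0 gC] := green_bounded stA.
split=> [j k|j k phi]; last exact: product_operator_green.
have intg phi : test_function phi -> (lebesgue_rV d).-integrable setT
    (EFin \o (fun x => green A x j k * phi x)).
  by move=> tphi; apply: (integrable_test _ (C0 := C0)) => //; exact: measurable_green.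
split=> [a phi psi tphi tpsi|K cK].
  rewrite /regular_distribution -RintegralZl ?intg//.
  rewrite -RintegralD ?intg//; last exact: integrable_EFinZ (intg _ tphi).
  by apply: eq_Rintegral => x _; rewrite mulrDr mulrCA.
have mK := compact_measurable_rV cK.
have lK := lebesgue_rV_bounded_lty mK (compact_bounded cK).
(* A bounded density defines a distribution of order 0. *)
exists (C0 * fine (lebesgue_rV d K)), 0 => phi M tphi phiK phiM.
have M0 x : `|phi x| <= M by exact: (phiM [::]).
rewrite /regular_distribution; apply: (le_trans (le_normr_Rintegral _ (intg _ tphi))) => //.
have -> : \int[lebesgue_rV d]_x `|green A x j k * phi x| =
    \int[lebesgue_rV d]_(x in K) `|green A x j k * phi x|.
  rewrite [RHS]Rintegral_mkcond; apply: eq_Rintegral => x _.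
  rewrite /patch; case: ifPn => //; rewrite notin_setE => /phiK ->.
  by rewrite mulr0 normr0.
apply: (@le_trans _ _ (\int[lebesgue_rV d]_(x in K) (C0 * M))).
  apply: le_Rintegral => //.
  - apply: (integrableS measurableT) => //.
    exact: (integrable_norm (intg _ tphi)).
  - apply: measurable_bounded_integrable => //.
    exists (C0 * M); split; [exact: num_real|move=> N CN x _ /=].
    rewrite ger0_norm; first exact: ltW.
    by rewrite mulr_ge0// (le_trans (normr_ge0 _) (gC 0 j k), le_trans (normr_ge0 _) (M0 0)).
  - by move=> x _; rewrite normrM ler_pM.
by rewrite Rintegral_cst// mulrAC.
Qed.

End fundamental_solution.

(** * Tail bounds and completeness of convergence in probability *)

Section tail_bounds.
Context d (T : measurableType d) (R : realType) (P : probability T R).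

(* [X] itself need not be measurable. *)
Definition tail_le (X : T -> R) (e : R) (k : \bar R) :=
  exists E, [/\ measurable E, (P E <= k)%E & forall w, ~ E w -> `|X w| < e].

Lemma tail_leW X e e' k k' : e <= e' -> (k <= k')%E -> tail_le X e k -> tail_le X e' k'.
Proof.
move=> ee kk [E [mE PE XE]]; exists E; split => //; first exact: le_trans kk.
by move=> w /XE; move=> /lt_le_trans; apply.
Qed.

Lemma tail_le_ae X Y e k : (\forall w \ae P, X w = Y w) -> tail_le X e k -> tail_le Y e k.
Proof.
move=> [N [mN PN XYN]] [E [mE PE XE]]; exists (E `|` N); split.
- exact: measurableU.
- by rewrite measureU0.
- move=> w EN; rewrite -(_ : X w = Y w); first by apply: XE => Ew; apply: EN; left.
  by apply: contrapT => XYw; apply: EN; right; exact: XYN.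
Qed.

Lemma tail_leD X Y e e' k k' : tail_le X e k -> tail_le Y e' k' ->
  tail_le (fun w => X w + Y w) (e + e') (k + k')%E.
Proof.
move=> [E [mE PE XE]] [F [mF PF YF]]; exists (E `|` F); split.
- exact: measurableU.
- by apply: (le_trans (measureU2 _ _ _)) => //; exact: leeD.
- move=> w EF; apply: (le_lt_trans (ler_normD _ _)).
  by apply: ltrD; [apply: XE => ?; apply: EF; left|apply: YF => ?; apply: EF; right].
Qed.

Lemma tail_le_cst (c e : R) k : `|c| < e -> (0 <= k)%E -> tail_le (fun=> c) e k.
Proof. by move=> ce k0; exists set0; split; rewrite ?measure0. Qed.

Lemma tail_le_markov X (Y : T -> \bar R) e r :
  0 < r -> measurable_fun setT Y -> (forall w, 0 <= Y w)%E ->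
  (forall w, (Y w < r%:E)%E -> `|X w| < e) ->
  tail_le X e (r^-1%:E * \int[P]_w Y w)%E.
Proof.
move=> r0 mY Y0 XY; exists [set w | (r%:E <= Y w)%E]; split.
- by rewrite -[X in measurable X]setTI; exact: emeasurable_fun_c_infty.
- rewrite lee_pdivlMl//.
  have := @le_integral_comp_abse _ _ _ P setT measurableT Y r id.
  rewrite setTI => /(_ (@measurable_id _ _ _) (fun _ => id)).
  rewrite (eq_integral Y) => [|w _]; last by rewrite /= gee0_abs.
  have -> : [set w | r%:E <= Y w]%E = [set w | r%:E <= `|Y w|]%E.
    by apply/seteqP; split=> w /=; rewrite gee0_abs.
  by apply => // x y _ _.
- by move=> w /negP; rewrite -ltNge; exact: XY.
Qed.

Lemma tail_le_prob X e k : measurable_fun setT X -> tail_le X e k ->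
  (P [set w | (e <= `|X w|)%R] <= k)%E.
Proof.
move=> mX [E [mE PE XE]]; apply: le_trans PE; apply: le_measure; rewrite ?inE//.
  rewrite -[X in measurable X]setTI.
  have mnX := measurableT_comp (@normr_measurable R setT) mX.
  exact: (measurable_fun_le measurableT (measurable_cst e) mnX).
by move=> w /= h; apply: contrapT => /XE; rewrite ltNge h.
Qed.

End tail_bounds.

Section completeness_in_probability.
Context d (T : measurableType d) (R : realType) (P : probability T R).

Let mset (X Y : T -> R) (e : R) : measurable_fun setT X -> measurable_fun setT Y ->
  measurable [set w | e <= `|X w - Y w|].
Proof.
move=> mX mY; rewrite -[X in measurable X]setTI.
apply: measurable_fun_le => //.
exact: measurableT_comp (measurable_funB mX mY).
Qed.

(* A subsequence with [P (|Z_(k+1) - Z_k| >= 2 ^ - k.+1) <= 2 ^ - k.+1]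
   converges almost surely. *)
Lemma cvg_in_probability_complete (X : nat -> T -> R) :
  (forall n, measurable_fun setT (X n)) ->
  (forall e : R, 0 < e -> exists N, forall n m, (N <= n)%N -> (N <= m)%N ->
     (P [set w | (e <= `|X n w - X m w|)%R] <= e%:E)%E) ->
  exists Y : {RV P >-> R}, cvg_in_probability P X Y.
Proof.
move=> mX cauchyX.
pose a k : R := 1 / 2 ^+ k.
have a0 k : 0 < a k by rewrite divr_gt0// exprn_gt0.
have aS k : a k.+1 + a k.+1 = a k.
  by rewrite /a exprS; field; rewrite expf_neq0.
have /choice[N0 HN0] : forall k, exists N, forall n m, (N <= n)%N -> (N <= m)%N ->
    (P [set w | (a k.+1 <= `|X n w - X m w|)%R] <= (a k.+1)%:E)%E.
  by move=> k; exact: cauchyX.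
(* Summing gives nondecreasing indices that still exceed [N0 k]. *)
pose N k := (\sum_(i < k.+1) N0 i)%N.
have NN0 k : (N0 k <= N k)%N by rewrite /N big_ord_recr/= leq_addl.
have NS k : (N k <= N k.+1)%N by rewrite /N [leqRHS]big_ord_recr/= leq_addr.
pose Z k := X (N k).
pose F k := [set w | a k.+1 <= `|Z k.+1 w - Z k w|].
have mF k : measurable (F k) by apply: mset; exact: mX.
have PF k : (P (F k) <= (a k.+1)%:E)%E.
  by apply: HN0 => //; exact: leq_trans (NN0 k) (NS k).
(* Outside of [G j] every increment from index [j] on is small, so the convergence there is uniform,
   with error [a j]. *)
pose G j := \bigcup_(i in ~` `I_j) F i.
have mG j : measurable (G j) by apply: bigcup_measurable => i _.
have PG j : (P (G j) <= (a j)%:E)%E.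
  have := @measure_sigma_subadditive_tail _ _ _ P (G j) F j mF (mG j) (@subset_refl _ _).
  move=> /le_trans; apply.
  apply: (@le_trans _ _ (\sum_(j <= n <oo) (a n.+1)%:E)%E).
    by apply: lee_nneseries => *; [exact: measure_ge0|exact: PF].
  have h := @cvg_geometric_series_half R 1 j.
  have -> : (\sum_(j <= n <oo) (a n.+1)%:E)%E = (a j)%:E :> \bar R; last by [].
  apply/cvg_lim => //; rewrite -(cvg_shiftn j).
  rewrite (_ : (fun _ => _) = EFin \o series (fun k : nat => 1 / (2 ^ (k + j.+1))%:R)).
    by apply/cvg_EFin; [exact: nearW|exact: h].
  apply/funext => n /=; rewrite /series/= sumEFin; congr EFin.
  rewrite -{1}[j]add0n big_addn addnK; apply: eq_bigr => i _.
  by rewrite /a natrX addnS.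
have Zle j w : ~ G j w -> forall m, `|Z (m + j)%N w - Z j w| <= a j - a (m + j)%N.
  move=> Gw; elim=> [|m IH]; first by rewrite add0n !subrr normr0.
  have : `|Z (m + j).+1 w - Z (m + j)%N w| < a (m + j).+1.
    rewrite ltNge; apply/negP => Fw; apply: Gw; exists (m + j)%N => //=.
    by apply/negP; rewrite -leqNgt leq_addl.
  rewrite addSn => h; have := aS (m + j)%N => h2.
  rewrite -(subrK (Z (m + j)%N w) (Z (m + j).+1 w)) -addrA.
  by apply: (le_trans (ler_normD _ _)); lra.
have Zcvg j w : ~ G j w -> cvgn (fun k => Z k w).
  move=> Gw.
  (* Adding [a] makes the sequence monotone: an increment of [Z] is below [a n.+1], which is exactly
     how much [a] drops between n and n + 1. *)
  pose v n := Z (n + j)%N w + a (n + j)%N.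
  have cv : cvgn v.
    apply: nonincreasing_is_cvgn.
      apply/nonincreasing_seqP => n; rewrite /v addSn.
      have : `|Z (n + j).+1 w - Z (n + j)%N w| < a (n + j).+1.
        rewrite ltNge; apply/negP => Fw; apply: Gw; exists (n + j)%N => //=.
        by apply/negP; rewrite -leqNgt leq_addl.
      by rewrite ltr_norml => /andP[_]; have := aS (n + j)%N; lra.
    exists (Z j w - a j) => _ [n _ <-]; rewrite /v.
    have := Zle _ _ Gw n; rewrite ler_norml => /andP[+ _].
    by have := a0 (n + j)%N; lra.
  have ca : (fun n => a (n + j)%N) @ \oo --> (0 : R).
    rewrite (cvg_shiftn j a).
    rewrite (_ : a = geometric 1 (2^-1)); last first.
      by apply/funext => k; rewrite /a /geometric/= exprVn.
    by apply: cvg_geometric; rewrite ger0_norm// invf_lt1// ltr1n.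
  apply/cvg_ex; exists (limn v - 0); rewrite -(cvg_shiftn j).
  rewrite (_ : (fun n => _) = fun n => v n - a (n + j)%N); last first.
    by apply/funext => n; rewrite /v addrK.
  exact: cvgB.
pose B := \bigcap_j G j.
have mB : measurable B by apply: bigcap_measurable => // j _.
(* Cutting off the exceptional set makes the sequence converge at every point, hence its limit
   measurable. *)
pose h k w := Z k w * \1_(~` B) w.
have hcvg w : cvgn (fun k => h k w).
  rewrite /h indicE; have [Bw|Bw] := pselect (B w).
    rewrite memNset; last by move=> /(_ Bw).
    by under eq_fun do rewrite mulr0; exact: is_cvg_cst.
  rewrite mem_set//; under eq_fun do rewrite mulr1.
  have [j Gj] : exists j, ~ G j w.
    by apply: contrapT => /forallNP nG; apply: Bw => j _; apply: contrapT; exact: nG.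
  exact: Zcvg Gj.
pose Y0 w := limn (fun k => h k w).
have mY0 : measurable_fun setT Y0.
  apply: (@measurable_fun_cvg _ _ _ _ h) => [k|w _]; last exact: hcvg.
  apply: measurable_funM; first exact: mX.
  exact/measurable_indic/measurableC.
have ZY j w : ~ G j w -> `|Z j w - Y0 w| <= a j.
  move=> Gw.
  have Bw : ~ B w by move=> /(_ j I).
  have hZ : (fun k => h k w) = fun k => Z k w.
    by apply/funext => k; rewrite /h indicE mem_set// mulr1.
  have cZ : (fun k => `|Z j w - Z (k + j)%N w|) @ \oo --> `|Z j w - Y0 w|.
    apply: cvg_norm; apply: cvgB; first exact: cvg_cst.
    by rewrite (cvg_shiftn j (fun k => Z k w)) /Y0 hZ; exact: Zcvg Gw.
  rewrite -(cvg_lim _ cZ)//; apply: limr_le; first by apply/cvg_ex; eexists; exact: cZ.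
  apply: nearW => k; rewrite distrC; apply: le_trans (Zle _ _ Gw k) _.
  by rewrite lerBlDr lerDl ltW.
pose Y : {RV P >-> R} := mfun_Sub (mem_set mY0).
exists Y => e e0.
(* The whole sequence is compared to the limit through [Z j]: the Cauchy property controls X n - Z
   j, and [ZY] controls Z j - Y outside of [G j]. *)
have PY j n : (N0 j <= n)%N -> a j < e / 2 -> (P [set w | (e <= `|X n w - Y w|)%R] <= (a j + a j)%:E)%E.
  move=> jn aje.
  have sub : [set w | (e <= `|X n w - Y w|)%R] `<=` [set w | a j.+1 <= `|X n w - Z j w|] `|` G j.
    move=> w /= ew; apply: contrapT => /not_orP[/negP]; rewrite -ltNge => h1 /ZY h2.
    have : `|X n w - Y0 w| < e.
      rewrite -(subrK (Z j w) (X n w)) -addrA; apply: (le_lt_trans (ler_normD _ _)).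
      by have := aS j; have := a0 j.+1; lra.
    by rewrite ltNge ew.
  apply: (le_trans (le_measure _ _ _ sub)); rewrite ?inE.
  - by apply: mset; [exact: mX|exact: mY0].
  - by apply: measurableU => //; apply: mset; exact: mX.
  apply: (le_trans (measureU2 _ _ _)) => //; first by apply: mset; exact: mX.
  rewrite EFinD; apply: leeD; last exact: PG.
  apply: (@le_trans _ _ (a j.+1)%:E); first exact: HN0.
  by rewrite lee_fin; have := aS j; have := a0 j.+1; lra.
have ca : a @ \oo --> (0 : R).
  rewrite (_ : a = geometric 1 (2^-1)); last first.
    by apply/funext => k; rewrite /a /geometric/= exprVn.
  by apply: cvg_geometric; rewrite ger0_norm// invf_lt1// ltr1n.
have mXY n : measurable [set w | e <= `|X n w - Y w|].
  by apply: mset; [exact: mX|exact: mY0].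
apply/fine_cvgP; split; first by apply: nearW => n; exact: fin_num_measure.
apply/cvgrPdist_le => r r0.
have [j /andP[aje ajr]] : exists j, (a j < e / 2) && (a j < r / 2).
  have /cvgrPdist_lt /(_ (Num.min (e / 2) (r / 2))) := ca.
  rewrite lt_min !divr_gt0// => /(_ isT)[j _ /(_ j (leqnn j))].
  by rewrite sub0r normrN ger0_norm ?(ltW (a0 j))// lt_min => h'; exists j.
exists (N0 j) => // n /= jn; have := PY j n jn aje.
rewrite sub0r normrN ger0_norm ?fine_ge0//.
rewrite -[X in (X <= _)%E]fineK ?fin_num_measure//.
rewrite lee_fin => /le_trans; apply.
lra.
Qed.

End completeness_in_probability.

(** * Moments of Poisson random measures *)

Section poisson_moments.
Context {R : realType}.

Definition poisson_weight (q : R) (k : nat) : R := expR (- q) * q ^+ k / k`!%:R.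

Lemma poisson_weight_ge0 q k : 0 <= q -> 0 <= poisson_weight q k.
Proof. by move=> q0; rewrite divr_ge0// mulr_ge0 ?expR_ge0// exprn_ge0. Qed.

Lemma poisson_weightS q k : k.+1%:R * poisson_weight q k.+1 = q * poisson_weight q k.
Proof.
rewrite /poisson_weight factS natrM exprS; field.
by rewrite pnatr_eq0 -lt0n fact_gt0/= gt_eqF// ltr_pwDl.
Qed.

Lemma poisson_moment0 (q : R) : 0 <= q ->
  (\sum_(0 <= k <oo) (poisson_weight q k)%:E = 1)%E.
Proof.
move=> q0; rewrite (eq_eseriesr (g := fun k => ((expR (- q))%:E * (exp_coeff q k)%:E)%E)).
  rewrite nneseriesZl/=; last by move=> i _; rewrite lee_fin exp_coeff_ge0.
  rewrite [X in (_ * X)%E](_ : _ = (expR q)%:E).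
    by rewrite -EFinM -expRD addNr expR0.
  rewrite /expR -EFin_lim; last exact: is_cvg_series_exp_coeff.
  by apply/congr_lim/funext => n/=; rewrite /series/= sumEFin.
by move=> k _; rewrite -EFinM /exp_coeff/= mulrA.
Qed.

(** The Chen-Stein identity E [N g (N)] = q E [g (N + 1)] of the Poisson law; g = 1 and g = id give
    the first two moments. *)
Let moment_shift (q : R) (g : nat -> R) : 0 <= q -> (forall k, 0 <= g k) ->
  (\sum_(0 <= k <oo) (k%:R * g k * poisson_weight q k)%:E =
   q%:E * \sum_(0 <= k <oo) (g k.+1 * poisson_weight q k)%:E)%E.
Proof.
move=> q0 g0; rewrite -nneseriesZl; last first.
  by move=> k _; rewrite lee_fin mulr_ge0// poisson_weight_ge0.
rewrite nneseries_recl//; last first.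
  by move=> k _; rewrite lee_fin mulr_ge0 ?poisson_weight_ge0// mulr_ge0.
rewrite !mul0r add0e -(nneseries_addn 1); last first.
  by move=> k; rewrite lee_fin mulr_ge0 ?poisson_weight_ge0// mulr_ge0.
apply: eq_eseriesr => k _; rewrite addn1 -EFinM; congr EFin.
by rewrite mulrAC poisson_weightS; ring.
Qed.

Lemma poisson_moment1 (q : R) : 0 <= q ->
  (\sum_(0 <= k <oo) (k%:R * poisson_weight q k)%:E = q%:E)%E.
Proof.
move=> q0; rewrite (eq_eseriesr (g := fun k => (k%:R * 1 * poisson_weight q k)%:E)).
  rewrite (@moment_shift _ (fun=> 1))//.
  under eq_eseriesr do rewrite mul1r.
  by rewrite poisson_moment0// mule1.
by move=> k _; rewrite mulr1.
Qed.

Lemma poisson_moment2 (q : R) : 0 <= q ->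
  (\sum_(0 <= k <oo) (k%:R ^+ 2 * poisson_weight q k)%:E = (q ^+ 2 + q)%:E)%E.
Proof.
move=> q0; rewrite (eq_eseriesr (g := fun k => (k%:R * k%:R * poisson_weight q k)%:E)).
  rewrite (@moment_shift _ (fun k => k%:R))//.
  under eq_eseriesr do rewrite -natr1 mulrDl mul1r EFinD.
  rewrite nneseriesD; last 2 first.
  - by move=> k _ _; rewrite lee_fin mulr_ge0// poisson_weight_ge0.
  - by move=> k _ _; rewrite lee_fin poisson_weight_ge0.
  rewrite poisson_moment1// poisson_moment0// -EFinD -EFinM; congr EFin; ring.
by move=> k _; rewrite expr2.
Qed.

End poisson_moments.

Section nnsfun_sum.
Context {dY} {Y : measurableType dY} {R : realType}.
Implicit Types (m : {measure set Y -> \bar R}) (f : {nnsfun Y >-> R}).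

Lemma nnsfun_integral_sum m f : (\int[m]_y (f y)%:E =
  \sum_(x <- finmap.enum_fset (fset_set (range f))) x%:E * m (f @^-1` [set x]))%E.
Proof. by rewrite integral_nnsfun// patch_setT sintegralE fsbig_finite. Qed.

Lemma nnsfun_preimage_ge0 m f (x : R) : (0 <= x%:E * m (f @^-1` [set x]))%E.
Proof.
have [x0|x0] := leP 0 x; first by rewrite mule_ge0.
by rewrite preimage_nnfun0// measure0 mule0.
Qed.

Lemma nnsfun_approx_le (h : Y -> \bar R) (mh : measurable_fun setT h) n y :
  (forall y, 0 <= h y)%E -> ((nnsfun_approx measurableT mh n y)%:E <= h y)%E.
Proof.
move=> h0; have hy := cvg_nnsfun_approx measurableT mh (fun y _ => h0 y) (I : setT y).
rewrite -(cvg_lim _ hy)//; apply: lime_ge; first by apply/cvg_ex; eexists; exact: hy.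
by exists n => // m /= nm; rewrite lee_fin; exact/lefP/nd_nnsfun_approx.
Qed.

End nnsfun_sum.

Section poisson_counts.
Context {d dY} {T : measurableType d} {Y : measurableType dY} {R : realType}.
Variables (P : probability T R) (q : {measure set Y -> \bar R}) (p : R.-ker T ~> Y).

Definition poisson_counts := forall B, measurable B -> (q B < +oo)%E ->
  forall k : nat, P [set w | p w B = (k%:R)%:E] = (poisson_weight (fine (q B)) k)%:E.

Hypothesis pq : poisson_counts.

Let mp B : measurable B -> measurable_fun setT (fun w => p w B).
Proof. exact: measurable_kernel. Qed.

Let mcount B k : measurable B -> measurable [set w | p w B = (k%:R)%:E].
Proof.
move=> mB; rewrite -[X in measurable X]setTI.
exact: (mp mB measurableT (emeasurable_set1 _)).
Qed.

(** The Poisson weights sum to 1, so the events where the count equals an integer partition a set of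
    full probability, and [X] is only described there. *)
Lemma integral_poisson_counts B (X : T -> \bar R) (g : nat -> R) :
  measurable B -> (q B < +oo)%E ->
  measurable_fun setT X -> (forall w, 0 <= X w)%E ->
  (forall w k, p w B = (k%:R)%:E -> X w = (g k)%:E) ->
  (\int[P]_w X w = \sum_(0 <= k <oo) (g k * poisson_weight (fine (q B)) k)%:E)%E.
Proof.
move=> mB qB mX X0 Xg.
pose E k := [set w | p w B = (k%:R)%:E].
have mE k : measurable (E k) by exact: mcount.
have tE : trivIset setT E.
  move=> i j _ _ [w [/= Ei Ej]].
  by move: Ei; rewrite /E/= Ej => -[] /eqP; rewrite eqr_nat => /eqP.
have mEU : measurable (\bigcup_k E k) by exact: bigcup_measurable.
have PE : P (\bigcup_k E k) = 1%E.
  rewrite measure_bigcup//= -(@poisson_moment0 _ (fine (q B)))//.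
    rewrite (@eq_eseriesl _ _ xpredT) => [|k]; last by rewrite in_setT.
    by apply: eq_eseriesr => k _; rewrite /E pq.
rewrite (ge0_negligible_integral (N := ~` \bigcup_k E k))//; last 2 first.
- exact: measurableC.
- by rewrite [LHS]probability_setC// PE subee.
rewrite setTD setCK ge0_integral_bigcup//; last exact: measurable_funTS.
apply: eq_eseriesr => k _.
rewrite (eq_integral (fun=> (g k)%:E)); last by move=> w; rewrite inE => /Xg.
by rewrite integral_cst//= /E pq.
Qed.

Lemma mean_poisson_count B : measurable B -> (q B < +oo)%E ->
  (\int[P]_w p w B = q B)%E.
Proof.
move=> mB qB; rewrite (integral_poisson_counts (g := fun k => k%:R) mB)//.
- by rewrite poisson_moment1 ?fine_ge0// fineK// ge0_fin_numE.
- exact: mp.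
Qed.

Lemma mean_poisson_count_le B : measurable B -> (\int[P]_w p w B <= q B)%E.
Proof.
move=> mB; have [->|] := eqVneq (q B) +oo%E; first exact: leey.
by rewrite -ltey => qB; rewrite mean_poisson_count.
Qed.

(** The inequality 1 - e ^ (- q) <= q. *)
Lemma poisson_count_neq0 B : measurable B -> (P [set w | p w B <> 0%E] <= q B)%E.
Proof.
move=> mB; have [->|] := eqVneq (q B) +oo%E; first exact: leey.
rewrite -ltey => qB.
have -> : [set w | p w B <> 0%E] = ~` [set w | p w B = 0%:R%:E] by [].
rewrite probability_setC; last exact: mcount.
rewrite pq// /poisson_weight expr0 fact0 divr1 mulr1.
rewrite -[leRHS]fineK ?ge0_fin_numE// -EFinB lee_fin.
by rewrite lerBlDl -lerBlDr -[leLHS]/(_ + _) expR_ge1Dx.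
Qed.

Lemma ae_poisson_count_fin B : measurable B -> (q B < +oo)%E ->
  \forall w \ae P, (p w B < +oo)%E.
Proof.
move=> mB qB; have : P.-integrable setT (fun w => p w B).
  apply/integrableP; split; first exact: mp.
  by under eq_integral do rewrite gee0_abs//; rewrite mean_poisson_count.
move=> /(integrable_ae measurableT); apply: filterS => w /= /(_ I).
by rewrite ge0_fin_numE.
Qed.

(** One half of Campbell's formula, by linearity on simple functions and monotone convergence. As an
    inequality it holds trivially on level sets of infinite intensity, and it is all that Markov's
    inequality takes. *)
Lemma campbell (h : Y -> \bar R) : measurable_fun setT h -> (forall y, 0 <= h y)%E ->
  (\int[P]_w \int[p w]_y h y <= \int[q]_y h y)%E.
Proof.
move=> mh h0; pose g := nnsfun_approx measurableT mh.
have cvg_h (m : {measure set Y -> \bar R}) :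
    (\int[m]_y (g n y)%:E)%E @[n --> \oo] --> (\int[m]_y h y)%E.
  rewrite [X in _ --> X](_ : _ = \int[m]_y (limn (fun n => (g n y)%:E)))%E.
    apply: cvg_monotone_convergence => //.
    - by move=> n; exact/measurable_EFinP.
    - by move=> n y _; rewrite lee_fin; exact: fun_ge0.
    - by move=> y _ i j ij; rewrite lee_fin; exact/lefP/nd_nnsfun_approx.
  by apply: eq_integral => y _; apply/esym/cvg_lim => //; exact: cvg_nnsfun_approx.
have mint (f : {nnsfun Y >-> R}) : measurable_fun setT (fun w => \int[p w]_y (f y)%:E)%E.
  apply: measurable_fun_integral_kernel => //.
  - by move=> z; rewrite lee_fin; exact: fun_ge0.
  - exact/measurable_EFinP.
have step n : (\int[P]_w \int[p w]_y (g n y)%:E <= \int[q]_y (g n y)%:E)%E.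
  under [leLHS]eq_integral => w _ do rewrite (nnsfun_integral_sum (p w) (g n)).
  rewrite (nnsfun_integral_sum q (g n)) ge0_integral_sum//.
  - apply: lee_sum => x _; have [x0|x0] := leP 0 x.
      rewrite ge0_integralZl//; last exact: mp.
      by apply: lee_wpmul2l => //; exact: mean_poisson_count_le.
    rewrite preimage_nnfun0// measure0 mule0.
    by rewrite integral0_eq// => w _; rewrite measure0 mule0.
  - by move=> x; apply: measurable_funeM; apply: mp.
  - by move=> x w _; exact: nnsfun_preimage_ge0.
have nd i j w : (i <= j)%N -> (\int[p w]_y (g i y)%:E <= \int[p w]_y (g j y)%:E)%E.
  move=> ij; apply: ge0_le_integral => //.
  - by move=> y _; rewrite lee_fin.
  - exact/measurable_EFinP.
  - exact/measurable_EFinP.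
  - by move=> y _; rewrite lee_fin; exact/lefP/nd_nnsfun_approx.
have cvgP : (\int[P]_w \int[p w]_y (g n y)%:E)%E @[n --> \oo] -->
    (\int[P]_w \int[p w]_y h y)%E.
  rewrite [X in _ --> X](_ : _ = \int[P]_w (limn (fun n => \int[p w]_y (g n y)%:E)))%E.
    apply: cvg_monotone_convergence => //.
    - by move=> n w _; apply: integral_ge0 => y _; rewrite lee_fin.
    - by move=> w _ i j; exact: nd.
  by apply: eq_integral => w _; apply/esym/cvg_lim => //; exact: cvg_h.
rewrite -(cvg_lim _ cvgP)//; apply: lime_le.
  by apply/cvg_ex; eexists; exact: cvgP.
apply: nearW => n; apply: (le_trans (step n)); apply: ge0_le_integral => //.
- by move=> y _; rewrite lee_fin.
- exact/measurable_EFinP.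
- by move=> y _; exact: nnsfun_approx_le.
Qed.

Let N B w : R := fine (p w B).

Let mN B : measurable B -> measurable_fun setT (N B).
Proof. by move=> mB; apply: measurableT_comp (mp mB); exact: fine_measurable. Qed.

Let integral_N B : measurable B -> (q B < +oo)%E ->
  (\int[P]_w (N B w)%:E = (fine (q B))%:E)%E.
Proof.
move=> mB qB; rewrite (integral_poisson_counts (g := fun k => k%:R) mB)//.
- by rewrite poisson_moment1// fine_ge0.
- by apply/measurable_EFinP; exact: mN.
- by move=> w; rewrite lee_fin fine_ge0.
- by move=> w k; rewrite /N => ->.
Qed.

Let integral_N2 B : measurable B -> (q B < +oo)%E ->
  (\int[P]_w (N B w ^+ 2)%:E = (fine (q B) ^+ 2 + fine (q B))%:E)%E.
Proof.
move=> mB qB; rewrite (integral_poisson_counts (g := fun k => k%:R ^+ 2) mB)//.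
- by rewrite poisson_moment2// fine_ge0.
- by apply/measurable_EFinP; apply: measurable_funX; exact: mN.
- by move=> w; rewrite lee_fin sqr_ge0.
- by move=> w k; rewrite /N => ->.
Qed.

Let integrable_N B : measurable B -> (q B < +oo)%E ->
  P.-integrable setT (EFin \o N B).
Proof.
move=> mB qB; apply/integrableP; split; first by apply/measurable_EFinP; exact: mN.
under eq_integral do rewrite gee0_abs ?lee_fin ?fine_ge0//=.
by rewrite integral_N// ltry.
Qed.

Let integrable_N2 B : measurable B -> (q B < +oo)%E ->
  P.-integrable setT (EFin \o (fun w => N B w ^+ 2)).
Proof.
move=> mB qB; apply/integrableP; split.
  by apply/measurable_EFinP; apply: measurable_funX; exact: mN.
under eq_integral do rewrite gee0_abs ?lee_fin ?sqr_ge0//=.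
by rewrite integral_N2// ltry.
Qed.

Let integrable_NN B C : measurable B -> (q B < +oo)%E ->
  measurable C -> (q C < +oo)%E ->
  P.-integrable setT (EFin \o (fun w => N B w * N C w)).
Proof.
move=> mB qB mC qC.
have := integrable_EFinD measurableT (integrable_N2 mB qB) (integrable_N2 mC qC).
apply: le_integrable => //.
  by apply/measurable_EFinP; apply: measurable_funM; exact: mN.
move=> w _; rewrite /= lee_fin.
rewrite [leRHS]ger0_norm ?addr_ge0 ?sqr_ge0// ger0_norm ?mulr_ge0 ?fine_ge0//.
by have := sqr_ge0 (N B w - N C w); have := sqr_ge0 (N B w + N C w); nra.
Qed.

(* Polarization of the second moments of [p B], [p C] and [p (B `|` C)]; only
   the one-dimensional Poisson laws are involved. *)
Let integral_NN B C : measurable B -> (q B < +oo)%E ->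
  measurable C -> (q C < +oo)%E -> [disjoint B & C] ->
  \int[P]_w (N B w * N C w) = fine (q B) * fine (q C).
Proof.
move=> mB qB mC qC /disj_set2P BC.
have mU : measurable (B `|` C) by exact: measurableU.
have qE : q (B `|` C) = (q B + q C)%E by rewrite measureU.
have qU : (q (B `|` C) < +oo)%E by rewrite qE lte_add_pinfty.
have fE : fine (q (B `|` C)) = fine (q B) + fine (q C).
  by rewrite qE fineD ?ge0_fin_numE.
have H : (\int[P]_w (N (B `|` C) w ^+ 2)%:E = \int[P]_w ((N B w + N C w) ^+ 2)%:E)%E.
  apply: ge0_ae_eq_integral => //.
  - by apply/measurable_EFinP; apply: measurable_funX; exact: mN.
  - by apply/measurable_EFinP; apply: measurable_funX; apply: measurable_funD; exact: mN.
  - by move=> w _; rewrite lee_fin sqr_ge0.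
  - by move=> w _; rewrite lee_fin sqr_ge0.
  - have := ae_poisson_count_fin mB qB; have := ae_poisson_count_fin mC qC.
    apply: filterS2 => w pC pB _; congr ((_ ^+ 2)%:E).
    by rewrite /N measureU// fineD ?ge0_fin_numE.
have I1 := integrable_N2 mB qB; have I2 := integrable_N2 mC qC.
have I3 := integrable_NN mB qB mC qC.
have I4 := integrable_EFinZ measurableT 2 I3.
have e : \int[P]_w ((N B w + N C w) ^+ 2) = \int[P]_w (N B w ^+ 2) +
    (2 * \int[P]_w (N B w * N C w) + \int[P]_w (N C w ^+ 2)).
  rewrite -RintegralZl// -RintegralD// -RintegralD//; last exact: integrable_EFinD.
  by apply: eq_Rintegral => w _; ring.
have := congr1 fine H; rewrite integral_N2// -/(Rintegral _ _ _) e /Rintegral.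
rewrite [X in _ = fine X + _]integral_N2// [X in _ = _ + (_ + fine X)]integral_N2//= fE.
rewrite -/(Rintegral P setT (fun w => N B w * N C w)).
lra.
Qed.

Let Z B w : R := N B w - fine (q B).

Let integral_ZZ B C : measurable B -> (q B < +oo)%E ->
  measurable C -> (q C < +oo)%E ->
  P.-integrable setT (EFin \o (fun w => Z B w * Z C w)) /\
  \int[P]_w (Z B w * Z C w) = \int[P]_w (N B w * N C w) - fine (q B) * fine (q C).
Proof.
move=> mB qB mC qC.
have I1 := integrable_NN mB qB mC qC.
have I2 := integrable_EFinZ measurableT (- fine (q C)) (integrable_N mB qB).
have I3 := integrable_EFinZ measurableT (- fine (q B)) (integrable_N mC qC).
have I4 : P.-integrable setT (EFin \o cst (fine (q B) * fine (q C))).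
  exact: finite_measure_integrable_cst.
have I34 := integrable_EFinD measurableT I3 I4.
have I234 := integrable_EFinD measurableT I2 I34.
have e w : Z B w * Z C w = N B w * N C w + (- fine (q C) * N B w +
    (- fine (q B) * N C w + cst (fine (q B) * fine (q C)) w)).
  by rewrite /Z /=; ring.
under eq_fun do rewrite e.
split; first exact: integrable_EFinD.
rewrite RintegralD// RintegralD// RintegralD//.
rewrite RintegralZl//; last exact: integrable_N.
rewrite RintegralZl//; last exact: integrable_N.
have -> : \int[P]_w cst (fine (q B) * fine (q C)) w = fine (q B) * fine (q C).
  rewrite /Rintegral (eq_integral (cst (fine (q B) * fine (q C))%:E))// integral_cst//.
  transitivity (fine ((fine (q B) * fine (q C))%:E * 1)%E); last by rewrite mule1.
  by congr (fine (_ * _)%E); exact: probability_setT.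
rewrite /Rintegral !integral_N//=.
ring.
Qed.

Let poisson_covariance0 B C : measurable B -> (q B < +oo)%E ->
  measurable C -> (q C < +oo)%E -> [disjoint B & C] ->
  \int[P]_w (Z B w * Z C w) = 0.
Proof.
by move=> mB qB mC qC BC; rewrite (integral_ZZ mB qB mC qC).2 integral_NN// subrr.
Qed.

Let poisson_variance B : measurable B -> (q B < +oo)%E ->
  \int[P]_w (Z B w * Z B w) = fine (q B).
Proof.
move=> mB qB; rewrite (integral_ZZ mB qB mB qB).2.
under eq_Rintegral do rewrite -expr2.
by rewrite /Rintegral integral_N2//= -expr2 addrAC subrr add0r.
Qed.

(** The level of 0 is emptied: its intensity may be infinite, and it contributes 0 to every
    integral. All other levels of an integrable simple function have finite intensity. *)
Let level (f : {nnsfun Y >-> R}) (x : R) : set Y :=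
  if x == 0 then set0 else f @^-1` [set x].

Let mlevel f x : measurable (level f x).
Proof. by rewrite /level; case: ifP. Qed.

Let level_lty (m : {measure set Y -> \bar R}) (f : {nnsfun Y >-> R}) x :
  (\int[m]_y (f y)%:E < +oo)%E -> (m (level f x) < +oo)%E.
Proof.
move=> fy; rewrite /level; have [_|x0] := eqVneq x 0; first by rewrite measure0.
have [xneg|xpos] := ltP x 0; first by rewrite preimage_nnfun0// measure0.
have xp : 0 < x by rewrite lt_neqAle eq_sym x0.
have [xr|xr] := pselect (range f x); last first.
  rewrite (_ : _ @^-1` _ = set0) ?measure0//.
  by apply/seteqP; split => // y /= fyx; apply: xr; exists y.
have : (x%:E * m (f @^-1` [set x]) < +oo)%E.
  apply: le_lt_trans fy; rewrite (nnsfun_integral_sum m f).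
  rewrite (big_rem x)//=; last by rewrite in_fset_set// inE.
  by rewrite leeDl// sume_ge0// => z _; exact: nnsfun_preimage_ge0.
have [->|] := eqVneq (m (f @^-1` [set x])) +oo%E; first by rewrite gt0_muley ?lte_fin.
by rewrite -ltey.
Qed.

Let fine_nnsfun (m : {measure set Y -> \bar R}) (f : {nnsfun Y >-> R}) : (\int[m]_y (f y)%:E < +oo)%E ->
  fine (\int[m]_y (f y)%:E)%E =
  \sum_(x <- finmap.enum_fset (fset_set (range f))) x * fine (m (level f x)).
Proof.
move=> fy; rewrite (nnsfun_integral_sum m f).
rewrite (eq_bigr (fun x => (x * fine (m (level f x)))%:E)) ?sumEFin// => x _.
rewrite EFinM fineK ?ge0_fin_numE ?level_lty// /level.
by have [->|//] := eqVneq x 0; rewrite !mul0e.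
Qed.

Let nnsfun_sqr (f : {nnsfun Y >-> R}) : (\int[q]_y (f y)%:E < +oo)%E ->
  (\int[q]_y (f y ^+ 2)%:E)%E =
  (\sum_(x <- finmap.enum_fset (fset_set (range f))) x ^+ 2 * fine (q (level f x)))%:E.
Proof.
move=> fy.
transitivity (\int[q]_y \sum_(x <- finmap.enum_fset (fset_set (range f)))
    (x ^+ 2)%:E * (\1_(level f x) y)%:E)%E.
  apply: eq_integral => y _.
  rewrite (big_rem (f y))/=; last by rewrite in_fset_set// inE; exists y.
  rewrite big1_seq ?adde0 => [|x /=]; last first.
    rewrite mem_rem_uniq ?finmap.fset_uniq// inE => /andP[xfy _].
    have nl : ~ level f x y.
      by rewrite /level; case: ifP => _ //= xy; move: xfy; rewrite xy eqxx.
    by rewrite -EFinM indicE memNset// mulr0.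
  rewrite -EFinM indicE /level; case: ifP => [/eqP ->|_]; first by rewrite expr0n mul0r.
  by rewrite mem_set// mulr1.
rewrite ge0_integral_sum//; last 2 first.
- by move=> x; apply: measurable_funeM; apply/measurable_EFinP; exact: measurable_indic.
- by move=> x y _; rewrite mule_ge0// lee_fin// sqr_ge0.
rewrite -sumEFin; apply: eq_bigr => x _.
rewrite ge0_integralZl//; last 2 first.
- by apply/measurable_EFinP; exact: measurable_indic.
- by rewrite lee_fin sqr_ge0.
rewrite [RHS]EFinM fineK ?ge0_fin_numE ?level_lty//.
by rewrite integral_indic// setIT.
Qed.

Let S (h : Y -> R) w : R := fine (\int[p w]_y (h y)%:E)%E - fine (\int[q]_y (h y)%:E)%E.

Let mintp (h : Y -> R) : measurable_fun setT h -> (forall y, 0 <= h y) ->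
  measurable_fun setT (fun w => \int[p w]_y (h y)%:E)%E.
Proof.
move=> mh h0; apply: measurable_fun_integral_kernel => //.
exact/measurable_EFinP.
Qed.

Let mS (h : Y -> R) : measurable_fun setT h -> (forall y, 0 <= h y) ->
  measurable_fun setT (S h).
Proof.
move=> mh h0; apply: measurable_funB => //.
by apply: measurableT_comp (mintp mh h0); exact: fine_measurable.
Qed.

Lemma campbell_fin (h : Y -> R) : measurable_fun setT h -> (forall y, 0 <= h y) ->
  (\int[q]_y (h y)%:E < +oo)%E -> \forall w \ae P, (\int[p w]_y (h y)%:E < +oo)%E.
Proof.
move=> mh h0 hy.
have I0 w : (0 <= \int[p w]_y (h y)%:E)%E by apply: integral_ge0 => y _; rewrite lee_fin.
have : P.-integrable setT (fun w => \int[p w]_y (h y)%:E)%E.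
  apply/integrableP; split; first exact: mintp.
  under eq_integral do rewrite gee0_abs//.
  apply: le_lt_trans hy; apply: (campbell (h := EFin \o h)) => //.
  exact/measurable_EFinP.
move=> /(integrable_ae measurableT); apply: filterS => w /= /(_ I).
by rewrite ge0_fin_numE.
Qed.

(** The centred integral is a combination of centred counts of the levels. Levels are disjoint,
    hence uncorrelated, and the variance of a count is its intensity: only the diagonal of the
    expanded square survives. *)
Let second_moment_nnsfun (f : {nnsfun Y >-> R}) : (\int[q]_y (f y)%:E < +oo)%E ->
  (\int[P]_w (S f w ^+ 2)%:E = \int[q]_y (f y ^+ 2)%:E)%E.
Proof.
move=> fy; set s := finmap.enum_fset (fset_set (range f)).
have qlev x : (q (level f x) < +oo)%E by exact: level_lty.
have intZ x y : P.-integrable setT (EFin \o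
    (fun w => x * y * (Z (level f x) w * Z (level f y) w))).
  by apply: integrable_EFinZ => //; exact: (integral_ZZ _ _ _ _).1.
have e : \int[P]_w ((\sum_(x <- s) x * Z (level f x) w) ^+ 2) =
    \sum_(x <- s) x ^+ 2 * fine (q (level f x)).
  transitivity (\int[P]_w (\sum_(x <- s) \sum_(y <- s)
      x * y * (Z (level f x) w * Z (level f y) w))).
    apply: eq_Rintegral => w _; rewrite expr2 mulr_suml; apply: eq_bigr => x _.
    by rewrite mulr_sumr; apply: eq_bigr => y _; ring.
  rewrite Rintegral_sum// => [|x]; last exact: integrable_EFin_sum.
  rewrite big_seq [RHS]big_seq; apply: eq_bigr => x xs.
  rewrite Rintegral_sum// (big_rem x)//= big1_seq => [|y /=]; last first.
    rewrite mem_rem_uniq ?finmap.fset_uniq// inE => /andP[yx _].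
    rewrite RintegralZl//; last exact: (integral_ZZ _ _ _ _).1.
    rewrite poisson_covariance0 ?mulr0//; apply/disj_set2P/seteqP; split=> // t [].
    rewrite /level; case: ifP => // _; case: ifP => // _ /= -> xy.
    by rewrite xy eqxx in yx.
  rewrite addr0 RintegralZl//; last exact: (integral_ZZ _ _ _ _).1.
  by rewrite poisson_variance// expr2.
rewrite nnsfun_sqr// -e /Rintegral fineK; last first.
  have : P.-integrable setT (EFin \o (fun w => (\sum_(x <- s) x * Z (level f x) w) ^+ 2)).
    rewrite (_ : (fun w => _) = fun w => \sum_(x <- s) \sum_(y <- s)
        x * y * (Z (level f x) w * Z (level f y) w)).
      by apply: integrable_EFin_sum => // x; exact: integrable_EFin_sum.
    apply/funext => w; rewrite expr2 mulr_suml; apply: eq_bigr => x _.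
    by rewrite mulr_sumr; apply: eq_bigr => y _; ring.
  exact: integrable_fin_num.
apply: ge0_ae_eq_integral => //.
- by apply/measurable_EFinP; apply: measurable_funX; apply: mS.
- apply/measurable_EFinP; apply: measurable_funX; apply: measurable_sum => x.
  apply: measurable_funM => //; apply: measurable_funB => //; exact: mN.
- by move=> w _; rewrite lee_fin sqr_ge0.
- by move=> w _; rewrite lee_fin sqr_ge0.
- have f0 y : 0 <= f y by [].
  have := campbell_fin (@measurable_funPT _ _ _ _ f) f0 fy.
  apply: filterS => w pf _; congr ((_ ^+ 2)%:E).
  rewrite /S !fine_nnsfun// -sumrB; apply: eq_bigr => x _.
  by rewrite -mulrBr.
Qed.

(** Fatou's lemma along increasing simple approximations. It turns the isometry into an inequality,
    which suffices for Chebyshev's inequality. *)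
Lemma poisson_second_moment (h : Y -> R) :
  measurable_fun setT h -> (forall y, 0 <= h y) -> (\int[q]_y (h y)%:E < +oo)%E ->
  (\int[P]_w ((fine (\int[p w]_y (h y)%:E) - fine (\int[q]_y (h y)%:E)) ^+ 2)%:E <=
   \int[q]_y (h y ^+ 2)%:E)%E.
Proof.
move=> mh h0 hy; rewrite -/(S h _).
have mEh : measurable_fun setT (EFin \o h) by exact/measurable_EFinP.
have h0E y : (0 <= (EFin \o h) y)%E by rewrite lee_fin.
pose g := nnsfun_approx measurableT mEh.
have gh n y : (g n y) <= h y by rewrite -lee_fin; exact: nnsfun_approx_le.
have cvg_h (m : {measure set Y -> \bar R}) :
    (\int[m]_y (g n y)%:E)%E @[n --> \oo] --> (\int[m]_y (h y)%:E)%E.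
  rewrite [X in _ --> X](_ : _ = \int[m]_y (limn (fun n => (g n y)%:E)))%E.
    apply: cvg_monotone_convergence => //.
    - by move=> n; exact/measurable_EFinP.
    - by move=> n y _; rewrite lee_fin.
    - by move=> y _ i j ij; rewrite lee_fin; exact/lefP/nd_nnsfun_approx.
  by apply: eq_integral => y _; apply/esym/cvg_lim => //; exact: cvg_nnsfun_approx.
have gy (m : {measure set Y -> \bar R}) n : (\int[m]_y (h y)%:E < +oo)%E ->
    (\int[m]_y (g n y)%:E < +oo)%E.
  apply: le_lt_trans; apply: ge0_le_integral => //.
  - by move=> y _; rewrite lee_fin.
  - exact/measurable_EFinP.
  - by move=> y _; rewrite lee_fin.
have mSg n : measurable_fun setT (EFin \o (fun w => S (g n) w ^+ 2)).
  by apply/measurable_EFinP; apply: measurable_funX; apply: mS.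
(* The approximations converge where [h] has a finite integral against [p w], which is almost sure
   by [campbell_fin]. *)
have -> : (\int[P]_w (S h w ^+ 2)%:E =
    \int[P]_w limn_einf (fun n => (S (g n) w ^+ 2)%:E))%E.
  apply: ge0_ae_eq_integral => //.
  - by apply/measurable_EFinP; apply: measurable_funX; apply: mS.
  - apply: measurableT_comp => //; apply: measurable_fun_limn_esup => n.
    by apply: measurableT_comp => //; exact: mSg.
  - by move=> w _; rewrite lee_fin sqr_ge0.
  - move=> w _; rewrite limn_einf_lim; apply: lime_ge.
      exact: is_cvg_einfs.
    apply: nearW => n; apply: le_ereal_inf_tmp => _ [k _ <-].
    by rewrite lee_fin sqr_ge0.
  - have := campbell_fin mh h0 hy; apply: filterS => w pw _.
    have cS : (fun n => (S (g n) w ^+ 2)%:E) @ \oo --> (S h w ^+ 2)%:E.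
      apply/cvg_EFin; first exact: nearW.
      have fin (m : {measure set Y -> \bar R}) : (\int[m]_y (h y)%:E < +oo)%E ->
          fine (\int[m]_y (g n y)%:E)%E @[n --> \oo] --> fine (\int[m]_y (h y)%:E)%E.
        move=> my; apply: fine_cvg; rewrite fineK; first exact: cvg_h.
        by rewrite ge0_fin_numE//; apply: integral_ge0 => y _; rewrite lee_fin.
      by apply: cvgM; apply: cvgB; apply: fin.
    by rewrite (cvg_limn_einf_sup cS).1.
apply: (le_trans (fatou P measurableT mSg _)).
  by move=> n w _; rewrite lee_fin sqr_ge0.
rewrite limn_einf_lim; apply: lime_le; first exact: is_cvg_einfs.
apply: nearW => n.
apply: (@le_trans _ _ (\int[P]_w (S (g n) w ^+ 2)%:E)%E).
  by apply: ereal_inf_lbound; exists n => /=.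
rewrite second_moment_nnsfun; last exact: gy.
apply: ge0_le_integral => //.
- by move=> y _; rewrite lee_fin sqr_ge0.
- by apply/measurable_EFinP; apply: measurable_funX.
- by apply/measurable_EFinP; apply: measurable_funX.
- by move=> y _; rewrite lee_fin lerXn2r// nnegrE.
Qed.

End poisson_counts.

(** * Finite combinations of indicator functions *)

Section indicator_sums.
Context d (Y : measurableType d) (R : realType) (m : {measure set Y -> \bar R}).
Variables (n : nat) (a : 'I_n -> R) (D : 'I_n -> set Y) (f : Y -> R).
Hypothesis mD : forall i, measurable (D i).

Lemma patch_indicE (E : set Y) y : (f \_ E) y = \1_E y * f y.
Proof.
by rewrite /patch indicE; case: ifPn => _; rewrite ?mul1r ?mul0r.
Qed.

Hypothesis fD : forall i, m.-integrable (D i) (EFin \o f).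

Lemma integrable_indic_sum :
  m.-integrable setT (EFin \o (fun y => (\sum_i a i * \1_(D i) y) * f y)).
Proof.
rewrite (_ : (fun y => _) = fun y => \sum_i a i * (f \_ (D i)) y).
  apply: integrable_EFin_sum => // i; apply: integrable_EFinZ => //.
  have [+ _] := @integrable_mkcond _ _ _ m _ (EFin \o f) (mD i).
  by move=> /(_ (fD i)); congr (integrable _ _ _); rewrite restrict_EFin.
apply/funext => y; rewrite mulr_suml; apply: eq_bigr => i _.
by rewrite patch_indicE mulrA.
Qed.

Lemma Rintegral_indic_sum : \sum_i a i * \int[m]_(y in D i) f y =
  \int[m]_y ((\sum_i a i * \1_(D i) y) * f y).
Proof.
have fDi i : m.-integrable setT (EFin \o (f \_ (D i))).
  have [+ _] := @integrable_mkcond _ _ _ m _ (EFin \o f) (mD i).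
  by move=> /(_ (fD i)); congr (integrable _ _ _); rewrite restrict_EFin.
transitivity (\int[m]_y \sum_i a i * (f \_ (D i)) y).
  rewrite Rintegral_sum// => [|i]; last exact: integrable_EFinZ.
  by apply: eq_bigr => i _; rewrite RintegralZl// -Rintegral_mkcond.
apply: eq_Rintegral => y _; rewrite mulr_suml; apply: eq_bigr => i _.
by rewrite patch_indicE mulrA.
Qed.

End indicator_sums.

Section indicator_square.
Context d (Y : measurableType d) (R : realType) (m : {measure set Y -> \bar R}).

(** Identifies the variance that appears in [gaussian_white_noise] with the squared L^2 norm of the
    integrand. *)
Lemma integral_indic_sum_sqr n (a : 'I_n -> R) (A : 'I_n -> set Y) :
  (forall i, measurable (A i)) -> (forall i, m (A i) < +oo)%E ->
  (\int[m]_y ((\sum_i a i * \1_(A i) y) ^+ 2)%:E =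
   (\sum_(i < n) \sum_(j < n) a i * a j * fine (m (A i `&` A j)))%:E)%E.
Proof.
move=> mA Aoo.
have mI i j : measurable (A i `&` A j) by exact: measurableI.
have Ioo i j : (m (A i `&` A j) < +oo)%E.
  by apply: le_lt_trans (Aoo i); apply: le_measure; rewrite ?inE.
have intI i j : m.-integrable setT (EFin \o (\1_(A i `&` A j) : Y -> R)).
  apply/integrableP; split; first by apply/measurable_EFinP; exact: measurable_indic.
  under eq_integral do rewrite gee0_abs ?lee_fin//=.
  by rewrite integral_indic// setIT.
have e y : (\sum_i a i * \1_(A i) y) ^+ 2 =
    \sum_i \sum_j a i * a j * \1_(A i `&` A j) y.
  rewrite expr2 mulr_suml; apply: eq_bigr => i _; rewrite mulr_sumr.
  by apply: eq_bigr => j _; rewrite indicI/=; ring.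
have int1 i : m.-integrable setT (EFin \o (fun y => \sum_j a i * a j * \1_(A i `&` A j) y)).
  by apply: integrable_EFin_sum => // j; exact: integrable_EFinZ.
under eq_integral do rewrite e.
rewrite -[LHS]fineK; last by apply: integrable_fin_num => //; exact: integrable_EFin_sum.
congr EFin; rewrite -/(Rintegral _ _ _) Rintegral_sum//; apply: eq_bigr => i _.
rewrite Rintegral_sum// => [|j]; last exact: integrable_EFinZ.
apply: eq_bigr => j _; rewrite RintegralZl//; congr (_ * _).
by rewrite /Rintegral integral_indic// setIT.
Qed.

End indicator_square.

Section kernel_measurability.
Context {d dY} {T : measurableType d} {Y : measurableType dY} {R : realType}.
Variable p : R.-ker T ~> Y.

Lemma measurable_integral_kernel (h : Y -> \bar R) :
  measurable_fun setT h -> (forall y, 0 <= h y)%E ->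
  measurable_fun setT (fun w => \int[p w]_y h y)%E.
Proof.
by move=> mh h0; apply: measurable_fun_integral_kernel => // U; exact: measurable_kernel.
Qed.

Lemma measurable_Rintegral_kernel (f : Y -> R) (D : set Y) :
  measurable D -> measurable_fun D f ->
  measurable_fun setT (fun w => \int[p w]_(y in D) f y).
Proof.
move=> mD mf.
have mfD : measurable_fun setT ((EFin \o f) \_ D).
  by apply/(measurable_restrictT _ mD); exact/measurable_EFinP.
rewrite (_ : (fun w => _) = fine \o (fun w =>
  \int[p w]_y ((EFin \o f) \_ D)^\+ y - \int[p w]_y ((EFin \o f) \_ D)^\- y)%E).
  apply: measurableT_comp; first exact: fine_measurable.
  apply: emeasurable_funB; apply: measurable_integral_kernel => //.
  - exact: measurable_funepos.
  - exact: measurable_funeneg.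
by apply/funext => w; rewrite /Rintegral integral_mkcond integralE.
Qed.

End kernel_measurability.

Section tail_more.
Context d (T : measurableType d) (R : realType) (P : probability T R).

Lemma tail_le_const (c e : R) : 0 < e -> tail_le P (fun=> c) e (`|c| / e)%:E.
Proof.
move=> e0; have [ce|ec] := ltP `|c| e.
  by apply: tail_le_cst => //; rewrite lee_fin divr_ge0// ltW.
exists setT; split => //; last by move=> w /(_ I).
by rewrite probability_setT lee_fin ler_pdivlMr// mul1r.
Qed.

(** Dividing by c + 1 rather than by [c] covers c = 0. *)
Lemma tail_le_scale (c e : R) X k : 0 <= c -> 0 < e ->
  tail_le P X (e / (c + 1)) k -> tail_le P (fun w => c * X w) e k.
Proof.
move=> c0 e0 [E [mE PE XE]]; exists E; split => // w /XE h.
rewrite normrM ger0_norm//.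
have c1 : 0 < c + 1 by rewrite ltr_wpDl.
move: h; rewrite ltr_pdivlMr// => h.
by apply: le_lt_trans h; rewrite mulrC ler_wpM2l// lerDl.
Qed.

(** Removes an arbitrarily small loss of probability, as arises for the small jumps, which are known
    only as an L^2 limit. Measurability of [X] lets the event |X| >= e itself be the exceptional
    set. *)
Lemma tail_le_lim X e k : measurable_fun setT X ->
  (forall r : R, 0 < r -> tail_le P X e (k + r%:E)%E) -> tail_le P X e k.
Proof.
move=> mX H; exists [set w | e <= `|X w|]; split.
- rewrite -[X in measurable X]setTI; apply: measurable_fun_le => //.
  exact: measurableT_comp.
- by apply/lee_addgt0Pr => r r0; apply: tail_le_prob => //; exact: H.
- by move=> w /negP; rewrite -ltNge.
Qed.

End tail_more.

(** * Gaussian tails *)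

Section gaussian_tail.
Context {R : realType}.

(* [exp (- x^2 / 2v) <= exp (- e^2 / 4v) exp (- x^2 / 4v)] on [|x| >= e], and the
   second factor is [sqrt 2] times a density up to the normalizing constant. *)
Lemma centered_gaussian_tail (v e : R) : 0 <= v -> 0 < e ->
  (centered_gaussian v [set x : R | (e <= `|x|)%R] <= (8 * v / e ^+ 2)%:E)%E.
Proof.
move=> v0 e0; rewrite /centered_gaussian; case: ifPn => [/eqP ->|vn0].
  rewrite mulr0 mul0r diracE memNset//= normr0.
  by apply/negP; rewrite -ltNge.
have vp : 0 < v by rewrite lt_neqAle eq_sym vn0.
pose s := Num.sqrt v; have sp : 0 < s by rewrite sqrtr_gt0.
have s2 : s ^+ 2 = v by rewrite sqr_sqrtr// ltW.
pose s' := s * Num.sqrt 2.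
have r2 : 0 < Num.sqrt (2 : R) by rewrite sqrtr_gt0.
have r22 : Num.sqrt (2 : R) ^+ 2 = 2 by rewrite sqr_sqrtr.
have s'p : 0 < s' by rewrite mulr_gt0.
have s'2 : s' ^+ 2 = 2 * v by rewrite exprMn s2 r22 mulrC.
have peak : normal_peak s = Num.sqrt 2 * normal_peak s'.
  rewrite /normal_peak s'2 s2 -[v * _ *+ 2]mulr_natl -[2 * v * pi *+ 2]mulr_natl.
  rewrite -[2 * v * pi]mulrA [Num.sqrt (2 * (2 * _))]sqrtrM//.
  by field; rewrite !gt_eqF// sqrtr_gt0 !mulr_gt0// pi_gt0.
have mE : measurable [set x : R | e <= `|x|].
  by rewrite -[X in measurable X]setTI; apply: measurable_fun_le.
rewrite /normal_prob -/s.
apply: (@le_trans _ _ (\int[lebesgue_measure]_x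
    ((Num.sqrt 2 * expR (- e ^+ 2 / (4 * v)))%:E * (normal_pdf 0 s' x)%:E))%E).
  rewrite integral_mkcond; apply: ge0_le_integral => //.
  - by move=> x _; rewrite /patch; case: ifP => // _; rewrite lee_fin normal_pdf_ge0.
  - apply/(measurable_restrictT _ mE); apply/measurable_funTS/measurable_EFinP.
    exact: measurable_normal_pdf.
  - apply: measurable_funeM; apply/measurable_EFinP; exact: measurable_normal_pdf.
  move=> x _; rewrite /patch; case: ifPn => [|_]; last first.
    by rewrite mule_ge0// lee_fin ?normal_pdf_ge0// mulr_ge0// ?expR_ge0// ltW.
  rewrite inE/= => ex; rewrite -EFinM lee_fin.
  rewrite !normal_pdfE ?gt_eqF// peak /normal_fun subr0 s2 s'2.
  rewrite -!mulrA; apply: ler_wpM2l; first exact: ltW.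
  rewrite [leRHS]mulrCA; apply: ler_wpM2l; first exact: normal_peak_ge0.
  rewrite -expRD ler_expR.
  have -> : - x ^+ 2 / (v *+ 2) = - x ^+ 2 / (4 * v) + - x ^+ 2 / ((2 * v) *+ 2).
    by field; rewrite gt_eqF.
  rewrite lerD2r ler_pM2r ?invr_gt0 ?mulr_gt0// lerN2.
  by rewrite -[leRHS]real_normK ?num_real// lerXn2r// nnegrE ltW.
rewrite ge0_integralZl//; last 2 first.
- by apply/measurable_EFinP; exact: measurable_normal_pdf.
- by move=> x _; rewrite lee_fin normal_pdf_ge0.
rewrite integral_normal_pdf mule1 lee_fin.
(* With u = e ^ 2 / (4 v), the bounds sqrt 2 <= 2 and e ^ (- u) <= 1 / u give 2 (4 v / e ^ 2), hence
   the constant 8. *)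
have r2le : Num.sqrt 2 <= 2 :> R.
  by rewrite -(ler_pXn2r (_ : 0 < 2)%N)// ?nnegrE ?r22 ?ltW//; lra.
have u0 : 0 < e ^+ 2 / (4 * v) by rewrite divr_gt0 ?exprn_gt0// mulr_gt0.
have eu : expR (- e ^+ 2 / (4 * v)) <= (e ^+ 2 / (4 * v))^-1.
  rewrite mulNr expRN lef_pV2 ?posrE ?expR_gt0//.
  by apply: le_trans (expR_ge1Dx _); rewrite lerDr.
apply: (le_trans (ler_pM (ltW r2) (expR_ge0 _) r2le eu)).
by rewrite le_eqVlt; apply/orP; left; apply/eqP; field; rewrite !gt_eqF.
Qed.

End gaussian_tail.

(** * A modular controlling a Levy basis *)

Section levy_measure_facts.
Context {R : realType} (nu : {measure set R -> \bar R}).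
Hypothesis lnu : levy_measure nu.

Lemma measurable_norm_gt (e : R) : measurable [set z : R | e < `|z|].
Proof.
rewrite (_ : [set z | _] = ~` [set z : R | `|z| <= e]).
  by apply: measurableC; rewrite -[X in measurable X]setTI; apply: measurable_fun_le.
by apply/seteqP; split=> z /=; rewrite ltNge => /negP.
Qed.

Lemma measurable_norm_itv (e : R) : measurable [set z : R | e < `|z| <= 1].
Proof.
rewrite (_ : [set z | _] = [set z : R | e < `|z|] `\` [set z | 1 < `|z|]).
  by apply: measurableD; exact: measurable_norm_gt.
apply/seteqP; split=> z /=; first by move=> /andP[-> ]; rewrite leNgt => /negP.
by move=> [-> /negP]; rewrite -leNgt.
Qed.

Let measurable_min1_sqr : measurable_fun setT (fun z : R => (Num.min 1 (z ^+ 2))%:E).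
Proof.
by apply/measurable_EFinP; apply: measurable_minr => //; apply: measurable_funX.
Qed.

Lemma levy_measure_tail_lty (e : R) : 0 < e -> (nu [set z | (e < `|z|)%R] < +oo)%E.
Proof.
move=> e0; have [_ H] := lnu.
pose c := Num.min 1 (e ^+ 2).
have c0 : 0 < c by rewrite lt_min ltr01 exprn_gt0.
have : (c%:E * nu [set z | (e < `|z|)%R] < +oo)%E.
  apply: le_lt_trans H; rewrite -integral_cst//; last exact: measurable_norm_gt.
  rewrite integral_mkcond; apply: ge0_le_integral => //.
  - by move=> z _; rewrite /patch; case: ifP => // _; rewrite lee_fin ltW.
  - by apply/(measurable_restrictT _ (measurable_norm_gt e)).
  - move=> z _; rewrite /patch; case: ifPn => [|_]; last by rewrite lee_fin le_min ler01 sqr_ge0.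
    rewrite inE/= => ez; rewrite lee_fin /c le_min ge_min lexx/= ge_min.
    rewrite -[X in _ || (_ <= X)]real_normK ?num_real//.
    by rewrite lerXn2r ?orbT// ?nnegrE// ltW.
have [->|] := eqVneq (nu [set z | (e < `|z|)%R]) +oo%E; first by rewrite gt0_muley.
by rewrite -ltey.
Qed.

(** Mass may accumulate near 0 but not at 0, so the origin can be added to each exhausting set
    without changing its measure. *)
Lemma levy_measure_sigma_finite : sigma_finite setT (nu : set R -> \bar R).
Proof.
exists (fun n => [set 0] `|` [set z | n.+1%:R^-1 < `|z|]).
  apply/seteqP; split => // z _; have [->|z0] := eqVneq z 0; first by exists 0%N => //; left.
  exists (Num.truncn `|z|^-1) => //; right => /=.
  by rewrite invf_plt ?posrE ?normr_gt0// truncnS_gt.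
move=> n; split; first by apply: measurableU => //; exact: measurable_norm_gt.
apply: le_lt_trans (measureU2 _ _ _) _ => //; first exact: measurable_norm_gt.
have nu0 : nu [set 0%R] = 0%E := lnu.1.
by rewrite [X in (X + _)%E](nu0 : _ = _) add0e levy_measure_tail_lty.
Qed.

(** An upper bound for the integral of z ^ 2 over |z| <= 1, rather than its value: it is the
    quantity assumed finite, and it is uniform in the truncation level of the small jumps. *)
Definition small_jump_variance : \bar R := \int[nu]_z (Num.min 1 (z ^+ 2))%:E.

Lemma levy_measure_small_le (e : R) :
  (\int[nu]_(z in [set z | (e < `|z| <= 1)%R]) (z ^+ 2)%:E <= small_jump_variance)%E.
Proof.
have mD : measurable [set z : R | e < `|z| <= 1] by exact: measurable_norm_itv.
rewrite integral_mkcond; apply: ge0_le_integral => //.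
- by move=> z _; rewrite /patch; case: ifP => // _; rewrite lee_fin sqr_ge0.
- apply/(measurable_restrictT _ mD); apply/measurable_EFinP/measurable_funTS.
  exact: measurable_funX.
- move=> z _; rewrite /patch; case: ifPn => [|_]; last by rewrite lee_fin le_min ler01 sqr_ge0.
  rewrite inE/= => /andP[_ z1]; rewrite lee_fin le_min lexx andbT.
  by rewrite -real_normK ?num_real// expr_le1.
Qed.

End levy_measure_facts.

Section positive_negative_parts.
Context d (Y : measurableType d) (R : realType) (m : {measure set Y -> \bar R}).
Variable f : Y -> R.
Hypothesis mf : m.-integrable setT (EFin \o f).

Lemma integrable_pos_part_lty : (\int[m]_y (Num.max (f y) 0)%:E < +oo)%E.
Proof.
have := integral_funepos_lt_pinfty measurableT mf.
by congr (_ < _)%E; apply: eq_integral => y _; rewrite funeposE EFin_max.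
Qed.

Lemma integrable_neg_part_lty : (\int[m]_y (Num.max (- f y) 0)%:E < +oo)%E.
Proof.
have := integral_funeneg_lt_pinfty measurableT mf.
by congr (_ < _)%E; apply: eq_integral => y _; rewrite funenegE EFin_max.
Qed.

Lemma Rintegral_parts : \int[m]_y f y =
  fine (\int[m]_y (Num.max (f y) 0)%:E) - fine (\int[m]_y (Num.max (- f y) 0)%:E).
Proof.
rewrite -fineB; last 2 first.
- rewrite ge0_fin_numE ?integrable_pos_part_lty// integral_ge0// => y _.
  by rewrite lee_fin le_max lexx orbT.
- rewrite ge0_fin_numE ?integrable_neg_part_lty// integral_ge0// => y _.
  by rewrite lee_fin le_max lexx orbT.
rewrite /Rintegral integralE; congr (fine (_ - _)); apply: eq_integral => y _.
  by rewrite funeposE EFin_max.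
by rewrite funenegE EFin_max.
Qed.

End positive_negative_parts.

(** * Tail bounds for the white noise, the large jumps and the small jumps *)

Section levy_basis_tail.
Context {dT : measure_display} {T : measurableType dT} {R : realType}.
Variables (P : probability T R) (d : nat).
Variables (nu : {measure set R -> \bar R}) (lnu : levy_measure nu).
Variable p : R.-ker T ~> ('rV[R]_d * R)%type.
Hypothesis poi : poisson_random_measure P (lebesgue_rV d \x nu)%E p.

Let nu' := sigma_finite_of (levy_measure_sigma_finite lnu).
Let q := (leb_rV d \x nu')%E.

Let pq : poisson_counts P q p.
Proof. by case: poi => + _ _ B mB qB k => /(_ B mB qB k). Qed.

Let bounded_lty (A : set 'rV[R]_d) : bounded_borel A -> (lebesgue_rV d A < +oo)%E.
Proof. by move=> [mA bA]; exact: lebesgue_rV_bounded_lty. Qed.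

Let qX (A : set 'rV[R]_d) (Z : set R) : measurable A -> measurable Z ->
  q (A `*` Z) = (lebesgue_rV d A * nu Z)%E.
Proof. by move=> mA mZ; rewrite /q product_measure1E. Qed.

Let qX_lty A e : bounded_borel A -> 0 < e -> (q (A `*` [set z | (e < `|z|)%R]) < +oo)%E.
Proof.
move=> bA e0; rewrite qX; [|exact: bA.1|exact: measurable_norm_gt].
have := bounded_lty bA; have := levy_measure_tail_lty lnu e0.
rewrite -!ge0_fin_numE// => h1 h2.
by rewrite fin_numM.
Qed.

Let msnd : measurable_fun setT (snd : 'rV[R]_d * R -> R).
Proof. exact: measurable_snd. Qed.

Let integral_q (f : 'rV[R]_d * R -> \bar R) : measurable_fun setT f ->
  (forall x, 0 <= f x)%E ->
  (\int[q]_x f x = \int[lebesgue_rV d]_s \int[nu]_z f (s, z))%E.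
Proof.
move=> mf f0; by rewrite /q fubini_tonelli1// /leb_rV sigma_finite_ofE.
Qed.

Section fixed_sets.
Variables (n : nat) (a : 'I_n -> R) (A : 'I_n -> set 'rV[R]_d).
Hypothesis bA : forall i, bounded_borel (A i).

(** The integrand behind the coefficients [a] and the possibly overlapping sets [A]; the bounds
    depend on [g] alone. *)
Let g s := \sum_i a i * \1_(A i) s.

Let mg : measurable_fun setT g.
Proof.
apply: measurable_sum => i; apply: measurable_funM => //.
exact: measurable_indic (bA i).1.
Qed.

Let mgn : measurable_fun setT (fun s => `|g s|).
Proof. exact: measurableT_comp. Qed.

Lemma white_noise_tail (W : set 'rV[R]_d -> {RV P >-> R}) (e : R) :
  gaussian_white_noise W -> 0 < e ->
  tail_le P (fun w => \sum_i a i * W (A i) w) e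
    ((8 / e ^+ 2)%:E * \int[lebesgue_rV d]_s (`|g s| ^+ 2)%:E)%E.
Proof.
move=> gW e0.
have mX : measurable_fun setT (fun w => \sum_i a i * W (A i) w).
  by apply: measurable_sum => i; apply: measurable_funM.
have mE : measurable [set x : R | e <= `|x|].
  by rewrite -[X in measurable X]setTI; apply: measurable_fun_le.
exists ((fun w => \sum_i a i * W (A i) w) @^-1` [set x : R | e <= `|x|]); split.
- by rewrite -[X in measurable X]setTI; exact: mX.
- have lA i : (lebesgue_rV d (A i) < +oo)%E by exact: bounded_lty.
  under eq_integral do rewrite real_normK ?num_real//.
  rewrite integral_indic_sum_sqr//; last by move=> i; exact: (bA i).1.
  rewrite gW//; apply: (le_trans (centered_gaussian_tail _ e0)).
    rewrite -lee_fin -integral_indic_sum_sqr//; last by move=> i; exact: (bA i).1.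
    by apply: integral_ge0 => s _; rewrite lee_fin sqr_ge0.
  by rewrite -EFinM lee_fin mulrAC.
- by move=> w /negP; rewrite -ltNge.
Qed.

(** The integrand g (s) z on jumps with size in [Z], in the form to which [Rintegral_indic_sum]
    applies. *)
Let h (Z : set R) (x : 'rV[R]_d * R) : R := (\sum_i a i * \1_(A i `*` Z) x) * x.2.

Let hE Z x : h Z x = g x.1 * (x.2 * \1_Z x.2).
Proof.
rewrite /h /g [x.2 * _]mulrC mulrA; congr (_ * _); rewrite mulr_suml.
apply: eq_bigr => i _; rewrite -mulrA; congr (_ * _).
by rewrite !indicE in_setX; case: (_ \in _); case: (_ \in _); rewrite ?mulr1 ?mulr0.
Qed.

Let mh Z : measurable Z -> measurable_fun setT (h Z).
Proof.
move=> mZ; apply: measurable_funM => //; apply: measurable_sum => i.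
apply: measurable_funM => //; apply: measurable_indic.
by apply: measurableX => //; exact: (bA i).1.
Qed.

(* The part [|z| > N] of the jumps over [A] vanishes off an event of
   probability [q (A `*` [set z | N < `|z|])], which tends to 0. *)
Let ae_large_integrable (B : set 'rV[R]_d) : bounded_borel B -> \forall w \ae P,
  (p w).-integrable (B `*` [set z | 1 < `|z|]) (EFin \o snd).
Proof.
move=> bB; pose C (N : nat) := B `*` [set z : R | N%:R < `|z|].
have mC N : measurable (C N).
  by apply: measurableX; [exact: bB.1|exact: measurable_norm_gt].
pose F := \bigcap_N [set w | p w (C N.+1) <> 0%E].
have mF0 N : measurable [set w | p w (C N) <> 0%E].
  rewrite (_ : [set w | _] = ~` ((fun w => p w (C N)) @^-1` [set 0%E]))//.
  apply: measurableC; rewrite -[X in measurable X]setTI.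
  by apply: measurable_kernel => //; exact: emeasurable_set1.
have mF : measurable F by apply: bigcap_measurable => // N _.
have PF0 : P F = 0%E.
  have cF : q (C N.+1) @[N --> \oo] --> q (\bigcap_N C N.+1).
    apply: nonincreasing_cvg_mu => //.
    - exact: qX_lty.
    - exact: bigcap_measurable.
    - move=> i j ij; apply/subsetPset => -[s z] [/= Bs jz]; split => //=.
      by apply: le_lt_trans jz; rewrite ler_nat.
  have e0 : \bigcap_N C N.+1 = set0.
    apply/seteqP; split => // -[s z] H; have [_ /=] := H (Num.truncn `|z|) I.
    by rewrite ltNge (ltW (truncnS_gt _)).
  have q0 : q (\bigcap_N C N.+1) = 0%E by rewrite e0 /q measure0.
  rewrite q0 in cF.
  apply/eqP; rewrite eq_le measure_ge0 andbT.
  rewrite -(cvg_lim _ cF)//; apply: lime_ge; first by apply/cvg_ex; eexists; exact: cF.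
  apply: nearW => N; apply: le_trans (poisson_count_neq0 pq (mC N.+1)).
  by apply: le_measure; rewrite ?inE// => w; apply.
have := ae_poisson_count_fin pq (mC 1%N) (qX_lty bB ltr01).
have : {ae P, forall w, ~ F w} by exists F; split => // w; rewrite /= => /contrapT.
apply: filterS2 => w Fw fw.
have [N HN] : exists N, p w (C N.+1) = 0%E.
  by apply: contrapT => /forallNP nF; apply: Fw => N _; exact: nF.
rewrite (_ : B `*` _ = C 1%N)//.
apply/(negligible_integrable (mC N.+1)) => //.
  exact/measurable_EFinP/measurable_funTS.
apply: measurable_bounded_integrable; first exact: measurableD.
- by apply: le_lt_trans fw; apply: le_measure; rewrite ?inE//; exact: measurableD.
- exact: measurable_funTS.
- exists N.+1%:R; split; [exact: num_real|move=> M /ltW NM [s z] /= [[Bs z1]]].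
  by move=> /not_andP[//|/negP]; rewrite -leNgt => zN; exact: le_trans NM.
Qed.

(** In the constant, 1 pays for the event that some jump has |g (s) z| > 1, whose probability is at
    most its intensity. Off this event the sum is bounded by the integral of min (1, |g (s) z|)
    against [p w], and Markov's inequality with Campbell's costs 1 / e. *)
Lemma large_jumps_tail (e : R) : 0 < e ->
  tail_le P (fun w => \sum_i a i * large_jumps p (A i) w) e
    ((1 + e^-1)%:E * \int[lebesgue_rV d]_s \int[nu]_(z in [set z | (1 < `|z|)%R])
      (Num.min 1 (`|g s| * `|z|))%:E)%E.
Proof.
move=> e0; pose Z := [set z : R | 1 < `|z|].
have mZ : measurable Z by exact: measurable_norm_gt.
pose B := [set x | 1 < `|h Z x|].
have mnh : measurable_fun setT (fun x => `|h Z x|).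
  by apply: measurableT_comp => //; exact: mh.
have mB : measurable B.
  by rewrite -[B]setTI; exact: (mh mZ measurableT (measurable_norm_gt 1)).
pose k x : \bar R := (Num.min 1 `|h Z x|)%:E.
have mk : measurable_fun setT k.
  by apply/measurable_EFinP; exact: measurable_minr.
have k0 x : (0 <= k x)%E by rewrite lee_fin le_min ler01 normr_ge0.
have Ek : (\int[q]_x k x = \int[lebesgue_rV d]_s \int[nu]_(z in Z)
    (Num.min 1 (`|g s| * `|z|))%:E)%E.
  rewrite (integral_q mk k0); apply: eq_integral => s _.
  rewrite [RHS]integral_mkcond; apply: eq_integral => z _.
  rewrite /k hE /= /patch indicE; case: (z \in Z); first by rewrite mulr1 normrM.
  by rewrite !mulr0 normr0 min_r.
have qB : (q B <= \int[q]_x k x)%E.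
  rewrite (_ : q B = \int[q]_x (\1_B x)%:E)%E; last by rewrite integral_indic// setIT.
  apply: ge0_le_integral => //.
  - by apply/measurable_EFinP; exact: measurable_indic.
  - move=> x _; rewrite indicE lee_fin; case: (boolP (x \in B)) => [|_].
      by rewrite inE /B /= => hx; rewrite le_min lexx ltW.
    by rewrite le_min ler01 normr_ge0.
pose F1 := [set w | p w B <> 0%E].
have mF1 : measurable F1.
  rewrite (_ : F1 = ~` ((fun w => p w B) @^-1` [set 0%E]))//.
  apply: measurableC; rewrite -[X in measurable X]setTI.
  by apply: measurable_kernel => //; exact: emeasurable_set1.
have [N [mN PN intN]] : \forall w \ae P, forall i,
    (p w).-integrable (A i `*` Z) (EFin \o snd).
  by apply: filter_forall => i; exact: ae_large_integrable (bA i).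
pose X w := \sum_i a i * large_jumps p (A i) w.
have Xk w : ~ N w -> ~ F1 w -> (`|X w|%:E <= \int[p w]_x k x)%E.
  move=> Nw /contrapT w0.
  have {}intN i : (p w).-integrable (A i `*` Z) (EFin \o snd).
    by move: i; apply: contrapT => H; apply: Nw; exact: intN.
  have mAZ i : measurable (A i `*` Z) by apply: measurableX => //; exact: (bA i).1.
  have XE : X w = \int[p w]_x h Z x.
    by rewrite /X /large_jumps Rintegral_indic_sum.
  have ih : (p w).-integrable setT (EFin \o h Z) by exact: integrable_indic_sum.
  rewrite XE -abse_EFin /Rintegral fineK ?integrable_fin_num//.
  apply: le_trans (le_abse_integral _ _ _) _ => //.
    by apply/measurable_EFinP; exact: mh.
  rewrite le_eqVlt; apply/orP; left; apply/eqP; apply: ae_eq_integral => //.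
    by apply/measurable_EFinP.
  exists B; split => // x /= H; apply: contrapT => /negP; rewrite -leNgt => hx1.
  by apply: H => _; rewrite /k min_r.
(* Setting the sum to 0 off the good event makes the domination [Xk] available at every point. *)
pose X2 w := if `[< ~ N w /\ ~ F1 w >] then X w else 0.
have [E [mE PE XE]] : tail_le P X2 e (e^-1%:E * \int[P]_w \int[p w]_x k x)%E.
  apply: tail_le_markov => //.
  - exact: measurable_integral_kernel.
  - by move=> w; exact: integral_ge0.
  - move=> w; rewrite /X2; case: asboolP => [[Nw Fw]|_ _]; last by rewrite normr0.
    by move=> /(le_lt_trans (Xk _ Nw Fw)); rewrite lte_fin.
exists ((E `|` F1) `|` N); split.
- by apply: measurableU => //; exact: measurableU.
- rewrite measureU0//; last exact: measurableU.
  apply: le_trans (measureU2 _ _ _) _ => //.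
  have e1 : 0 <= e^-1 by rewrite invr_ge0 ltW.
  rewrite -Ek [1 + _]addrC EFinD ge0_muleDl ?lee_fin ?ler01//.
  apply: leeD.
    apply: le_trans PE _; apply: lee_wpmul2l; first by rewrite lee_fin invr_ge0 ltW.
    exact: (campbell pq).
  by rewrite mul1e; apply: le_trans qB; exact: (poisson_count_neq0 pq).
- move=> w H; rewrite -/(X w) (_ : X w = X2 w).
    by apply: XE => Ew; apply: H; left; left.
  rewrite /X2; case: asboolP => // H'; exfalso; apply: H'; split => K; apply: H.
    by right.
  by left; right.
Qed.

Let compensated_tail (f : 'rV[R]_d * R -> R) (e : R) :
  measurable_fun setT f -> (forall x, 0 <= f x) -> (\int[q]_x (f x)%:E < +oo)%E ->
  0 < e ->
  tail_le P (fun w => fine (\int[p w]_x (f x)%:E) - fine (\int[q]_x (f x)%:E)) e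
    ((e ^+ 2)^-1%:E * \int[q]_x (f x ^+ 2)%:E)%E.
Proof.
move=> mf f0 fq e0.
have mS : measurable_fun setT
    (fun w => fine (\int[p w]_x (f x)%:E) - fine (\int[q]_x (f x)%:E)).
  apply: measurable_funB => //; apply: measurableT_comp; first exact: fine_measurable.
  by apply: measurable_integral_kernel => //; exact/measurable_EFinP.
apply: (tail_leW (lexx e)); last first.
  apply: (@tail_le_markov _ _ _ P _ (fun w => ((fine (\int[p w]_x (f x)%:E) -
    fine (\int[q]_x (f x)%:E)) ^+ 2)%:E) e (e ^+ 2)).
  - exact: exprn_gt0.
  - by apply/measurable_EFinP; exact: measurable_funX.
  - by move=> w; rewrite lee_fin sqr_ge0.
  - move=> w; rewrite lte_fin -real_normK ?num_real// => H.
    by rewrite -(ltr_pXn2r (_ : 0 < 2)%N)// ?nnegrE ?(ltW e0).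
apply: lee_wpmul2l; first by rewrite lee_fin invr_ge0 sqr_ge0.
exact: (poisson_second_moment pq).
Qed.

Let integrable_snd_q (B : set 'rV[R]_d) (eps : R) : bounded_borel B -> 0 < eps ->
  q.-integrable (B `*` [set z | eps < `|z| <= 1]) (EFin \o snd).
Proof.
move=> bB eps0; have mBZ : measurable (B `*` [set z : R | eps < `|z| <= 1]).
  by apply: measurableX; [exact: bB.1|exact: measurable_norm_itv].
apply: measurable_bounded_integrable => //.
- apply: le_lt_trans (qX_lty bB eps0); apply: le_measure; rewrite ?inE//.
    by apply: measurableX; [exact: bB.1|exact: measurable_norm_gt].
  by move=> [s z] [/= Bs /andP[]].
- exact: measurable_funTS.
- exists 1; split; [exact: num_real|move=> M /ltW M1 [s z] /= [_ /andP[_ z1]]].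
  exact: le_trans M1.
Qed.

(** By Fubini, the compensator written in [compensated_jumps] is the integral of the jump size
    against the intensity. *)
Let Rintegral_snd_q (B : set 'rV[R]_d) (eps : R) : bounded_borel B -> 0 < eps ->
  \int[q]_(x in B `*` [set z | eps < `|z| <= 1]) x.2 =
  fine (lebesgue_rV d B) * \int[nu]_(z in [set z | eps < `|z| <= 1]) z.
Proof.
move=> bB eps0; pose Z := [set z : R | eps < `|z| <= 1].
have mZ : measurable Z by exact: measurable_norm_itv.
have mBZ : measurable (B `*` Z) by apply: measurableX => //; exact: bB.1.
have ii : q.-integrable setT (EFin \o (snd \_ (B `*` Z))).
  have [+ _] := @integrable_mkcond _ _ _ q _ (EFin \o snd) mBZ.
  move=> /(_ (integrable_snd_q bB eps0)).
  by congr (integrable _ _ _); rewrite restrict_EFin.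
have iz : nu.-integrable Z (EFin \o (id : R -> R)).
  apply: measurable_bounded_integrable => //.
    apply: le_lt_trans (levy_measure_tail_lty lnu eps0).
    apply: le_measure; rewrite ?inE//; first exact: measurable_norm_gt.
    by move=> z /= /andP[].
  exists 1; split; [exact: num_real|move=> M /ltW M1 z /= /andP[_ z1]].
  exact: le_trans M1.
rewrite Rintegral_mkcond {1}/Rintegral -integral12_prod_meas1//.
rewrite /leb_rV sigma_finite_ofE.
under eq_integral => s _.
  rewrite /fubini_F /nu' sigma_finite_ofE.
  rewrite (_ : (\int[nu]_z _)%E = (\1_B s)%:E * \int[nu]_(z in Z) z%:E)%E; last first.
    rewrite [in RHS]integral_mkcond -integralZl//; last first.
      by have [+ _] := @integrable_mkcond _ _ _ nu _ (EFin \o id) mZ; exact.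
    apply: eq_integral => z _; rewrite /= /patch in_setX/= indicE.
    by case: (s \in B); case: (z \in Z); rewrite /= ?mul1e ?mul0e.
  over.
rewrite -(@fineK _ (\int[nu]_(z in Z) z%:E)%E); last exact: integrable_fin_num.
under eq_integral do rewrite muleC.
rewrite integralZl//; last first.
  apply/integrableP; split.
    by apply/measurable_EFinP; apply: measurable_indic; exact: bB.1.
  under eq_integral do rewrite gee0_abs ?lee_fin//=.
  rewrite integral_indic//; last exact: bB.1.
  by rewrite setIT; exact: bounded_lty.
rewrite integral_indic//; last exact: bB.1.
rewrite setIT -[X in (_ * X)%E]fineK ?ge0_fin_numE ?bounded_lty//.
by rewrite -EFinM /= mulrC.
Qed.

(** The threshold is split into e / 2 for the distance to a truncation at [eps], and e / 4 for each
    of the positive and negative parts of the truncated integrand, as the second moment bound takes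
    nonnegative functions; 16 is the inverse square of 1 / 4. The result does not depend on
    [eps]. *)
Lemma small_jumps_tail (M : 'I_n -> {RV P >-> R}) (e : R) :
  (forall i, is_compensated_small_jumps nu p (A i) (M i)) -> 0 < e ->
  tail_le P (fun w => \sum_i a i * M i w) e
    ((16 / e ^+ 2)%:E *
     (small_jump_variance nu * \int[lebesgue_rV d]_s (`|g s| ^+ 2)%:E))%E.
Proof.
move=> cM e0; apply: tail_le_lim => [|r r0].
  by apply: measurable_sum => i; apply: measurable_funM.
(* If all M i are within [rho] of their truncations, the combination is within e / 2. *)
pose rho := e / 2 / (\sum_i `|a i| + 1).
have sa0 : 0 <= \sum_i `|a i| by rewrite sumr_ge0.
have rho0 : 0 < rho by rewrite divr_gt0 ?divr_gt0// ltr_wpDl.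
(* Chebyshev's inequality for the sum of the [n] squared errors then costs at most n r' / rho ^ 2 <=
   r. *)
pose r' := r * rho ^+ 2 / n.+1%:R.
have r'0 : 0 < r' by apply: divr_gt0; [apply: mulr_gt0; [|apply: exprn_gt0]|].
have near_eps : \forall eps \near (0 : R)^'+, forall i,
    (\int[P]_w ((compensated_jumps nu p (A i) eps w - M i w) ^+ 2)%:E < r'%:E)%E.
  apply: filter_forall => i.
  by have := cM i _ (@nbhs_open_ereal_lt _ 0 (fun=> r') r'0); apply.
have [eps [eps0 {}near_eps]] := filter_ex (filterI (nbhs_right_gt (0 : R)) near_eps).
pose Z := [set z : R | eps < `|z| <= 1].
have mZ : measurable Z by exact: measurable_norm_itv.
have mAZ i : measurable (A i `*` Z) by apply: measurableX => //; exact: (bA i).1.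
have mc i : measurable_fun setT (compensated_jumps nu p (A i) eps).
  apply: measurable_funB => //; apply: measurable_Rintegral_kernel => //.
  exact: measurable_funTS.
have rem_tail : tail_le P
    (fun w => \sum_i a i * (M i w - compensated_jumps nu p (A i) eps w)) (e / 2) r%:E.
  pose Y w := (\sum_i (compensated_jumps nu p (A i) eps w - M i w) ^+ 2)%:E.
  apply: (@tail_leW _ _ _ P _ (e / 2) _ ((rho ^+ 2)^-1%:E * \int[P]_w Y w)%E) => //.
    rewrite /Y; under eq_integral do rewrite -sumEFin.
    rewrite ge0_integral_sum//; last first.
    - by move=> i w _; rewrite lee_fin sqr_ge0.
    - by move=> i; apply/measurable_EFinP; apply: measurable_funX; exact: measurable_funB.
    apply: (@le_trans _ _ ((rho ^+ 2)^-1%:E * \sum_(i < n) r'%:E)%E).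
      apply: lee_wpmul2l; first by rewrite lee_fin invr_ge0 sqr_ge0.
      by apply: lee_sum => i _; exact: ltW.
    rewrite sumEFin -EFinM lee_fin sumr_const card_ord -[r' *+ n]mulr_natr.
    rewrite ler_pdivrMl ?exprn_gt0// /r' mulrC mulrA ler_pdivrMr//.
    rewrite [leRHS]mulrC [rho ^+ 2 * r]mulrC; apply: ler_wpM2r.
      by rewrite mulr_ge0 ?sqr_ge0// ltW.
    by rewrite ler_nat.
  apply: tail_le_markov.
  - exact: exprn_gt0.
  - apply/measurable_EFinP; apply: measurable_sum => i; apply: measurable_funX.
    exact: measurable_funB.
  - by move=> w; rewrite lee_fin sumr_ge0// => i _; exact: sqr_ge0.
  - move=> w; rewrite lte_fin => Yr.
    have ci i : `|M i w - compensated_jumps nu p (A i) eps w| <= rho.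
      rewrite distrC -(ler_pXn2r (_ : 0 < 2)%N)// ?nnegrE ?(ltW rho0)//.
      rewrite real_normK ?num_real//; apply: le_trans (ltW Yr).
      by rewrite (bigD1 i)//= lerDl sumr_ge0// => j _; exact: sqr_ge0.
    apply: (@le_lt_trans _ _ ((\sum_i `|a i|) * rho)).
      rewrite mulr_suml; apply: (le_trans (ler_norm_sum _ _ _)).
      by apply: ler_sum => i _; rewrite normrM; apply: ler_wpM2l.
    rewrite /rho mulrA ltr_pdivrMr ?ltr_wpDl// mulrC ltr_pM2l ?divr_gt0//.
    by rewrite ltrDl.
have ih_q : q.-integrable setT (EFin \o h Z).
  by apply: integrable_indic_sum => // i; exact: integrable_snd_q.
pose hp x := Num.max (h Z x) 0.
pose hm x := Num.max (- h Z x) 0.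
have mhp : measurable_fun setT hp by apply: measurable_maxr => //; exact: mh.
have mhm : measurable_fun setT hm.
  by apply: measurable_maxr => //; apply: measurableT_comp => //; exact: mh.
have hp0 x : 0 <= hp x by rewrite le_max lexx orbT.
have hm0 x : 0 <= hm x by rewrite le_max lexx orbT.
have e4 : 0 < e / 4 by rewrite divr_gt0.
have tp := compensated_tail mhp hp0 (integrable_pos_part_lty ih_q) e4.
have tm := compensated_tail mhm hm0 (integrable_neg_part_lty ih_q) e4.
have aeE : \forall w \ae P,
    fine (\int[p w]_x (hp x)%:E) - fine (\int[q]_x (hp x)%:E) +
    -1 * (fine (\int[p w]_x (hm x)%:E) - fine (\int[q]_x (hm x)%:E)) =
    \sum_i a i * compensated_jumps nu p (A i) eps w.
  have : \forall w \ae P, forall i, (p w (A i `*` Z) < +oo)%E.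
    apply: filter_forall => i; apply: (ae_poisson_count_fin pq (mAZ i)).
    apply: le_lt_trans (qX_lty (bA i) eps0); apply: le_measure; rewrite ?inE//.
      by apply: measurableX; [exact: (bA i).1|exact: measurable_norm_gt].
    by move=> [s z] [/= Bs /andP[]].
  apply: filterS => w pw.
  have ipw i : (p w).-integrable (A i `*` Z) (EFin \o snd).
    apply: measurable_bounded_integrable => //; first exact: measurable_funTS.
    exists 1; split; [exact: num_real|move=> K /ltW K1 [s z] /= [_ /andP[_ z1]]].
    exact: le_trans K1.
  have ih_p : (p w).-integrable setT (EFin \o h Z) by exact: integrable_indic_sum.
  transitivity (\int[p w]_x h Z x - \int[q]_x h Z x).
    rewrite (Rintegral_parts ih_p) (Rintegral_parts ih_q); rewrite /hp /hm; ring.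
  rewrite /h -!Rintegral_indic_sum//; last by move=> i; exact: integrable_snd_q.
  rewrite -sumrB; apply: eq_bigr => i _.
  by rewrite -mulrBr Rintegral_snd_q.
have h2 : ((e ^+ 2 / 16)^-1%:E * \int[q]_x (hp x ^+ 2)%:E +
    (e ^+ 2 / 16)^-1%:E * \int[q]_x (hm x ^+ 2)%:E <= (16 / e ^+ 2)%:E *
     (small_jump_variance nu * \int[lebesgue_rV d]_s (`|g s| ^+ 2)%:E))%E.
  rewrite invf_div -ge0_muleDr ?integral_ge0// => [|x _|x _];
    rewrite ?lee_fin ?sqr_ge0//.
  apply: lee_wpmul2l; first by rewrite lee_fin divr_ge0 ?sqr_ge0.
  rewrite -ge0_integralD//; last 4 first.
  - by move=> x _; rewrite lee_fin sqr_ge0.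
  - by apply/measurable_EFinP; exact: measurable_funX.
  - by move=> x _; rewrite lee_fin sqr_ge0.
  - by apply/measurable_EFinP; exact: measurable_funX.
  (* The two parts have disjoint supports, so their squares add up to the square of [h]. *)
  rewrite (_ : (\int[q]_x _)%E = \int[q]_x (h Z x ^+ 2)%:E)%E; last first.
    apply: eq_integral => x _; rewrite -EFinD; congr EFin.
    rewrite /hp /hm; have [x0|x0] := leP 0 (h Z x).
      by rewrite max_r ?oppr_le0// expr0n addr0.
    by rewrite max_l ?oppr_ge0 ?(ltW x0)// expr0n add0r sqrrN.
  rewrite integral_q; last 2 first.
  - by apply/measurable_EFinP; apply: measurable_funX; exact: mh.
  - by move=> x; rewrite lee_fin sqr_ge0.
  rewrite (eq_integral (fun s =>
      ((`|g s| ^+ 2)%:E * \int[nu]_(z in Z) (z ^+ 2)%:E)%E)); last first.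
    move=> s _; rewrite [in RHS]integral_mkcond -ge0_integralZl//; last 2 first.
    - apply/(measurable_restrictT _ mZ); apply/measurable_EFinP/measurable_funTS.
      exact: measurable_funX.
    - by move=> z _; rewrite /patch; case: ifP => // _; rewrite lee_fin sqr_ge0.
    apply: eq_integral => z _; rewrite hE /= /patch indicE real_normK ?num_real//.
    case: (z \in Z); last by rewrite !mulr0 expr0n mule0.
    by rewrite mulr1 exprMn EFinM.
  rewrite ge0_integralZr//; last 2 first.
  - by apply/measurable_EFinP; exact: measurable_funX.
  - by apply: integral_ge0 => z _; rewrite lee_fin sqr_ge0.
  rewrite muleC; apply: lee_wpmul2r; last exact: levy_measure_small_le.
  by apply: integral_ge0 => s _; rewrite lee_fin sqr_ge0.
apply: (tail_le_ae (X := fun w =>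
  (fine (\int[p w]_x (hp x)%:E) - fine (\int[q]_x (hp x)%:E) +
    -1 * (fine (\int[p w]_x (hm x)%:E) - fine (\int[q]_x (hm x)%:E))) +
  \sum_i a i * (M i w - compensated_jumps nu p (A i) eps w))).
  move: aeE; apply: filterS => w ->; rewrite -big_split/=; apply: eq_bigr => i _.
  by rewrite -mulrDr addrC subrK.
apply: (@tail_leW _ _ _ P _ ((e / 4 + e / 4) + e / 2) _
  (((e / 4) ^+ 2)^-1%:E * \int[q]_x (hp x ^+ 2)%:E +
   ((e / 4) ^+ 2)^-1%:E * \int[q]_x (hm x ^+ 2)%:E + r%:E)%E); first by lra.
  by rewrite leeD2r// expr_div_n -[4 ^+ 2]natrX.
apply: tail_leD rem_tail; apply: tail_leD tp _.
move: tm => [E [mE PE hE']]; exists E; split => // w Ew.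
by rewrite mulN1r normrN; exact: hE'.
Qed.

End fixed_sets.

End levy_basis_tail.

(** * The modular and the tail bound for a Levy basis *)

Section levy_modulus.
Context {R : realType}.
Variable nu : {measure set R -> \bar R}.

(* A truncated version of the Rajput-Rosinski modular of a Levy basis. *)
Definition levy_modulus (u : R) : \bar R :=
  ((`|u| + `|u| ^+ 2)%:E + \int[nu]_(z in [set z | (1 < `|z|)%R])
     (Num.min 1 (`|u| * `|z|))%:E)%E.

Lemma large_modulus_ge0 (u : R) : (0 <= \int[nu]_(z in [set z | (1 < `|z|)%R])
  (Num.min 1 (`|u| * `|z|))%:E)%E.
Proof. by apply: integral_ge0 => z _; rewrite lee_fin le_min ler01 mulr_ge0. Qed.

Lemma levy_modulus_ge0 u : (0 <= levy_modulus u)%E.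
Proof. by rewrite adde_ge0 ?large_modulus_ge0// lee_fin addr_ge0// sqr_ge0. Qed.

Lemma measurable_large_modulus : levy_measure nu ->
  measurable_fun setT (fun u : R => \int[nu]_(z in [set z | (1 < `|z|)%R])
    (Num.min 1 (`|u| * `|z|))%:E)%E.
Proof.
move=> lnu; pose nu' := sigma_finite_of (levy_measure_sigma_finite lnu).
pose Z := [set z : R | 1 < `|z|].
have mZ : measurable Z by exact: measurable_norm_gt.
pose f (x : R * R) : \bar R := (Num.min 1 (`|x.1| * `|x.2|) * \1_Z x.2)%:E.
have mf : measurable_fun setT f.
  apply/measurable_EFinP; apply: measurable_funM.
    apply: measurable_minr => //; apply: measurable_funM; apply: measurableT_comp => //.
  by apply: measurableT_comp => //; exact: measurable_indic.
have f0 x : (0 <= f x)%E by rewrite lee_fin mulr_ge0// le_min ler01 mulr_ge0.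
have := measurable_fun_fubini_tonelli_F (m2 := nu') f mf f0.
congr measurable_fun; apply/funext => u; rewrite /fubini_F sigma_finite_ofE.
rewrite [RHS]integral_mkcond; apply: eq_integral => z _.
by rewrite /f /patch indicE; case: (_ \in _); rewrite ?mulr1 ?mulr0.
Qed.

Lemma measurable_levy_modulus : levy_measure nu -> measurable_fun setT levy_modulus.
Proof.
move=> lnu; apply: emeasurable_funD; last exact: measurable_large_modulus.
apply/measurable_EFinP; apply: measurable_funD; last apply: measurable_funX;
  exact: normr_measurable.
Qed.

End levy_modulus.

Section levy_basis_tail_bound.
Context {dT : measure_display} {T : measurableType dT} {R : realType}.
Variables (P : probability T R) (d : nat).
Variables (beta sigma : R) (nu : {measure set R -> \bar R}).
Variable L : set 'rV[R]_d -> {RV P >-> R}.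

(** A union bound with e / 4 for each of the drift, the Gaussian part, the small and the large
    jumps, every one bounded by the integral [I] of the modular. [K] is chosen before the
    combination, which is what allows passing to limits of simple functions. *)
Lemma levy_basis_tail : homogeneous_levy_basis beta sigma nu L ->
  forall e : R, 0 < e -> exists2 K : R, 0 <= K &
  forall (n : nat) (a : 'I_n -> R) (A : 'I_n -> set 'rV[R]_d),
    (forall i, bounded_borel (A i)) ->
    tail_le P (fun w => \sum_i a i * L (A i) w) e
      (K%:E * \int[lebesgue_rV d]_s levy_modulus nu (\sum_i a i * \1_(A i) s))%E.
Proof.
move=> [sigma0 lnu [W [p [gW poi _ LE]]]] e e0.
have e4 : 0 < e / 4 by rewrite divr_gt0.
pose e4s := e / 4 / (sigma + 1).
have e4s0 : 0 < e4s by rewrite divr_gt0// ltr_wpDl.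
have [kap0 kapoo] : (0 <= small_jump_variance nu)%E /\ (small_jump_variance nu < +oo)%E.
  split; last exact: lnu.2.
  by apply: integral_ge0 => z _; rewrite lee_fin le_min ler01 sqr_ge0.
pose K1 := `|beta| / (e / 4).
pose K2 := 8 / e4s ^+ 2.
pose K3 := 16 / (e / 4) ^+ 2 * fine (small_jump_variance nu).
pose K4 := 1 + (e / 4)^-1.
have K10 : 0 <= K1 by rewrite divr_ge0// ltW.
have K20 : 0 <= K2 by rewrite divr_ge0// sqr_ge0.
have K30 : 0 <= K3 by rewrite mulr_ge0 ?fine_ge0// divr_ge0// sqr_ge0.
have K40 : 0 <= K4 by rewrite addr_ge0// invr_ge0 ltW.
have K0 : 0 <= K1 + K2 + K3 by apply: addr_ge0 => //; exact: addr_ge0.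
exists (K1 + K2 + K3 + K4); first exact: addr_ge0.
move=> n a A bA; pose g s := \sum_i a i * \1_(A i) s.
have mg : measurable_fun setT g.
  apply: measurable_sum => i; apply: measurable_funM => //.
  exact: measurable_indic (bA i).1.
have mgn : measurable_fun setT (fun s => `|g s|) by exact: measurableT_comp.
have lA i : (lebesgue_rV d (A i) < +oo)%E by apply: lebesgue_rV_bounded_lty; case: (bA i).
have mpsi : measurable_fun setT (fun s => levy_modulus nu (g s)).
  by apply: measurableT_comp => //; exact: measurable_levy_modulus.
have [M cM ML] : exists2 M : 'I_n -> {RV P >-> R},
    forall i, is_compensated_small_jumps nu p (A i) (M i) &
    forall i, \forall w \ae P, L (A i) w = beta * fine (lebesgue_rV d (A i)) +
      sigma * W (A i) w + M i w + large_jumps p (A i) w.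
  have H i : exists M : {RV P >-> R}, is_compensated_small_jumps nu p (A i) M /\
      (\forall w \ae P, L (A i) w = beta * fine (lebesgue_rV d (A i)) +
      sigma * W (A i) w + M w + large_jumps p (A i) w).
    by have [M ? ?] := LE _ (bA i); exists M.
  exists (fun i => projT1 (cid (H i))) => i; first by case: (projT2 (cid (H i))).
  by case: (projT2 (cid (H i))).
set I := (\int[lebesgue_rV d]_s _)%E.
have I0 : (0 <= I)%E by apply: integral_ge0 => s _; exact: levy_modulus_ge0.
have le_I (f : 'rV[R]_d -> \bar R) : measurable_fun setT f -> (forall s, 0 <= f s)%E ->
    (forall s, f s <= levy_modulus nu (g s))%E -> (\int[lebesgue_rV d]_s f s <= I)%E.
  by move=> mf f0 fg; apply: ge0_le_integral => // s _; exact: levy_modulus_ge0.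
have I1 : (\int[lebesgue_rV d]_s `|g s|%:E <= I)%E.
  apply: le_I => [|s|s]; rewrite ?lee_fin//; first exact/measurable_EFinP.
  by rewrite /levy_modulus EFinD -addeA leeDl// adde_ge0 ?large_modulus_ge0// lee_fin.
have I2 : (\int[lebesgue_rV d]_s (`|g s| ^+ 2)%:E <= I)%E.
  apply: le_I => [|s|s]; rewrite ?lee_fin ?sqr_ge0//.
    by apply/measurable_EFinP; exact: measurable_funX.
  by rewrite /levy_modulus EFinD addeAC leeDr// adde_ge0 ?large_modulus_ge0// lee_fin.
have I3 : (\int[lebesgue_rV d]_s \int[nu]_(z in [set z | (1 < `|z|)%R])
    (Num.min 1 (`|g s| * `|z|))%:E <= I)%E.
  apply: le_I => [|s|s]; last 2 first.
  - exact: large_modulus_ge0.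
  - by rewrite /levy_modulus leeDr// lee_fin addr_ge0// sqr_ge0.
  - by apply: (measurableT_comp (measurable_large_modulus lnu)).
have iA i : (lebesgue_rV d).-integrable setT (EFin \o (\1_(A i) : _ -> R)).
  apply/integrableP; split.
    by apply/measurable_EFinP; apply: measurable_indic; exact: (bA i).1.
  under eq_integral do rewrite gee0_abs ?lee_fin//=.
  by rewrite integral_indic ?setIT//; exact: (bA i).1.
have ig : (lebesgue_rV d).-integrable setT (EFin \o g).
  by apply: integrable_EFin_sum => // i; exact: integrable_EFinZ.
have T1 : tail_le P (fun=> beta * \sum_i a i * fine (lebesgue_rV d (A i))) (e / 4)
    (K1%:E * I)%E.
  apply: tail_leW (lexx _) _ (tail_le_const P _ e4).
  have -> : \sum_i a i * fine (lebesgue_rV d (A i)) = \int[lebesgue_rV d]_s g s.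
    rewrite Rintegral_sum// => [|i]; last exact: integrable_EFinZ.
    apply: eq_bigr => i _; rewrite RintegralZl//; congr (_ * _).
    by rewrite /Rintegral integral_indic ?setIT//; exact: (bA i).1.
  rewrite normrM /K1 mulrAC EFinM; apply: lee_wpmul2l; first by rewrite lee_fin.
  apply: le_trans I1; rewrite -abse_EFin /Rintegral fineK ?integrable_fin_num//.
  by apply: le_abse_integral => //; exact/measurable_EFinP.
have T2 : tail_le P (fun w => sigma * \sum_i a i * W (A i) w) (e / 4) (K2%:E * I)%E.
  apply: tail_le_scale => //.
  apply: tail_leW (lexx _) _ (white_noise_tail a bA gW e4s0).
  by apply: lee_wpmul2l; rewrite ?lee_fin.
have T3 : tail_le P (fun w => \sum_i a i * M i w) (e / 4) (K3%:E * I)%E.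
  apply: tail_leW (lexx _) _ (small_jumps_tail lnu poi a bA cM e4).
  rewrite -[X in (_ * (X * _))%E]fineK ?ge0_fin_numE// muleA -EFinM.
  by apply: lee_wpmul2l; rewrite ?lee_fin.
have T4 : tail_le P (fun w => \sum_i a i * large_jumps p (A i) w) (e / 4) (K4%:E * I)%E.
  apply: tail_leW (lexx _) _ (large_jumps_tail lnu poi a bA e4).
  by apply: lee_wpmul2l; rewrite ?lee_fin.
have e4E : e / 4 + e / 4 + e / 4 + e / 4 = e by field.
have := tail_leD (tail_leD (tail_leD T1 T2) T3) T4.
rewrite e4E -!ge0_muleDl ?lee_fin//; last exact: addr_ge0.
apply: tail_le_ae.
have : \forall w \ae P, forall i, L (A i) w = beta * fine (lebesgue_rV d (A i)) +
    sigma * W (A i) w + M i w + large_jumps p (A i) w by exact: filter_forall.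
apply: filterS => w H; rewrite !mulr_sumr -!big_split/=; apply: eq_bigr => i _.
by rewrite H; ring.
Qed.

End levy_basis_tail_bound.

(** * Integrals with respect to a Levy basis *)

Section sfun_approximation.
Context {R : realType} {d : nat}.

(** Both parts of [f] are approximated from below and cut off to growing boxes, since [L] is
    described on bounded sets only. The error bound by |f| makes the modular of [f] a dominating
    function. *)
Lemma bounded_sfun_approx (f : 'rV[R]_d -> R) : measurable_fun setT f ->
  exists fn : nat -> {sfun 'rV[R]_d >-> R},
    [/\ forall n, bounded_set [set s | fn n s != 0],
        forall s, fn n s @[n --> \oo] --> f s &
        forall n s, `|fn n s - f s| <= `|f s|].
Proof.
move=> mf.
pose fp s : \bar R := (Num.max (f s) 0)%:E.
pose fm s : \bar R := (Num.max (- f s) 0)%:E.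
have mfp : measurable_fun setT fp by apply/measurable_EFinP; exact: measurable_maxr.
have mfm : measurable_fun setT fm.
  by apply/measurable_EFinP; apply: measurable_maxr => //; exact: measurableT_comp.
have fp0 s : (0 <= fp s)%E by rewrite lee_fin le_max lexx orbT.
have fm0 s : (0 <= fm s)%E by rewrite lee_fin le_max lexx orbT.
pose gp n : {sfun 'rV[R]_d >-> R} := nnsfun_approx measurableT mfp n.
pose gm n : {sfun 'rV[R]_d >-> R} := nnsfun_approx measurableT mfm n.
have gp_le n s : 0 <= gp n s <= Num.max (f s) 0.
  by rewrite -lee_fin -[X in _ && X]lee_fin nnsfun_approx_le// andbT lee_fin; exact: fun_ge0.
have gm_le n s : 0 <= gm n s <= Num.max (- f s) 0.
  by rewrite -lee_fin -[X in _ && X]lee_fin nnsfun_approx_le// andbT lee_fin; exact: fun_ge0.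
exists (fun n => indic_sfun _ (measurable_rV_box (n := d) n%:R) * (gp n - gm n)).
have E n s : (indic_sfun _ (measurable_rV_box (n := d) n%:R) * (gp n - gm n)) s =
    \1_(rV_box d n%:R) s * (gp n s - gm n s) by [].
split => [n|s|n s].
- have [M [Mr HM]] := rV_box_bounded d (n%:R : R).
  exists M; split => // x Mx s Es; apply: (HM x Mx).
  have : \1_(rV_box d n%:R) s * (gp n s - gm n s) != 0 by exact: Es.
  rewrite indicE; case: (boolP (s \in _)) => [|_]; first by rewrite inE.
  by rewrite mul0r eqxx.
- under eq_fun do rewrite E.
  have cp : gp n s @[n --> \oo] --> Num.max (f s) 0.
    exact: fine_cvg (cvg_nnsfun_approx measurableT mfp (fun s _ => fp0 s) (I : setT s)).
  have cm : gm n s @[n --> \oo] --> Num.max (- f s) 0.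
    exact: fine_cvg (cvg_nnsfun_approx measurableT mfm (fun s _ => fm0 s) (I : setT s)).
  have fE : f s = Num.max (f s) 0 - Num.max (- f s) 0.
    have [f0|f0] := leP 0 (f s).
      by rewrite max_r ?oppr_le0// subr0.
    by rewrite max_l ?oppr_ge0 ?(ltW f0)// sub0r opprK.
  rewrite fE; apply: cvg_trans (cvgB cp cm); apply: near_eq_cvg.
  have [k _ sk] : (\bigcup_k rV_box d (k%:R : R)) s by rewrite -rV_box_cover.
  exists k => // n /= kn; rewrite indicE mem_set ?mul1r// => i.
  move: (sk i); rewrite /= !in_itv/= -!ler_norml => /le_trans; apply.
  by rewrite ler_nat.
- rewrite E indicE; case: (s \in _); last by rewrite mul0r sub0r normrN.
  rewrite mul1r; move: (gp_le n s) (gm_le n s).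
  have [f0|f0] := leP 0 (f s).
    rewrite (max_r (_ : - f s <= 0)) ?oppr_le0// [`|f s|]ger0_norm// => /andP[h1 h2] /andP[h3 h4].
    by rewrite ler_norml; apply/andP; split; lra.
  rewrite (max_l (_ : 0 <= - f s)) ?oppr_ge0 ?(ltW f0)// [`|f s|]ltr0_norm// => /andP[h1 h2] /andP[h3 h4].
  by rewrite ler_norml; apply/andP; split; lra.
Qed.

End sfun_approximation.

Section simple_integrals.
Context {dT : measure_display} {T : measurableType dT} {R : realType}.
Variables (P : probability T R) (d : nat) (L : set 'rV[R]_d -> {RV P >-> R}).

(** The value 0 gets the empty set instead of its unbounded level set, so that every set in the
    combination is bounded; its coefficient vanishes anyway. *)
Lemma simple_integralE (f : {sfun 'rV[R]_d >-> R}) (B : set 'rV[R]_d) :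
  bounded_set [set s | f s != 0] -> measurable B ->
  exists (n : nat) (a : 'I_n -> R) (A : 'I_n -> set 'rV[R]_d),
    [/\ forall i, bounded_borel (A i),
        forall w, simple_integral L f B w = \sum_i a i * L (A i) w &
        forall s, f s * \1_B s = \sum_i a i * \1_(A i) s].
Proof.
move=> bf mB; pose r := finmap.enum_fset (fset_set (range f)).
pose x (i : 'I_(size r)) := nth 0 r i.
exists (size r), x, (fun i => if x i == 0 then set0 else f @^-1` [set x i] `&` B).
split=> [i|w|s].
- case: ifPn => [_|xi0]; first by split => //; exists 0; split => // ? _ ? [].
  split; first by apply: measurableI => //; rewrite -[X in measurable X]setTI; exact: measurable_funP.
  have [M [Mr HM]] := bf; exists M; split => // y My s [/= fs _].
  by apply: (HM y My); rewrite /= fs.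
- rewrite /simple_integral fsbig_finite//= (big_nth 0) big_mkord.
  apply: eq_bigr => i _; case: ifPn => // /eqP; rewrite -/(x i) => ->; by rewrite !mul0r.
- rewrite fimfunE fsbig_finite//= (big_nth 0) big_mkord mulr_suml.
  apply: eq_bigr => i _; rewrite -/(x i); case: ifPn => [/eqP ->|_]; first by rewrite !mul0r.
  by rewrite -mulrA indicI.
Qed.

Lemma measurable_simple_integral (f : {sfun 'rV[R]_d >-> R}) (B : set 'rV[R]_d) :
  measurable_fun setT (simple_integral L f B).
Proof.
rewrite /simple_integral; under eq_fun do rewrite fsbig_finite//=.
by apply: measurable_sum => x; apply: measurable_funM.
Qed.

End simple_integrals.

Section levy_modulus_properties.
Context {R : realType} (nu : {measure set R -> \bar R}) (lnu : levy_measure nu).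

Let Z := [set z : R | 1 < `|z|].

Let mZ : measurable Z. Proof. exact: measurable_norm_gt. Qed.

Let mmin (u : R) : measurable_fun Z (fun z => (Num.min 1 (`|u| * `|z|))%:E).
Proof.
apply/measurable_EFinP/measurable_funTS; apply: measurable_minr => //.
by apply: measurable_funM => //; exact: normr_measurable.
Qed.

Let min0 (u z : R) : (0 <= (Num.min 1 (`|u| * `|z|))%:E)%E.
Proof. by rewrite lee_fin le_min ler01 mulr_ge0. Qed.

Lemma levy_modulus_le (u v : R) : `|u| <= `|v| ->
  (levy_modulus nu u <= levy_modulus nu v)%E.
Proof.
move=> uv; apply: leeD.
  by rewrite lee_fin lerD// lerXn2r// ?nnegrE.
apply: ge0_le_integral => // z _; rewrite lee_fin; apply: le_min2 => //.
exact: ler_wpM2r.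
Qed.

Lemma levy_modulusN u : levy_modulus nu (- u) = levy_modulus nu u.
Proof. by rewrite /levy_modulus normrN. Qed.

(** Stands in for the triangle inequality. The 2 is forced by (x + y) ^ 2 <= 2 x ^ 2 + 2 y ^ 2; min
    (1, x) is subadditive. *)
Lemma levy_modulusD (u v : R) :
  (levy_modulus nu (u + v) <= 2%:E * levy_modulus nu u + 2%:E * levy_modulus nu v)%E.
Proof.
have le1 : ((`|u + v| + `|u + v| ^+ 2)%:E <=
    (2 * (`|u| + `|u| ^+ 2) + 2 * (`|v| + `|v| ^+ 2))%:E)%E.
  rewrite lee_fin; have := ler_normD u v; move: (normr_ge0 (u + v)).
  move: `|u| `|v| `|u + v| (normr_ge0 u) (normr_ge0 v) => x y z x0 y0 z0 h.
  have : z ^+ 2 <= (x + y) ^+ 2 by rewrite lerXn2r// nnegrE ?addr_ge0.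
  have := sqr_ge0 (x - y); nra.
have le2 : (\int[nu]_(z in Z) (Num.min 1 (`|(u + v)%R| * `|z|))%:E <=
    2%:E * \int[nu]_(z in Z) (Num.min 1 (`|u| * `|z|))%:E +
    2%:E * \int[nu]_(z in Z) (Num.min 1 (`|v| * `|z|))%:E)%E.
  have m2 (w : R) : measurable_fun Z (fun z => 2%:E * (Num.min 1 (`|w| * `|z|))%:E)%E.
    exact: measurable_funeM.
  have p2 (w z : R) : (0 <= 2%:E * (Num.min 1 (`|w| * `|z|))%:E)%E by exact: mule_ge0.
  rewrite -!ge0_integralZl// -ge0_integralD//.
  apply: ge0_le_integral => //.
  - exact: emeasurable_funD.
  - move=> z _; rewrite -!EFinM -EFinD lee_fin.
    have : `|u + v| * `|z| <= `|u| * `|z| + `|v| * `|z|.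
      by rewrite -mulrDl ler_wpM2r// ler_normD.
    move: (mulr_ge0 (normr_ge0 u) (normr_ge0 z)) (mulr_ge0 (normr_ge0 v) (normr_ge0 z)).
    move: (`|u + v| * _) (`|u| * _) (`|v| * _) => x y t.
    by rewrite /Num.min; case: ifP; case: ifP; case: ifP => /=; rewrite ?ltNge; lra.
pose J w : \bar R := (\int[nu]_(z in Z) (Num.min 1 (`|w : R| * `|z|))%:E)%E.
have J0 w : (0 <= J w)%E by exact: large_modulus_ge0.
rewrite /levy_modulus -/Z -!/(J _) in le2 *.
move: (J (u + v)) (J u) (J v) (J0 u) (J0 v) le2 => Iuv Iu Iv Iu0 Iv0 le2.
rewrite !ge0_muleDr// ?lee_fin ?addr_ge0 ?sqr_ge0// addeACA.
by apply: leeD => //; rewrite -!EFinM -EFinD.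
Qed.

(** The truncated integrand is dominated by 1, which is integrable because [nu] is finite on |z| >
    1. *)
Lemma levy_modulus_cvg0 (u : nat -> R) : u n @[n --> \oo] --> 0 ->
  levy_modulus nu (u n) @[n --> \oo] --> 0%E.
Proof.
move=> u0.
have nu0 : `|u n| @[n --> \oo] --> (0 : R) by rewrite -[X in _ --> X](@normr0 _ R); exact: cvg_norm.
rewrite -[X in _ --> X]adde0; apply: cvgeD => //.
  apply/fine_cvgP; split; first by apply: nearW.
  rewrite (_ : fine \o _ = fun n => `|u n| + `|u n| ^+ 2)//.
  rewrite [X in _ --> X](_ : _ = 0 + 0 ^+ 2); last by rewrite expr0n addr0.
  by apply: cvgD => //; rewrite !expr2; exact: cvgM.
have [] := @dominated_convergence _ _ _ nu Z mZ
  (fun n z => (Num.min 1 (`|u n| * `|z|))%:E) (fun=> 0%E) (fun=> 1%E).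
- by move=> n; exact: mmin.
- exact: measurable_cst.
- apply: aeW => z _; apply/fine_cvgP; split; first exact: nearW.
  rewrite (_ : fine \o _ = fun n => Num.min 1 (`|u n| * `|z|))//=.
  apply: (@squeeze_cvgr _ _ _ _ (fun=> 0) (fun n => `|u n| * `|z|)).
  - apply: nearW => n; rewrite le_min ler01 mulr_ge0//=.
    by rewrite ge_min lexx orbT.
  - exact: cvg_cst.
  - by rewrite -(mul0r `|z|); apply: cvgMl.
- apply/integrableP; split => //; under eq_integral do rewrite abse1.
  by rewrite integral_cst// mul1e; exact: levy_measure_tail_lty.
- apply: aeW => z n _; rewrite gee0_abs// lee_fin ge_min lexx//.
by move=> _ _; rewrite integral0.
Qed.

End levy_modulus_properties.

(** * Finite modular implies integrability *)

Section levy_integrability.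
Context {dT : measure_display} {T : measurableType dT} {R : realType}.
Variables (P : probability T R) (d : nat) (L : set 'rV[R]_d -> {RV P >-> R}).
Variables (beta sigma : R) (nu : {measure set R -> \bar R}).
Hypothesis lL : homogeneous_levy_basis beta sigma nu L.

(** The two representations are concatenated, with opposite signs, into one combination. Restricting
    to [B] multiplies by an indicator, which can only lower the modular: the bound is uniform in
    [B]. *)
Lemma simple_integral_diff_tail (e : R) : 0 < e -> exists2 K : R, 0 <= K &
  forall (f g : {sfun 'rV[R]_d >-> R}) (B : set 'rV[R]_d),
    bounded_set [set s | f s != 0] -> bounded_set [set s | g s != 0] ->
    measurable B ->
    (P [set w | (e <= `|simple_integral L f B w - simple_integral L g B w|)%R] <=
     K%:E * \int[lebesgue_rV d]_s levy_modulus nu (f s - g s))%E.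
Proof.
move=> e0; have lnu : levy_measure nu by case: lL.
have [K K0 HK] := levy_basis_tail lL e0; exists K => // f g B bf bg mB.
have [n [a [A [bA EA sA]]]] := simple_integralE L bf mB.
have [m [c [C [bC EC sC]]]] := simple_integralE L bg mB.
pose a' (i : 'I_(n + m)) := match fintype.split i with inl j => a j | inr j => - c j end.
pose A' (i : 'I_(n + m)) := match fintype.split i with inl j => A j | inr j => C j end.
have bA' i : bounded_borel (A' i) by rewrite /A'; case: (fintype.split i).
have sumE (F : set 'rV[R]_d -> R) : \sum_i a' i * F (A' i) =
    \sum_i a i * F (A i) - \sum_i c i * F (C i).
  rewrite big_split_ord/= -sumrN; congr (_ + _); apply: eq_bigr => i _.
    by rewrite /a' /A' (unsplitK (inl _ i)).
  by rewrite /a' /A' (unsplitK (inr _ i)) mulNr.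
have [E [mE PE HE]] := HK _ a' A' bA'.
have mS h : measurable_fun setT (simple_integral L h B) by exact: measurable_simple_integral.
apply: (@le_trans _ _ (P E)).
  apply: le_measure; rewrite ?inE//.
    rewrite -[X in measurable X]setTI; apply: measurable_fun_le => //.
    by apply: measurableT_comp => //; exact: measurable_funB.
  move=> w /= Hw; apply: contrapT => /HE; rewrite (sumE (fun D => L D w)) -EA -EC.
  by rewrite ltNge Hw.
apply: le_trans PE _; apply: lee_wpmul2l; first by rewrite lee_fin.
have mpsi (h : 'rV[R]_d -> R) : measurable_fun setT h ->
    measurable_fun setT (fun s => levy_modulus nu (h s)).
  by move=> mh; apply: measurableT_comp => //; exact: measurable_levy_modulus.
apply: ge0_le_integral => //.
- by move=> s _; exact: levy_modulus_ge0.
- apply: mpsi; apply: measurable_sum => i; apply: measurable_funM => //.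
  exact: measurable_indic (bA' i).1.
- by apply: mpsi; exact: measurable_funB.
- move=> s _; apply: levy_modulus_le; rewrite (sumE (fun D => \1_D s)) -sA -sC -mulrBl.
  by rewrite normrM ler_piMr// ger0_norm// indicE; case: (_ \in _); rewrite ?lexx ?ler01.
Qed.

Lemma levy_integrable_modulus (f : 'rV[R]_d -> R) : measurable_fun setT f ->
  (\int[lebesgue_rV d]_s levy_modulus nu (f s) < +oo)%E -> levy_integrable L f.
Proof.
move=> mf fi; have lnu : levy_measure nu by case: lL.
have [fn [bfn cfn fn_le]] := bounded_sfun_approx mf.
have mpsi (h : 'rV[R]_d -> R) : measurable_fun setT h ->
    measurable_fun setT (fun s => levy_modulus nu (h s)).
  by move=> mh; apply: measurableT_comp => //; exact: measurable_levy_modulus.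
have mfn n : measurable_fun setT (fn n) by [].
have fi' : (lebesgue_rV d).-integrable setT (fun s => levy_modulus nu (f s)).
  apply/integrableP; split; first exact: mpsi.
  by under eq_integral do rewrite gee0_abs ?levy_modulus_ge0//.
have [] := @dominated_convergence _ _ _ (lebesgue_rV d) setT measurableT
  (fun n s => levy_modulus nu (fn n s - f s)) (fun=> 0%E)
  (fun s => levy_modulus nu (f s)).
- by move=> n; apply: mpsi; exact: measurable_funB.
- exact: measurable_cst.
- apply: aeW => s _; apply: levy_modulus_cvg0 => //.
  by rewrite -(subrr (f s)); apply: cvgB => //; exact: cvg_cst.
- exact: fi'.
- apply: aeW => s n _; rewrite gee0_abs ?levy_modulus_ge0//.
  exact: levy_modulus_le.
move=> _ _; rewrite integral0 => cvg0.
have diff_le n m : (\int[lebesgue_rV d]_s levy_modulus nu (fn n s - fn m s) <=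
    2%:E * \int[lebesgue_rV d]_s levy_modulus nu (fn n s - f s) +
    2%:E * \int[lebesgue_rV d]_s levy_modulus nu (fn m s - f s))%E.
  have m2 k : measurable_fun setT (fun s => 2%:E * levy_modulus nu (fn k s - f s))%E.
    by apply: measurable_funeM; apply: mpsi; exact: measurable_funB.
  have p2 k s : (0 <= 2%:E * levy_modulus nu (fn k s - f s))%E.
    by rewrite mule_ge0 ?levy_modulus_ge0.
  have Zk k : (2%:E * \int[lebesgue_rV d]_s levy_modulus nu (fn k s - f s) =
      \int[lebesgue_rV d]_s (2%:E * levy_modulus nu (fn k s - f s)))%E.
    apply/esym/ge0_integralZl => // [|s _]; last exact: levy_modulus_ge0.
    by apply: mpsi; exact: measurable_funB.
  rewrite [X in (_ <= X + _)%E]Zk [X in (_ <= _ + X)%E]Zk.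
  rewrite -ge0_integralD//; apply: ge0_le_integral => //.
  - by move=> s _; exact: levy_modulus_ge0.
  - by apply: mpsi; exact: measurable_funB.
  - exact: emeasurable_funD.
  - move=> s _; rewrite (_ : fn n s - fn m s = (fn n s - f s) + - (fn m s - f s)).
      by apply: le_trans (levy_modulusD nu _ _) _; rewrite levy_modulusN.
    by rewrite opprB addrA subrK.
have cvgB B : measurable B -> exists Y : {RV P >-> R},
    cvg_in_probability P (fun n => simple_integral L (fn n) B) Y.
  move=> mB; apply: cvg_in_probability_complete.
    by move=> n; exact: measurable_simple_integral.
  move=> e e0; have [K K0 HK] := simple_integral_diff_tail e0.
  (* Two errors, each doubled, give K (2 c + 2 c) = e K / (K + 1) <= e. *)
  pose c := e / (4 * (K + 1)).
  have c0 : 0 < c by rewrite divr_gt0// mulr_gt0// ltr_wpDl.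
  have [N _ HN] := cvg0 _ (@nbhs_open_ereal_lt _ 0 (fun=> c) c0).
  exists N => n m Nn Nm; apply: le_trans (HK _ _ _ (bfn n) (bfn m) mB) _.
  apply: (@le_trans _ _ (K%:E * (2%:E * c%:E + 2%:E * c%:E))%E).
    apply: lee_wpmul2l; first by rewrite lee_fin.
    apply: le_trans (diff_le n m) _; apply: leeD; apply: lee_wpmul2l => //; apply: ltW.
      exact: HN.
    exact: HN.
  rewrite -[(2%:E * c%:E)%E]EFinM -EFinD -EFinM lee_fin.
  rewrite (_ : K * _ = e * (K / (K + 1))); last by rewrite /c; field; rewrite gt_eqF// ltr_wpDl.
  by rewrite ler_piMr ?(ltW e0)// ler_pdivrMr ?ltr_wpDl// mul1r lerDl.
have [X HX] := cvgB _ measurableT.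
exists X; split => //; exists fn; split => //.
by apply: aeW => s.
Qed.

End levy_integrability.

(** * The modular of exponential kernels *)

Section exponential_rays.
Context {R : realType}.

Definition exp_ray (l t x : R) : R := if x <= t then expR (- (l * (t - x))) else 0.

Lemma exp_ray_ge0 l t x : 0 <= exp_ray l t x.
Proof. by rewrite /exp_ray; case: ifP => // _; exact: expR_ge0. Qed.

Lemma exp_ray_le1 l t x : 0 <= l -> exp_ray l t x <= 1.
Proof.
rewrite /exp_ray => l0; case: ifP => // xt.
by rewrite -[leRHS]expR0 ler_expR oppr_le0 mulr_ge0// subr_ge0.
Qed.

Let continuous_exp (l t c : R) : continuous (fun x : R => expR (- (l * (t + c * x)))).
Proof.
move=> x; apply: (@continuous_comp _ _ _ (fun x => - (l * (t + c * x))) expR).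
  apply: cvgN; apply: cvgM; first exact: cvg_cst.
  by apply: cvgD; [exact: cvg_cst|apply: cvgM; [exact: cvg_cst|exact: cvg_id]].
exact: continuous_expR.
Qed.

Let continuous_expB (l t : R) : continuous (fun x : R => expR (- (l * (t - x)))).
Proof.
rewrite (_ : (fun x => _) = fun x => expR (- (l * (t + -1 * x)))).
  exact: continuous_exp.
by apply/funext => x; rewrite mulN1r.
Qed.

Let measurable_ray (t : R) (f : R -> R) : measurable_fun setT f ->
  measurable_fun setT (fun x : R => if x <= t then f x else 0).
Proof.
move=> mf; apply: measurable_fun_ifT => //.
by apply: measurable_fun_ler.
Qed.

Lemma measurable_exp_ray l t : measurable_fun setT (exp_ray l t).
Proof.
by apply: measurable_ray; exact: continuous_measurable_fun.
Qed.

Lemma integral_exp_ray l t : 0 < l ->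
  (\int[lebesgue_measure]_x (exp_ray l t x)%:E = l^-1%:E)%E.
Proof.
move=> l0.
have -> : (\int[lebesgue_measure]_x (exp_ray l t x)%:E =
    \int[lebesgue_measure]_(x in `]-oo, t]) (expR (- (l * (t - x))))%:E)%E.
  rewrite [RHS]integral_mkcond; apply: eq_integral => x _.
  by rewrite /patch mem_setE in_itv/= /exp_ray; case: ifP.
(* Reflection turns the half-line into one unbounded to the right, where the fundamental theorem of
   calculus applies. *)
have := @ge0_integration_by_substitutionNy R (fun x => expR (- (l * (t - x)))) (- t).
rewrite opprK => ->; last 2 first.
- exact/continuous_subspaceT/continuous_expB.
- by move=> x _; exact: expR_ge0.
pose F (x : R) := - l^-1 * expR (- (l * (t + x))).
have dF (x : R) : is_derive x 1 F (expR (- (l * (t + x)))).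
  apply: is_derive_eq; rewrite /GRing.scale/= add0r mulr1.
  by rewrite mulrN mulrNN mulrC mulfK// gt_eqF.
have cF : continuous F.
  by move=> x; apply/differentiable_continuous/derivable1_diffP; exact: (@ex_derive _ _ _ _ _ _ _ (dF x)).
rewrite (@ge0_continuous_FTC2y R _ F _ 0).
- by rewrite /F subrr mulr0 oppr0 expR0 mulr1 -EFinB sub0r opprK.
- by move=> x _; exact: expR_ge0.
- apply/continuous_subspaceT => x /=.
  rewrite (_ : _ \o _ = fun x => expR (- (l * (t + 1 * x)))).
    exact: continuous_exp.
  by apply/funext => y /=; rewrite opprK mul1r.
- rewrite -[X in _ --> X](mulr0 (- l^-1)); apply: cvgMr.
  have ltx : l * (t + x) @[x --> +oo] --> +oo.
    by apply: gt0_cvgMry => //; exact: cvg_addrl.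
  exact: (cvg_comp _ _ ltx (@cvgr_expR R)).
- by move=> x _; exact: (@ex_derive _ _ _ _ _ _ _ (dF x)).
- exact/cvg_at_right_filter/cF.
- by move=> x _; rewrite derive1E (@derive_val _ _ _ _ _ _ _ (dF x))/= opprK.
Qed.

(** The minimum is 1 on the interval of length a / l before [t], and decays at rate l / k to the
    left of it: the two pieces contribute a / l and k / l. *)
Lemma integral_min_exp_ray (l a k t : R) : 0 < l -> 0 <= a -> 0 < k ->
  (\int[lebesgue_measure]_x
    (if x <= t then Num.min 1 (expR ((a - l * (t - x)) / k)) else 0)%:E <=
   ((a + k) / l)%:E)%E.
Proof.
move=> l0 a0 k0.
pose I : set R := `[t - a / l, t]%classic.
have mI : measurable I by exact: measurable_itv.
apply: (@le_trans _ _ (\int[lebesgue_measure]_x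
    ((\1_I x)%:E + (exp_ray (l / k) (t - a / l) x)%:E))%E).
  apply: ge0_le_integral => //.
  - by move=> x _; case: ifP => // _; rewrite lee_fin le_min ler01 expR_ge0.
  - apply/measurable_EFinP; apply: measurable_ray; apply: measurable_minr => //.
    apply: measurableT_comp; first exact: measurable_expR.
    apply: measurable_funM => //; apply: measurable_funB => //.
    by apply: measurable_funM => //; exact: measurable_funB.
  - apply: emeasurable_funD; apply/measurable_EFinP; first exact: measurable_indic.
    exact: measurable_exp_ray.
  move=> x _; rewrite -EFinD lee_fin.
  case: ifPn => xt; last by rewrite addr_ge0// exp_ray_ge0.
  have [xa|xa] := leP (t - a / l) x.
    rewrite indicE mem_set; last by rewrite /I/= in_itv/= xa xt.
    by rewrite ge_min lerDl exp_ray_ge0.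
  rewrite /exp_ray (ltW xa) ge_min; apply/orP; right.
  apply: (@le_trans _ _ (expR (- (l / k * (t - a / l - x))))); last by rewrite lerDr.
  rewrite ler_expR le_eqVlt; apply/orP; left; apply/eqP; field.
  by rewrite !gt_eqF.
rewrite ge0_integralD//; last 3 first.
- by apply/measurable_EFinP; exact: measurable_indic.
- by move=> x _; rewrite lee_fin exp_ray_ge0.
- by apply/measurable_EFinP; exact: measurable_exp_ray.
rewrite integral_indic// setIT integral_exp_ray ?divr_gt0//.
have lI : lebesgue_measure I = (a / l)%:E.
  rewrite [LHS](lebesgue_measure_itv `[t - a / l, t])/= lte_fin.
  case: ifPn => [_|]; first by rewrite -EFinB opprB addrC subrK.
  rewrite -leNgt lerBrDr gerDl => al0; congr EFin; apply/eqP.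
  by rewrite eq_le al0 divr_ge0// ltW.
by rewrite [X in (X + _)%E](lI : _ = _) invf_div -EFinD lee_fin mulrDl.
Qed.

(* Each factor [exp_ray] is at most 1, so the left-hand side is at most each
   [Num.min 1 (expR (a - l * (t i - s i)))], hence at most their geometric mean. *)
Lemma min_prod_exp_ray (d : nat) (l a : R) (t s : 'I_d -> R) : (0 < d)%N -> 0 <= l ->
  Num.min 1 (expR a * \prod_i exp_ray l (t i) (s i)) <=
  \prod_i (if s i <= t i then Num.min 1 (expR ((a - l * (t i - s i)) / d%:R)) else 0).
Proof.
move=> d0 l0; have minE (x : R) : Num.min 1 (expR x) = expR (Num.min 0 x).
  have [x0|x0] := leP x 0; first by rewrite !min_r// -expR0 ler_expR.
  by rewrite !min_l ?expR0 ?(ltW x0)// -expR0 ler_expR ltW.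
have [/forallP st|/forallPn[i sti]] := boolP [forall i, s i <= t i]; last first.
  rewrite [X in _ * X](bigD1 i)//= [leRHS](bigD1 i)//= {1}/exp_ray (negbTE sti).
  by rewrite !mul0r mulr0 min_r.
under [leRHS]eq_bigr => i _ do rewrite st minE.
under eq_bigr => i _ do rewrite /exp_ray st.
rewrite -!expR_sum -expRD minE ler_expR sumrN.
set S := \sum_i _; set y := Num.min 0 (a - S).
rewrite [leLHS](_ : y = \sum_(i < d) y / d%:R); last first.
  by rewrite sumr_const card_ord -[RHS]mulr_natr divfK// pnatr_eq0 -lt0n.
apply: ler_sum => i _; rewrite le_min; apply/andP; split.
  by rewrite pmulr_lle0 ?invr_gt0 ?ltr0n// ge_min lexx.
rewrite ler_wpM2r ?invr_ge0 ?ler0n// ge_min; apply/orP; right.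
by rewrite lerD2l lerN2 /S (bigD1 i)//= lerDl sumr_ge0// => j _; rewrite mulr_ge0 ?subr_ge0.
Qed.

End exponential_rays.

Section kernel_modulus.
Context {R : realType} (nu : {measure set R -> \bar R}) (lnu : levy_measure nu).
Variables (d : nat) (d0 : (0 < d)%N).
Hypothesis log_nu : log_moment d nu.
Variables (C l : R) (C1 : 1 <= C) (l0 : 0 < l) (t : 'rV[R]_d).

Let C0 : 0 < C. Proof. exact: lt_le_trans C1. Qed.

Let G (s : 'rV[R]_d) : R := C * \prod_i exp_ray l (t 0 i) (s 0 i).

Let G0 s : 0 <= G s.
Proof. by rewrite mulr_ge0 ?prodr_ge0 ?(ltW C0)// => i _; exact: exp_ray_ge0. Qed.

Let prod1 (s : 'rV[R]_d) : 0 <= \prod_i exp_ray l (t 0 i) (s 0 i) <= 1.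
Proof.
rewrite prodr_ge0/= => [|i _]; last exact: exp_ray_ge0.
apply: prodr_ile1 => i _; rewrite exp_ray_ge0/=; apply: exp_ray_le1; exact: ltW.
Qed.

Let mprod : measurable_fun setT (fun s : 'rV[R]_d => \prod_i exp_ray l (t 0 i) (s 0 i)).
Proof.
apply: measurable_prod => i _.
exact: measurableT_comp (measurable_exp_ray _ _) (measurable_coord i).
Qed.

Let mG : measurable_fun setT G.
Proof. exact: measurable_funM. Qed.

Let integral_prod : (\int[lebesgue_rV d]_s (\prod_i exp_ray l (t 0 i) (s 0 i))%:E =
  (l^-1 ^+ d)%:E)%E.
Proof.
rewrite (integral_prod_rV (phi := fun i => exp_ray l (t 0 i))) => [|i|i x]; last 2 first.
- exact: measurable_exp_ray.
- exact: exp_ray_ge0.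
under eq_bigr do rewrite integral_exp_ray//.
by rewrite prodEFin prodr_const card_ord.
Qed.

Let Z := [set z : R | 1 < `|z|].

Let mZ : measurable Z. Proof. exact: measurable_norm_gt. Qed.

(** The power of 2 comes from (x + y) ^ d <= 2 ^ d (x ^ d + y ^ d), that of 1 / l from the
    one-dimensional integrals. *)
Let K := (2 / l) ^+ d.

(** With e ^ a = C |z|, [min_prod_exp_ray] bounds the integrand by a product over the coordinates,
    whose integral is a product of [d] integrals at most (a + d) / l each. This is the source of the
    power [d] of the logarithm. *)
Let inner_le (z : R) : Z z ->
  (\int[lebesgue_rV d]_s (Num.min 1 (`|G s| * `|z|))%:E <=
   (K * (ln C + d%:R) ^+ d + K * ln `|z| ^+ d)%:E)%E.
Proof.
rewrite /Z/= => z1; have z0 : 0 < `|z| by exact: lt_trans z1.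
have Cz : 0 < C * `|z| by rewrite mulr_gt0.
pose a := ln (C * `|z|).
have aE : a = ln C + ln `|z| by rewrite /a lnM ?posrE.
have lC0 : 0 <= ln C by exact: ln_ge0.
have lz0 : 0 <= ln `|z| by apply: ln_ge0; exact: ltW.
have a0 : 0 <= a by rewrite aE addr_ge0.
have dR : 0 < d%:R :> R by rewrite ltr0n.
pose m i (x : R) := if x <= t 0 i then Num.min 1 (expR ((a - l * (t 0 i - x)) / d%:R)) else 0.
have m0 i x : 0 <= m i x by rewrite /m; case: ifP => // _; rewrite le_min ler01 expR_ge0.
have mm i : measurable_fun setT (m i).
  apply: measurable_fun_ifT => //; first exact: measurable_fun_ler.
  apply: measurable_minr => //; apply: measurableT_comp; first exact: measurable_expR.
  apply: measurable_funM => //; apply: measurable_funB => //.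
  by apply: measurable_funM => //; exact: measurable_funB.
apply: (@le_trans _ _ (\int[lebesgue_rV d]_s (\prod_i m i (s 0 i))%:E)%E).
  apply: ge0_le_integral => //.
  - apply/measurable_EFinP; apply: measurable_minr => //; apply: measurable_funM => //.
    exact: measurableT_comp.
  - apply/measurable_EFinP; apply: measurable_prod => i _.
    exact: measurableT_comp (mm i) (measurable_coord i).
  move=> s _; rewrite lee_fin.
  apply: le_trans (min_prod_exp_ray a (fun i => t 0 i) (fun i => s 0 i) d0 (ltW l0)).
  by rewrite ger0_norm// /G /a lnK ?posrE// mulrAC.
rewrite integral_prod_rV//.
apply: (@le_trans _ _ (\prod_(i < d) ((a + d%:R) / l)%:E)%E).
  have H i : (0 <= \int[lebesgue_measure]_x (m i x)%:E <= ((a + d%:R) / l)%:E)%E.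
    rewrite integral_ge0 => [|x _]; last by rewrite lee_fin.
    exact: integral_min_exp_ray.
  suff /(_ (index_enum _))/andP[] : forall r : seq 'I_d,
    (0 <= \prod_(i <- r) \int[lebesgue_measure]_x (m i x)%:E <=
     \prod_(i <- r) ((a + d%:R) / l)%:E)%E by [].
  elim=> [|i r /andP[IH0 IH]]; first by rewrite !big_nil lexx lee_fin ler01.
  have /andP[Hi0 Hi] := H i; rewrite !big_cons mule_ge0//=.
  exact: lee_pmul.
rewrite prodEFin prodr_const card_ord lee_fin aE -mulrDr /K !expr_div_n.
rewrite mulrAC; apply: ler_wpM2r; first by rewrite invr_ge0 exprn_ge0 // ltW.
rewrite addrAC; move: (ln C + d%:R) (ln `|z|) lz0 (addr_ge0 lC0 (ltW dR)) => x y y0 x0.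
have [xy|yx] := leP x y.
  apply: (@le_trans _ _ ((2 * y) ^+ d)).
    by rewrite lerXn2r ?nnegrE ?addr_ge0 ?mulr_ge0// mulr_natl mulr2n lerD2r.
  by rewrite exprMn ler_wpM2l ?exprn_ge0// lerDr exprn_ge0.
apply: (@le_trans _ _ ((2 * x) ^+ d)).
  by rewrite lerXn2r ?nnegrE ?addr_ge0 ?mulr_ge0// mulr_natl mulr2n lerD2l ltW.
by rewrite exprMn ler_wpM2l ?exprn_ge0// lerDl exprn_ge0.
Qed.

Let nu' := sigma_finite_of (levy_measure_sigma_finite lnu).

(** Tonelli puts the integral over [s] inside, where [inner_le] applies; its constant term is
    integrable since [nu] is finite on [Z], the other one by the logarithmic moment. *)
Let large_lty : (\int[lebesgue_rV d]_s \int[nu]_(z in Z) (Num.min 1 (`|G s| * `|z|))%:E < +oo)%E.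
Proof.
pose f (x : 'rV[R]_d * R) : \bar R := (Num.min 1 (`|G x.1| * `|x.2|) * \1_Z x.2)%:E.
have mf : measurable_fun setT f.
  apply/measurable_EFinP; apply: measurable_funM.
    apply: measurable_minr => //; apply: measurable_funM; last exact: measurableT_comp.
    by apply: measurableT_comp => //; exact: measurableT_comp.
  by apply: measurableT_comp => //; exact: measurable_indic.
have f0 x : (0 <= f x)%E by rewrite lee_fin mulr_ge0// le_min ler01 mulr_ge0.
rewrite (_ : (\int[lebesgue_rV d]_s _)%E = \int[leb_rV d]_s \int[nu']_z f (s, z))%E; last first.
  rewrite /leb_rV sigma_finite_ofE; apply: eq_integral => s _.
  transitivity (\int[nu]_z f (s, z))%E; last first.
    exact/esym/(sigma_finite_ofE (levy_measure_sigma_finite lnu)).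
  rewrite integral_mkcond; apply: eq_integral => z _.
  by rewrite /f /patch indicE; case: (z \in Z); rewrite ?mulr1 ?mulr0.
rewrite fubini_tonelli// sigma_finite_ofE.
apply: (@le_lt_trans _ _ (\int[nu]_(z in Z)
   ((K * (ln C + d%:R) ^+ d)%:E + K%:E * (ln `|z| ^+ d)%:E))%E).
  rewrite [leRHS]integral_mkcond; apply: ge0_le_integral => //.
  - by move=> z _; exact: integral_ge0.
  - exact: (measurable_fun_fubini_tonelli_G (m1 := leb_rV d) f mf f0).
  - apply/(measurable_restrictT _ mZ); apply: emeasurable_funD => //.
    apply: measurable_funeM; apply/measurable_EFinP; apply: measurable_funTS.
    apply: measurable_funX; apply: measurableT_comp; first exact: measurable_ln.
    exact: normr_measurable.
  move=> z _; rewrite /leb_rV sigma_finite_ofE /patch /f /=; case: ifPn => zZ.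
    rewrite -EFinM -EFinD; apply: le_trans (inner_le (set_mem zZ)).
    by under eq_integral do rewrite indicE zZ mulr1.
  by under eq_integral do rewrite indicE (negbTE zZ) mulr0; rewrite integral0.
have mln : measurable_fun Z (fun z => (ln `|z| ^+ d)%:E).
  apply/measurable_EFinP/measurable_funTS; apply: measurable_funX.
  by apply: measurableT_comp; [exact: measurable_ln|exact: normr_measurable].
have ln0 z : Z z -> (0 <= (ln `|z| ^+ d)%:E)%E.
  by rewrite /Z/= => z1; rewrite lee_fin exprn_ge0// ln_ge0// ltW.
have K0 : 0 <= K by rewrite exprn_ge0// divr_ge0// ltW.
have c0 : 0 <= K * (ln C + d%:R) ^+ d.
  by rewrite mulr_ge0// exprn_ge0// addr_ge0// ln_ge0.
rewrite ge0_integralD//; last 2 first.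
- by move=> z Zz; rewrite mule_ge0 ?ln0.
- exact: measurable_funeM.
apply: lte_add_pinfty.
  rewrite (integral_cst nu mZ (K * (ln C + d%:R) ^+ d)%:E) lte_mul_pinfty//.
  exact: levy_measure_tail_lty.
by rewrite ge0_integralZl// lte_mul_pinfty.
Qed.

Lemma levy_modulus_kernel_lty (f : 'rV[R]_d -> R) : measurable_fun setT f ->
  (forall s, `|f s| <= C * \prod_i exp_ray l (t 0 i) (s 0 i)) ->
  (\int[lebesgue_rV d]_s levy_modulus nu (f s) < +oo)%E.
Proof.
move=> mf fG; have mlm := measurable_levy_modulus lnu.
apply: (@le_lt_trans _ _ (\int[lebesgue_rV d]_s
  (* The product of rays is at most 1, so it bounds its own square and one integrable function
     controls both |u| and u ^ 2. *)
  ((C + C ^+ 2)%:E * (\prod_i exp_ray l (t 0 i) (s 0 i))%:E +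
   \int[nu]_(z in Z) (Num.min 1 (`|G s| * `|z|))%:E))%E).
  apply: ge0_le_integral => //.
  - by move=> s _; exact: levy_modulus_ge0.
  - exact: measurableT_comp.
  - apply: emeasurable_funD; first by apply: measurable_funeM; exact/measurable_EFinP.
    exact: measurableT_comp (measurable_large_modulus lnu) mG.
  - move=> s _; apply: (@le_trans _ _ (levy_modulus nu (G s))).
      by apply: levy_modulus_le; rewrite [leRHS]ger0_norm//; exact: fG.
    apply: leeD => //; rewrite -EFinM lee_fin ger0_norm// /G.
    have /andP[p0 p1] := prod1 s; rewrite mulrDl lerD2l exprMn ler_wpM2l ?sqr_ge0//.
    by rewrite expr2 ler_piMr.
rewrite ge0_integralD//; last 4 first.
- by move=> s _; rewrite -EFinM lee_fin mulr_ge0 ?addr_ge0 ?sqr_ge0 ?(ltW C0)//; case/andP: (prod1 s).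
- by apply: measurable_funeM; exact/measurable_EFinP.
- by move=> s _; exact: large_modulus_ge0.
- exact: measurableT_comp (measurable_large_modulus lnu) mG.
apply: lte_add_pinfty; last exact: large_lty.
rewrite ge0_integralZl//.
- by rewrite integral_prod -EFinM ltry.
- exact/measurable_EFinP.
- by move=> s _; rewrite lee_fin; case/andP: (prod1 s).
- by rewrite lee_fin addr_ge0 ?sqr_ge0 ?(ltW C0).
Qed.

End kernel_modulus.

(** * Existence of CARMA fields *)

Section gcarma_fields.
Context {R : realType}.

(** The characteristic polynomial of the companion matrix is [a], so its eigenvalues are the roots
    of [a]. *)
Lemma companion_stable p (a : {poly R}) (A : 'M[R]_p) :
  a \is monic -> stable_poly a -> is_companion a A -> stable_mx A.
Proof.
move=> am sa [e ->] z; case: p / e A => A; rewrite castmx_id.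
rewrite eigenvalue_root_char -map_char_poly companionmxK//; exact: sa.
Qed.

Lemma green_mulE p d (A : 'I_d -> 'M[R]_p.+1) (c : 'cV[R]_p.+1) t j :
  (fun s => (green A (t - s) *m c) j 0) = gcarma_kernel c A t j.
Proof.
apply/funext => s; rewrite /green /gcarma_kernel.
under eq_forallb do rewrite !mxE subr_ge0.
case: ifP => _; last by rewrite mul0mx mxE.
by congr ((_ *m c) j 0); apply: eq_bigr => i _; rewrite !mxE.
Qed.

Lemma measurable_gcarma_kernel p d (A : 'I_d -> 'M[R]_p.+1) (c : 'cV[R]_p.+1) t j :
  measurable_fun setT (gcarma_kernel c A t j).
Proof.
rewrite -green_mulE (_ : (fun s => _) = fun s => \sum_k green A (t - s) j k * c k 0).
  apply: measurable_sum => k; apply: measurable_funM => //.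
  apply: (measurableT_comp (measurable_green A j k)); apply: measurable_fun_rV => i.
  rewrite (_ : (fun s => _) = fun s : 'rV[R]_d => t 0 i - s 0 i).
    by apply: measurable_funB => //; exact: measurable_coord.
  by apply/funext => s; rewrite !mxE.
by apply/funext => s; rewrite mxE.
Qed.

Lemma gcarma_kernel_le p d (A : 'I_d -> 'M[R]_p.+1) (c : 'cV[R]_p.+1) t :
  (forall i, stable_mx (A i)) -> exists C l, [/\ 1 <= C, 0 < l & forall j s,
    `|gcarma_kernel c A t j s| <= C * \prod_i exp_ray l (t 0 i) (s 0 i)].
Proof.
move=> /expmx_decays_unif[C0 [l [C00 l0 H]]].
pose D := (\sum_k `|c k 0|) * (p.+1%:R * C0) ^+ d.
have S0 : 0 <= \sum_k `|c k 0| by exact: sumr_ge0.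
have D0 : 0 <= D by rewrite mulr_ge0// exprn_ge0// mulr_ge0// ltW.
(* Adding 1 makes the constant at least 1, hence its logarithm nonnegative in [inner_le]. *)
exists (D + 1), l; split => // [|j s]; first by rewrite lerDr.
have E0 : 0 <= \prod_i exp_ray l (t 0 i) (s 0 i).
  by apply: prodr_ge0 => i _; exact: exp_ray_ge0.
apply: (@le_trans _ _ (D * \prod_i exp_ray l (t 0 i) (s 0 i))); last first.
  by apply: ler_wpM2r => //; rewrite lerDl.
have gE : \prod_(i < d) @green_bound R p C0 l ((t - s) 0 i) =
    (p.+1%:R * C0) ^+ d * \prod_i exp_ray l (t 0 i) (s 0 i).
  rewrite -[X in _ ^+ X]card_ord -prodr_const -big_split/=; apply: eq_bigr => i _.
  rewrite /green_bound /exp_ray !mxE subr_ge0; case: ifP => _; last by rewrite mulr0.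
  by rewrite mulrA.
rewrite -(congr1 (fun f => f s) (green_mulE A c t j)) mxE.
apply: le_trans (ler_norm_sum _ _ _) _; rewrite /D -mulrA -gE mulr_suml.
apply: ler_sum => k _; rewrite normrM mulrC; apply: ler_wpM2l => //.
exact: norm_green (ltW C00) H _ _ _.
Qed.

Context {dT : measure_display} {T : measurableType dT}.
Variables (P : probability T R) (d : nat).
Hypothesis d_gt0 : (0 < d)%N.

(** By [green_mulE] the causal kernel at [t] is the translate of [green A] applied to [c], so the
    field [X] of the causal representation is also the convolution required of a mild solution. *)
Lemma gcarma_mild p (b c : 'cV[R]_p) (A : 'I_d -> 'M[R]_p)
    (beta sigma : R) (nu : {measure set R -> \bar R})
    (L : set 'rV[R]_d -> {RV P >-> R}) :
  gcarma_data A beta sigma nu L ->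
  (forall t j, levy_integrable L (gcarma_kernel c A t j)) /\
  (forall Y : 'rV[R]_d -> {RV P >-> R},
    causal_field b c A L Y -> mild_solution b c A L Y).
Proof.
case: p b c A => [b c A []//|p b c A [_ stA lL logL]].
have lnu : levy_measure nu by case: lL.
split=> [t j|Y [X [intX YX]]].
  have [C [l [C1 l0 H]]] := gcarma_kernel_le c t stA.
  apply: (levy_integrable_modulus lL); first exact: measurable_gcarma_kernel.
  apply: (levy_modulus_kernel_lty lnu d_gt0 logL C1 l0 (t := t)) => //.
  exact: measurable_gcarma_kernel.
exists (green A); split.
- by move=> j k; exact: locally_L1_green.
- exact: fundamental_solution_green.
- by exists X; split => // t j; rewrite green_mulE.
Qed.

Lemma carma_gcarma_data p q (b c : 'cV[R]_p) (A : 'I_d -> 'M[R]_p)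
    (beta sigma : R) (nu : {measure set R -> \bar R})
    (L : set 'rV[R]_d -> {RV P >-> R}) :
  carma_data q b c A beta sigma nu L -> gcarma_data A beta sigma nu L.
Proof.
move=> [[qp _ _ _ HA] lL logL]; split => // [|i]; first exact: leq_ltn_trans qp.
by have [a [am _ sa ca]] := HA i; exact: companion_stable am sa ca.
Qed.

End gcarma_fields.

Theorem theorem3p5 (R : realType) (dT : measure_display)
    (T : measurableType dT) (P : probability T R)
    (P_complete : measure_is_complete P) (d : nat) (d_gt0 : (0 < d)%N) :
  (forall (q p : nat) (b c : 'cV[R]_p) (A : 'I_d -> 'M[R]_p)
      (beta sigma : R) (nu : {measure set R -> \bar R})
      (L : set 'rV[R]_d -> {RV P >-> R}),
    carma_data q b c A beta sigma nu L ->
    (forall t j, levy_integrable L (gcarma_kernel c A t j)) /\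
    (forall Y : 'rV[R]_d -> {RV P >-> R},
      causal_field b c A L Y -> mild_solution b c A L Y)) /\
  (forall (p : nat) (b c : 'cV[R]_p) (A : 'I_d -> 'M[R]_p)
      (beta sigma : R) (nu : {measure set R -> \bar R})
      (L : set 'rV[R]_d -> {RV P >-> R}),
    gcarma_data A beta sigma nu L ->
    (forall t j, levy_integrable L (gcarma_kernel c A t j)) /\
    (forall Y : 'rV[R]_d -> {RV P >-> R},
      causal_field b c A L Y -> mild_solution b c A L Y)).
Proof.
split=> [q p b c A beta sigma nu L /carma_gcarma_data|p b c A beta sigma nu L];
  exact: gcarma_mild.
Qed.
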